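(* Let $\mathbb{K}$ be a field of characteristic $3$ and $n\geq 1$. Let $\mathcal{V}$ be a linear subspace of $M_n(\mathbb{K})$ of dimension $\binom{n}{2}+1$ such that every $M\in\mathcal{V}$ has at most one nonzero eigenvalue in $\overline{\mathbb{K}}$. Then exactly one of the following holds: (i) there exists a non-empty subset $I$ of $\{1,\dots,n\}$ such that $\mathcal{V}$ is similar to $\mathcal{V}^{(1^\star)}_I$; (ii) there exist an exceptional $\overline{1}$-spec subspace $\mathcal{F}$ of $M_3(\mathbb{K})$ and an integer $p\in\{0,\dots,n-3\}$ such that $\mathcal{V}$ is similar to $\mathcal{W}^{(1^\star)}_{p,\mathcal{F}}$; in this case $p$ and the similarity class of $\mathcal{F}$ are uniquely determined by the similarity class of $\mathcal{V}$.
   Context: $\overline{\mathbb{K}}$ is an algebraic closure of $\mathbb{K}$. $\mathrm{NT}_k(\mathbb{K})$ is the space of strictly upper-triangular $k\times k$ matrices; $D_I$ is the diagonal matrix with $(i,i)$ entry $1$ for $i\in I$ and $0$ otherwise; $\mathcal{V}^{(1^\star)}_I:=\mathbb{K}D_I\oplus\mathrm{NT}_n(\mathbb{K})$. A $\overline{1}$-spec subspace of $M_3(\mathbb{K})$ is a linear subspace in which every matrix has at most one eigenvalue in $\overline{\mathbb{K}}$; it is exceptional if it has dimension $4$ and is not similar to $\mathbb{K}I_3\oplus\mathrm{NT}_3(\mathbb{K})$. For subsets $\mathcal{A}\subset M_a(\mathbb{K})$, $\mathcal{B}\subset M_b(\mathbb{K})$, $\mathcal{A}\vee\mathcal{B}$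 is the set of matrices $\begin{bmatrix}A&C\\0&B\end{bmatrix}$ with $A\in\mathcal{A}$, $B\in\mathcal{B}$, $C\in M_{a,b}(\mathbb{K})$ arbitrary (with $\mathrm{NT}_0$ meaning the trivial factor). $\mathcal{W}^{(1^\star)}_{p,\mathcal{F}}:=\mathrm{NT}_p(\mathbb{K})\vee\mathcal{F}\vee\mathrm{NT}_{n-p-3}(\mathbb{K})$. Similar means conjugate by a single invertible matrix. *)

(* Defs.v *)
From HB Require Import structures.
From mathcomp Require Import all_boot all_order all_algebra.
Set Implicit Arguments. Unset Strict Implicit. Unset Printing Implicit Defensive.
Import Order.TTheory GRing.Theory Num.Theory.
Local Open Scope ring_scope.

Section Defs.
Variable K : fieldType.

Definition mx_similar n (A B : 'M[K]_n -> Prop) : Prop :=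
  exists2 P : 'M[K]_n, P \in unitmx &
    forall M : 'M[K]_n, A M <-> B (P *m M *m invmx P).

(* Every matrix of S has at most one NONZERO eigenvalue in an algebraic closure
   (checked in every algebraically closed extension of K). *)
Definition at_most_one_nonzero_eigenvalue n (S : 'M[K]_n -> Prop) : Prop :=
  forall (L : closedFieldType) (f : {rmorphism K -> L}) (M : 'M[K]_n), S M ->
    forall a b : L, a != 0 -> b != 0 ->
      eigenvalue (map_mx f M) a -> eigenvalue (map_mx f M) b -> a = b.

Definition one_spec n (S : 'M[K]_n -> Prop) : Prop :=
  forall (L : closedFieldType) (f : {rmorphism K -> L}) (M : 'M[K]_n), S M ->
    forall a b : L,
      eigenvalue (map_mx f M) a -> eigenvalue (map_mx f M) b -> a = b.

Definition Dmx n (I : {set 'I_n}) : 'M[K]_n :=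
  \matrix_(i, j) ((i == j) && (i \in I))%:R.

(* V^(1star)_I = K D_I (+) NT_n : M - c D_I strictly upper triangular for some c *)
Definition V1star n (I : {set 'I_n}) (M : 'M[K]_n) : Prop :=
  exists c : K, forall i j : 'I_n, (j <= i)%N -> M i j = c * Dmx I i j.

(* block index for the decomposition n = p + 3 + (n - p - 3) *)
Definition bk (p i : nat) : nat := if (i < p)%N then 0%N else if (i < p + 3)%N then 1%N else 2%N.

(* W^(1star)_{p,F} = NT_p \/ F \/ NT_{n-p-3} *)
Definition W1star n (p : nat) (F : {vspace 'M[K]_3}) (M : 'M[K]_n) : Prop :=
  [/\ (forall i j : 'I_n, (bk p j < bk p i)%N -> M i j = 0),
      (forall i j : 'I_n, bk p i != 1%N -> bk p i = bk p j -> (j <= i)%N -> M i j = 0) &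
      exists2 A : 'M[K]_3, A \in F &
        forall i j : 'I_n, bk p i = 1%N -> bk p j = 1%N ->
          M i j = A (inord (i - p)) (inord (j - p))].

Definition exceptional (F : {vspace 'M[K]_3}) : Prop :=
  [/\ \dim F = 4%N, one_spec (fun M => M \in F) &
      ~ mx_similar (fun M => M \in F) (V1star [set: 'I_3])].

End Defs.

(* Main.v *)
Require Import Defs.
From HB Require Import structures.
From mathcomp Require Import boolp classical_sets filter generic_quotient ring_quotient.
From mathcomp Require Import all_boot all_order all_algebra all_field.
From mathcomp Require Import ring zify.
Set Implicit Arguments. Unset Strict Implicit. Unset Printing Implicit Defensive.
Import Order.TTheory GRing.Theory Num.Theory.
Local Open Scope ring_scope.

(* Over an algebraically closed extension of K, a matrix M with at most one nonzero
   eigenvalue t of multiplicity k has tr(M^j) = k t^j, and only k mod 3 matters.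
   Hence tr(M^2) and tr(M^4) are, up to a common sign, (tr M)^2 and (tr M)^4;
   polarizing inside V gives, for M of trace zero, tr(MN) = 0 and quartic trace
   identities.  By tr(MN) = 0 and a count of vectors over the prime field, some
   nonzero x is adapted to V: x phi in V and phi x = 0 imply phi = 0.
   The matrices of V for which x is an eigenvector then act on K^n / x as a space
   of the same kind (a space as in the theorem, or a space of nilpotents of
   dimension C(n-1, 2)), and by dimension they contain enough matrices for the
   quartic identities to lift an invariant line of K^n / x, or an invariant
   3-dimensional block, to an invariant subspace of V itself.  This permits an
   induction on n.  Uniqueness holds because the vectors killed by long products
   of W_{p,F} form the span of the first p basis vectors, dually for rows, and
   because an exceptional space has no invariant line while V_I is triangular. *)

(** * An algebraically closed extension *)

(** In characteristic 3 the trace of M^3 is the cube of the trace, so third powers carry no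
    information and the fourth power is the next one to polarize. A matrix of trace zero need not be
    nilpotent: its nonzero eigenvalue may have multiplicity divisible by 3. This is the source of
    the exceptional spaces: in M_3, a vanishing trace and a vanishing second power sum force the
    three eigenvalues to coincide. The role of an adapted x is uniqueness: a rank one nilpotent v l
    of K^n / x has at most one lift v l + x r in V. The identities give r = s l with one scalar s,
    so v + s x is invariant up to an error along x, which is removed by perturbing with another
    matrix of V. In the triangular case that matrix takes three dimensions in the quotient, so n <=
    3 is done separately; when a block fills the quotient, at n = 4, there are no rank one lifts and
    the matrices of the block replace them. The hypothesis on eigenvalues quantifies over
    algebraically closed extensions of K and is usable only if there is one. *)

Section GeneratedSubfield.
Variables (K : fieldType) (S : seq K).

(** Each stage of the closure is a finite list, so an element is coded by a stage and a position.
    This makes the generated subfield countable, as [countable_algebraic_closure] demands. *)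
Fixpoint gen_step (k : nat) : seq K :=
  if k is k'.+1 then
    let s := gen_step k' in
    s ++ [seq x - y | x <- s, y <- s] ++ [seq x / y | x <- s, y <- s]
  else 1 :: S.

Definition gen_pred : pred K := fun x => `[< exists k, x \in gen_step k >].

Lemma gen_stepS k l : {subset gen_step k <= gen_step (k + l)}.
Proof.
elim: l => [|l IH] x; first by rewrite addn0.
by move/IH; rewrite addnS /= mem_cat => ->.
Qed.

Lemma gen_common x y : gen_pred x -> gen_pred y ->
  exists k, x \in gen_step k /\ y \in gen_step k.
Proof.
move=> /asboolP[k xk] /asboolP[l yl]; exists (k + l)%N.
by split; [exact: gen_stepS | rewrite addnC; exact: gen_stepS].
Qed.

Lemma gen_closed : divring_closed gen_pred.
Proof.
split=> [|x y|x y].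
- by apply/asboolP; exists 0; rewrite inE eqxx.
- move=> gx gy; have [k [xk yk]] := gen_common gx gy; apply/asboolP; exists k.+1.
  by rewrite /= !mem_cat (allpairs_f (fun a b => a - b)) // orbT.
- move=> gx gy; have [k [xk yk]] := gen_common gx gy; apply/asboolP; exists k.+1.
  by rewrite /= !mem_cat (allpairs_f (fun a b => a / b)) // !orbT.
Qed.

HB.instance Definition _ := GRing.isDivringClosed.Build K gen_pred gen_closed.

Record genF := GenF { genval :> K; _ : genval \in gen_pred }.
HB.instance Definition _ := [isSub for genval].
HB.instance Definition _ := [Choice of genF by <:].
HB.instance Definition _ := [SubChoice_isSubComUnitRing of genF by <:].
HB.instance Definition _ := [SubComUnitRing_isSubIntegralDomain of genF by <:].
HB.instance Definition _ := [SubIntegralDomain_isSubField of genF by <:].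

Lemma gen_ex (x : genF) : exists k, val x \in gen_step k.
Proof. by case: x => x /= /asboolP. Qed.

Definition gen_pickle (x : genF) : nat :=
  let k := ex_minn (gen_ex x) in pickle (k, index (val x) (gen_step k)).
Definition gen_unpickle (m : nat) : option genF :=
  if unpickle m is Some (k, i) then insub (nth 0 (gen_step k) i) else None.

Lemma gen_pickleK : pcancel gen_pickle gen_unpickle.
Proof.
move=> x; rewrite /gen_pickle /gen_unpickle pickleK; case: ex_minnP => k xk _.
by rewrite nth_index // valK.
Qed.

HB.instance Definition _ := Choice_isCountable.Build genF gen_pickleK.

Lemma gen_mem x : x \in S -> x \in gen_pred.
Proof. by move=> xS; apply/asboolP; exists 0; rewrite /= inE xS orbT. Qed.

End GeneratedSubfield.

(** * The ultraproduct of the closures of the finitely generated subfields *)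

Section Ultraproduct.
Local Open Scope quotient_scope.
Variable K : fieldType.

Definition gen_closure (S : seq K) : closedFieldType :=
  projT1 (countable_algebraic_closure (genF S)).

Definition gen_emb (S : seq K) : {rmorphism genF S -> gen_closure S} :=
  sval (projT2 (countable_algebraic_closure (genF S))).

(* Junk value 0 outside the subfield generated by S. *)
Definition pemb (S : seq K) (x : K) : gen_closure S :=
  if insub x is Some y then gen_emb S y else 0.

Definition uprod := forall S : seq K, gen_closure S.
HB.instance Definition _ := gen_eqMixin uprod.
HB.instance Definition _ := gen_choiceMixin uprod.

Let uaddA : associative (fun (u v : uprod) (S : seq K) => u S + v S).
Proof. by move=> u v w; apply: functional_extensionality_dep => S; rewrite addrA. Qed.
Let uaddC : commutative (fun (u v : uprod) (S : seq K) => u S + v S).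
Proof. by move=> u v; apply: functional_extensionality_dep => S; rewrite addrC. Qed.
Let uadd0 : left_id (fun S => 0 : gen_closure S)
  (fun (u v : uprod) (S : seq K) => u S + v S).
Proof. by move=> u; apply: functional_extensionality_dep => S; rewrite add0r. Qed.
Let uaddN : left_inverse (fun S => 0 : gen_closure S) (fun (u : uprod) S => - u S)
  (fun (u v : uprod) (S : seq K) => u S + v S).
Proof. by move=> u; apply: functional_extensionality_dep => S; rewrite addNr. Qed.
HB.instance Definition _ := GRing.isZmodule.Build uprod uaddA uaddC uadd0 uaddN.

Let umulA : associative (fun (u v : uprod) (S : seq K) => u S * v S).
Proof. by move=> u v w; apply: functional_extensionality_dep => S; rewrite mulrA. Qed.
Let umulC : commutative (fun (u v : uprod) (S : seq K) => u S * v S).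
Proof. by move=> u v; apply: functional_extensionality_dep => S; rewrite mulrC. Qed.
Let umul1 : left_id (fun S => 1 : gen_closure S)
  (fun (u v : uprod) (S : seq K) => u S * v S).
Proof. by move=> u; apply: functional_extensionality_dep => S; rewrite mul1r. Qed.
Let umulD : left_distributive (fun (u v : uprod) (S : seq K) => u S * v S) +%R.
Proof. by move=> u v w; apply: functional_extensionality_dep => S; rewrite mulrDl. Qed.
Let uone_neq0 : (fun S => 1 : gen_closure S) != 0 :> uprod.
Proof.
by apply/eqP => /(congr1 (fun u : uprod => u [::])) /eqP; apply/negP; exact: oner_neq0.
Qed.
HB.instance Definition _ :=
  GRing.Zmodule_isComNzRing.Build uprod umulA umulC umul1 umulD uone_neq0.

(** For an ultrafilter containing the cones, almost every S contains any given finite set of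
    elements of K. *)
Definition cones : set_system (seq K) :=
  fun A => exists S0 : seq K, forall S, {subset S0 <= S} -> A S.

Lemma cones_proper : ProperFilter cones.
Proof.
split; first by case=> S0 /(_ S0 (fun _ h => h)).
split=> [|A B [S hS] [T hT]|A B AB [S hS]].
- by exists [::].
- exists (S ++ T) => W hW; split=> /=; [apply: hS|apply: hT] => x xS; apply: hW;
  by rewrite mem_cat xS ?orbT.
- by exists S => W /hS /AB.
Qed.

Let uf : set_system (seq K) := sval (cid (ultraFilterLemma cones_proper)).
Let uf_ultra : UltraFilter uf := proj1 (svalP (cid (ultraFilterLemma cones_proper))).
#[local] Existing Instance uf_ultra.
Let uf_cones A : cones A -> uf A := proj2 (svalP (cid (ultraFilterLemma cones_proper))) A.

Definition null_pred : pred uprod := fun u => `[< uf (fun S => u S = 0) >].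

Lemma null_closed : idealr_closed null_pred.
Proof.
split.
- by apply/asboolP; apply: (filterS _ filterT) => S _.
- apply/negP => /asboolP h; apply: (@filter_not_empty _ uf).
  by apply: filterS h => S /= /eqP; rewrite oner_eq0.
- move=> a u v /asboolP hu /asboolP hv; apply/asboolP.
  apply: filterS (filterI hu hv) => S [/= uS vS].
  by rewrite -[(a * u + v) S]/(a S * u S + v S) uS vS mulr0 addr0.
Qed.
HB.instance Definition _ := isIdealr.Build uprod null_pred null_closed.

Definition null_ideal : idealr uprod := null_pred.
Definition ultraprod := {ideal_quot null_ideal}.
HB.instance Definition _ := GRing.ComNzRing.on ultraprod.

Let pi (u : uprod) : ultraprod := \pi_ultraprod u.

Let pi0 u : (pi u == 0) = null_pred u.
Proof.
rewrite /pi; have -> : (0 : ultraprod) = \pi_ultraprod 0 by rewrite rmorph0.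
by rewrite -Quotient.idealrBE subr0.
Qed.
Let pi_eq (u v : uprod) : uf (fun S => u S = v S) -> pi u = pi v.
Proof.
move=> h; apply/eqP; rewrite /pi -Quotient.idealrBE; apply/asboolP.
by apply: filterS h => S /= e; rewrite -[(u - v) S]/(u S - v S) e subrr.
Qed.

Let ev (x : ultraprod) : uprod := repr x.
Let evK x : pi (ev x) = x.
Proof. exact: reprK. Qed.

Definition uinv (x : ultraprod) : ultraprod := pi (fun S => (ev x S)^-1).

Let umulV x : x != 0 -> uinv x * x = 1.
Proof.
move=> nx; rewrite -{2}[x]evK /uinv /pi -rmorphM -(rmorph1 (\pi_ultraprod)).
(* Ultrafilter dichotomy: the representative vanishes almost everywhere, and then x = 0, or it is
   nonzero almost everywhere, and there the componentwise inverse works. *)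
apply: pi_eq; have /= [h|h] := in_ultra_setVsetC (fun S => ev x S = 0) uf_ultra.
  by case/negP: nx; rewrite -[x]evK pi0; apply/asboolP.
by apply: filterS h => S /= /eqP hS; apply: mulVf.
Qed.
Let uinv0 : uinv 0 = 0.
Proof.
apply/eqP; rewrite pi0; apply/asboolP.
have: (pi (ev 0) == 0) by rewrite evK.
by rewrite pi0 => /asboolP; apply: filterS => S /= ->; rewrite invr0.
Qed.
HB.instance Definition _ := GRing.ComNzRing_isField.Build ultraprod umulV uinv0.

(** A monic equation is solved in each component, by choice, and the class of the solutions is a
    root. *)
Let uclosed : GRing.closed_field_axiom ultraprod.
Proof.
move=> n P n_gt0.
have ex S : exists x : gen_closure S, x ^+ n = \sum_(i < n) ev (P i) S * x ^+ i.
  exact: (@solve_monicpoly (gen_closure S) n (fun i => ev (P i) S)).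
pose u : uprod := fun S => sval (cid (ex S)).
have uX k S : (u ^+ k) S = u S ^+ k.
  by elim: k => // k IH; rewrite !exprS -IH.
exists (pi u).
under eq_bigr => i _ do rewrite -[P i]evK /pi -rmorphXn -rmorphM.
rewrite /pi -rmorphXn -rmorph_sum; congr (\pi_ultraprod _).
apply: functional_extensionality_dep => S; rewrite uX.
have -> : u S ^+ n = \sum_(i < n) ev (P i) S * u S ^+ i := svalP (cid (ex S)).
rewrite -[RHS]/((fun u : uprod => u S) _).
elim/big_rec2: _ => // i a b _ ->.
by rewrite -[RHS]/((ev (P i) : uprod) S * (u ^+ i) S + a S) uX.
Qed.
HB.instance Definition _ := Field_isAlgClosed.Build ultraprod uclosed.

Definition uemb (x : K) : ultraprod := pi (fun S => pemb S x).

Let pembE (S : seq K) x (h : x \in gen_pred S) : pemb S x = gen_emb S (GenF h).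
Proof. by rewrite /pemb insubT. Qed.

(** [pemb S] respects the operations only on the subfield generated by S; for a given pair x, y this
    covers the cone of all S that contain both. *)
Let uembB : zmod_morphism uemb.
Proof.
move=> x y; rewrite /uemb /pi -rmorphB; apply: pi_eq; apply: uf_cones.
exists [:: x; y] => S sub.
have xS : x \in gen_pred S by apply/gen_mem/sub; rewrite !inE eqxx.
have yS : y \in gen_pred S by apply/gen_mem/sub; rewrite !inE eqxx orbT.
have xyS : x - y \in gen_pred S by rewrite rpredB.
rewrite -[RHS]/(pemb S x - pemb S y) !pembE -rmorphB; congr (gen_emb S _).
exact: val_inj.
Qed.
Let uembM : monoid_morphism uemb.
Proof.
split=> [|x y]; rewrite /uemb /pi.
  rewrite -(rmorph1 (\pi_ultraprod)); apply: pi_eq; apply: uf_cones; exists [::] => S _.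
  have g1 : 1 \in gen_pred S by exact: rpred1.
  rewrite (pembE g1) -[RHS]/(1 : gen_closure S) -[RHS](rmorph1 (gen_emb S)); congr (gen_emb S _).
  exact: val_inj.
rewrite -rmorphM; apply: pi_eq; apply: uf_cones.
exists [:: x; y] => S sub.
have xS : x \in gen_pred S by apply/gen_mem/sub; rewrite !inE eqxx.
have yS : y \in gen_pred S by apply/gen_mem/sub; rewrite !inE eqxx orbT.
have xyS : x * y \in gen_pred S by rewrite rpredM.
rewrite -[RHS]/(pemb S x * pemb S y) !pembE -rmorphM; congr (gen_emb S _).
exact: val_inj.
Qed.
HB.instance Definition _ := GRing.isZmodMorphism.Build K ultraprod uemb uembB.
HB.instance Definition _ := GRing.isMonoidMorphism.Build K ultraprod uemb uembM.

(** Provides the field L in which all eigenvalues are taken. *)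
Lemma exists_closed_extension : exists L : closedFieldType, inhabited {rmorphism K -> L}.
Proof. by exists ultraprod; constructor; exact: uemb. Qed.

End Ultraproduct.

(** * Completing columns to a basis; eigenvalues under conjugation and in blocks *)

Section Completion.
Variable F : fieldType.

(** In the rank factorization z = C E R, full column rank makes E the column of blocks 1, 0. The
    matrix P undoes C and then applies the inverse of R to the top block. *)
Lemma complete_columns d k (z : 'M[F]_(d + k, d)) : \rank z = d ->
  exists2 P, P \in unitmx & P *m z = col_mx 1%:M 0.
Proof.
move=> rz; have ruz : row_ebase z \in unitmx := row_ebase_unit z.
exists (block_mx (invmx (row_ebase z)) 0 0 1%:M *m invmx (col_ebase z)).
  rewrite unitmx_mul unitmx_inv col_ebase_unit andbT.
  by rewrite unitmxE det_ublock det1 mulr1 -unitmxE unitmx_inv.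
rewrite -mulmxA -{3}(mulmx_ebase z) rz -!mulmxA mulKmx ?col_ebase_unit //.
have -> : pid_mx d = col_mx 1%:M 0 :> 'M[F]_(d + k, d).
  by rewrite -[LHS]vsubmxK; congr col_mx; apply/matrixP => i j; rewrite !mxE /=;
    [rewrite ltn_ord andbT | rewrite gtn_eqF // ltn_addr].
rewrite (mul_col_mx 1%:M 0 (row_ebase z)) mul1mx mul0mx mul_block_col mulVmx // !mul0mx !mulmx0.
by rewrite !addr0.
Qed.

Lemma complete_column k (e : 'cV[F]_(1 + k)) : e != 0 ->
  exists2 P, P \in unitmx & P *m e = col_mx 1%:M 0.
Proof.
move=> ne; apply: complete_columns; apply/eqP.
by rewrite eqn_leq rank_leq_col lt0n mxrank_eq0.
Qed.

Lemma stable_block d k (P M : 'M[F]_(d + k)) (z : 'M_(d + k, d)) A :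
  P \in unitmx -> P *m z = col_mx 1%:M 0 -> M *m z = z *m A ->
  ulsubmx (P *m M *m invmx P) = A /\ dlsubmx (P *m M *m invmx P) = 0.
Proof.
move=> uP Pz Mz; set M' := P *m M *m invmx P.
have : M' *m col_mx 1%:M 0 = col_mx A 0.
  by rewrite -Pz /M' mulmxA mulmxKV // -mulmxA Mz mulmxA Pz mul_col_mx mul1mx mul0mx.
rewrite -[M']submxK mul_block_col !mulmx0 !mulmx1 !addr0 => /eq_col_mx[-> ->].
by rewrite block_mxKul block_mxKdl.
Qed.

Lemma eigenvalue_det n (M : 'M[F]_n) a : eigenvalue M a = (\det (M - a%:M) == 0).
Proof. by rewrite /eigenvalue /eigenspace kermx_eq0 row_free_unit unitmxE unitfE negbK. Qed.

Lemma eigenvalue_col n (M : 'M[F]_n) a :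
  eigenvalue M a -> exists2 z : 'cV_n, z != 0 & M *m z = a *: z.
Proof.
rewrite eigenvalue_det -det_tr => /det0P[v nv]; rewrite linearB /= tr_scalar_mx mulmxBr.
move=> /eqP; rewrite subr_eq0 => /eqP e; exists v^T; first by rewrite trmx_eq0.
by apply: trmx_inj; rewrite trmx_mul trmxK e mul_mx_scalar linearZ /= trmxK.
Qed.

Lemma eigenvalue_conj n (P M : 'M[F]_n) a :
  P \in unitmx -> eigenvalue (P *m M *m invmx P) a = eigenvalue M a.
Proof.
move=> uP; rewrite !eigenvalue_det.
have -> : P *m M *m invmx P - a%:M = P *m (M - a%:M) *m invmx P.
  by rewrite mulmxBr mulmxBl scalar_mxC -(mulmxA a%:M) mulmxV // mulmx1.
by rewrite !det_mulmx mulrC mulrA -det_mulmx mulVmx // det1 mul1r.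
Qed.

Lemma eigenvalue_ublock d k (A : 'M[F]_d) B (D : 'M_k) a :
  eigenvalue (block_mx A B 0 D) a = eigenvalue A a || eigenvalue D a.
Proof.
by rewrite !eigenvalue_det scalar_mx_block opp_block_mx add_block_mx !oppr0 !addr0
  det_ublock mulf_eq0.
Qed.

Lemma eigenvalue_shift n (M : 'M[F]_n) a c :
  eigenvalue (M + c%:M) a = eigenvalue M (a - c).
Proof. by rewrite !eigenvalue_det raddfB /= opprB addrA. Qed.

Lemma eigenvalue_scale n (M : 'M[F]_n) a c :
  eigenvalue M a -> eigenvalue (c *: M) (c * a).
Proof.
by move=> /eigenvalueP[v h nv]; apply/eigenvalueP; exists v => //;
   rewrite -scalemxAr h scalerA.
Qed.

Lemma eigenvalue_scalar1 (c a : F) : eigenvalue (c%:M : 'M_1) a = (a == c).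
Proof. by rewrite eigenvalue_det -raddfB /= det_scalar1 subr_eq0 eq_sym. Qed.

End Completion.

Lemma eigenvalue_exists (L : closedFieldType) n (M : 'M[L]_n.+1) : exists a, eigenvalue M a.
Proof.
have [|a ra] := @closed_rootP L (char_poly M) _; first by rewrite size_char_poly.
by exists a; rewrite eigenvalue_root_char.
Qed.

(** Triangularization, one eigenvector at a time; s lists the eigenvalues with multiplicity. *)
Lemma trace_eigenvalues (L : closedFieldType) n (M : 'M[L]_n) : exists s : seq L,
  [/\ size s = n, (forall x, (x \in s) = eigenvalue M x) &
      [/\ \tr M = \sum_(x <- s) x, \tr (M *m M) = \sum_(x <- s) x ^+ 2 &
          \tr (M *m M *m (M *m M)) = \sum_(x <- s) x ^+ 4]].
Proof.
elim: n M => [|n IH] M.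
  exists [::]; split=> //; last by split; rewrite big_nil /mxtrace big_ord0.
  by move=> x; rewrite eigenvalue_det det_mx00 oner_eq0.
have [a /[dup] ea /eigenvalue_col[z nz Mz]] := eigenvalue_exists M.
have [P uP Pz] := @complete_column _ n z nz.
have := stable_block uP Pz (_ : M *m z = z *m a%:M).
rewrite mul_mx_scalar => /(_ Mz) [].
set M' := P *m M *m invmx P => ul dl.
have tc (X : 'M[L]_(1 + n)) : \tr X = \tr (P *m X *m invmx P).
  by rewrite mxtrace_mulC mulmxA mulVmx // mul1mx.
have cc (X Y : 'M[L]_(1 + n)) :
  P *m (X *m Y) *m invmx P = (P *m X *m invmx P) *m (P *m Y *m invmx P).
  by rewrite !mulmxA mulmxKV.
have M'E : M' = block_mx a%:M (ursubmx M') 0 (drsubmx M') by rewrite -ul -dl submxK.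
have [s [sz es [t1 t2 t4]]] := IH (drsubmx M').
exists (a :: s); split.
- by rewrite /= sz.
- move=> x; rewrite inE es; move: (eigenvalue_ublock a%:M (ursubmx M') (drsubmx M') x).
  by rewrite -M'E /M' (eigenvalue_conj (M : 'M_(1 + n))) // eigenvalue_scalar1.
- rewrite !big_cons -t1 -t2 -t4 (tc M) (tc (M *m M)) (tc (_ *m (M *m M))) !cc -/M'.
  move: M'E; move: (ursubmx M') (drsubmx M') => C B ->.
  rewrite !mulmx_block !mul0mx !mulmx0 !addr0 !add0r !mulmx0 !mul0mx !addr0 !add0r.
  by rewrite -!scalar_mxM !mxtrace_block !mxtrace_scalar !mulr1n !exprS expr0 !mulr1 !mulrA.
Qed.

(** * Traces of matrices with one nonzero eigenvalue *)

Section SpectrumInClosure.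
Variables (K : fieldType) (L : closedFieldType) (f : {rmorphism K -> L}).
Hypothesis ch3 : 3%N \in [pchar K].

Definition ev n (M : 'M[K]_n) (a : L) := eigenvalue (map_mx f M) a.

Definition spec1 n (M : 'M[K]_n) :=
  forall a b : L, a != 0 -> b != 0 -> ev M a -> ev M b -> a = b.

Definition nil_spec n (M : 'M[K]_n) := forall a : L, ev M a -> a = 0.

Lemma three0 : 3%:R = 0 :> K. Proof. exact: pcharf0 ch3. Qed.

Lemma two_eqN1 : 2%:R = -1 :> K.
Proof. by apply/eqP; rewrite -subr_eq0 opprK natr1 three0. Qed.

Lemma three0L : 3%:R = 0 :> L.
Proof. by rewrite -(rmorph_nat f) three0 rmorph0. Qed.

Lemma two_neq0 : 2%:R != 0 :> K. Proof. by rewrite two_eqN1 oppr_eq0 oner_eq0. Qed.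

Lemma two_neq0L : 2%:R != 0 :> L.
Proof. by rewrite -(rmorph_nat f) fmorph_eq0 two_neq0. Qed.

Lemma opp_neq (x : L) : x != 0 -> x != - x.
Proof. by rewrite -addr_eq0 -mulr2n -mulr_natl mulf_eq0 (negbTE two_neq0L). Qed.

Lemma evP n (M : 'M[K]_n) a : ev M a = (\det (map_mx f M - a%:M) == 0).
Proof. exact: eigenvalue_det. Qed.

Lemma ev_conj n (P M : 'M[K]_n) a : P \in unitmx -> ev (P *m M *m invmx P) a = ev M a.
Proof. by move=> uP; rewrite /ev !map_mxM map_invmx eigenvalue_conj // map_unitmx. Qed.

Lemma ev_ublock d k (A : 'M[K]_d) B (D : 'M_k) a :
  ev (block_mx A B 0 D) a = ev A a || ev D a.
Proof. by rewrite /ev map_block_mx map_mx0 eigenvalue_ublock. Qed.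

Lemma ev_shift n (M : 'M[K]_n) a c : ev (M + c%:M) a = ev M (a - f c).
Proof. by rewrite /ev map_mxD map_scalar_mx eigenvalue_shift. Qed.

Lemma ev_scale n (M : 'M[K]_n) a c : ev M a -> ev (c *: M) (f c * a).
Proof. by rewrite /ev map_mxZ; exact: eigenvalue_scale. Qed.

Lemma ev_scalar1 (c : K) a : ev (c%:M : 'M_1) a = (a == f c).
Proof. by rewrite /ev map_scalar_mx eigenvalue_scalar1. Qed.

Lemma ev_exists n (M : 'M[K]_n.+1) : exists a, ev M a.
Proof. exact: eigenvalue_exists. Qed.

Lemma spec1_conj n (P M : 'M[K]_n) : P \in unitmx -> spec1 M -> spec1 (P *m M *m invmx P).
Proof. by move=> uP h a b na nb; rewrite !ev_conj //; exact: h. Qed.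

Lemma spec1_ul d k (A : 'M[K]_d) B (D : 'M_k) : spec1 (block_mx A B 0 D) -> spec1 A.
Proof. by move=> h a b na nb ea eb; apply: h => //; rewrite ev_ublock ?ea ?eb. Qed.

Lemma spec1_dr d k (A : 'M[K]_d) B (D : 'M_k) : spec1 (block_mx A B 0 D) -> spec1 D.
Proof. by move=> h a b na nb ea eb; apply: h => //; rewrite ev_ublock ?ea ?eb orbT. Qed.

Lemma spec1_cross d k (A : 'M[K]_d) B (D : 'M_k) a b : spec1 (block_mx A B 0 D) ->
  a != 0 -> b != 0 -> ev A a -> ev D b -> a = b.
Proof. by move=> h na nb ea eb; apply: h => //; rewrite ev_ublock ?ea ?eb ?orbT. Qed.

(** k counts the occurrences of lam; exponents start at 1 so that the zeros contribute nothing. *)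
Lemma sum_two_values (s : seq L) lam : (forall x, x \in s -> x = 0 \/ x = lam) ->
  exists k : nat, forall j, \sum_(x <- s) x ^+ j.+1 = k%:R * lam ^+ j.+1.
Proof.
elim: s => [|x s IH] h; first by exists 0 => j; rewrite big_nil mul0r.
have [|k hk] := IH; first by move=> y ys; apply: h; rewrite inE ys orbT.
have [->|->] := h x (mem_head _ _).
  by exists k => j; rewrite big_cons expr0n add0r hk.
by exists k.+1 => j; rewrite big_cons hk -natr1 mulrDl mul1r addrC.
Qed.

Definition p2 n (M : 'M[K]_n) := \tr (M *m M).
Definition p4 n (M : 'M[K]_n) := \tr (M *m M *m (M *m M)).

(* The multiplicity k of the nonzero eigenvalue lam enters the power sums k lam^j
   only mod 3, whence the sign. *)
Lemma spec1_traces n (M : 'M[K]_n) : spec1 M ->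
  exists s : bool, p2 M = (-1) ^+ s * \tr M ^+ 2 /\ p4 M = (-1) ^+ s * \tr M ^+ 4.
Proof.
move=> h; have [s [_ es [t1 t2 t4]]] := trace_eigenvalues (map_mx f M).
have [lam hl] : exists lam, forall x, x \in s -> x = 0 \/ x = lam.
  have [/hasP[x xs nx]|/hasPn z] := boolP (has (fun x => x != 0) s).
    exists x => y ys; have [->|ny] := eqVneq y 0; [by left|right].
    by apply: h => //; rewrite /ev -es.
  by exists 0 => x /z /negbNE/eqP; left.
have [k hk] := sum_two_values hl.
have s1 : \sum_(x <- s) x = k%:R * lam by rewrite -[lam]expr1 -hk.
move: t1 t2 t4; rewrite s1 !hk => t1 t2 t4.
have kE : k%:R = (k %% 3)%:R :> L.
  by rewrite {1}(divn_eq k 3) natrD natrM three0L mulr0 add0r.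
have {}kE : exists s : bool, k%:R ^+ 2 = (-1) ^+ s * k%:R :> L /\
     k%:R ^+ 4 = (-1) ^+ s * k%:R :> L.
  rewrite kE; have : (k %% 3 < 3)%N by rewrite ltn_mod.
  have e2 : 2%:R = -1 :> L by rewrite -(rmorph_nat f) two_eqN1 rmorphN1.
  case: (k %% 3)%N => [|[|[|//]]] _; [exists false|exists false|exists true].
  - by rewrite !expr0n mulr0.
  - by rewrite !expr1n mulr1.
  - by rewrite e2 /=; split; ring.
have inj : injective f := fmorph_inj f.
have [e [e2 e4]] := kE; exists e; rewrite /p2 /p4; split; apply: inj.
- rewrite rmorphM rmorph_sign rmorphXn -!trace_map_mx !map_mxM t2 t1 exprMn e2.
  by rewrite !mulrA -exprD addnn -mul2n exprM sqrrN !expr1n mul1r.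
- rewrite rmorphM rmorph_sign rmorphXn -!trace_map_mx !map_mxM t4 t1 exprMn e4.
  by rewrite !mulrA -exprD addnn -mul2n exprM sqrrN !expr1n mul1r.
Qed.

Lemma spec1_tr0 n (M : 'M[K]_n) : spec1 M -> \tr M = 0 -> p2 M = 0 /\ p4 M = 0.
Proof. by move=> /spec1_traces[s [-> ->]] ->; rewrite !expr0n !mulr0. Qed.

End SpectrumInClosure.

Section TraceIdentities.
Variables (K : fieldType) (L : closedFieldType) (f : {rmorphism K -> L}).
Hypothesis ch3 : 3%N \in [pchar K].
Variables (n : nat) (V : {vspace 'M[K]_n}).
Hypothesis hV : forall M, M \in V -> spec1 f M.

Let trM (A B : 'M[K]_n) : \tr (A *m B) = \tr (B *m A) := mxtrace_mulC A B.

Lemma p2D (M N : 'M[K]_n) : p2 (N + M) = p2 N + 2%:R * \tr (M *m N) + p2 M.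
Proof. by rewrite /p2 mulmxDl !mulmxDr !mxtraceD (trM N M); ring. Qed.

Lemma p2B (M N : 'M[K]_n) : p2 (N - M) = p2 N - 2%:R * \tr (M *m N) + p2 M.
Proof. by rewrite p2D /p2 mulNmx mulmxN mulNmx opprK !linearN /=; ring. Qed.

(** N, N + M and N - M have the same trace t, so [p2] takes at each of them one of the two values
    t^2 and - t^2. Two of the three values agree, and any two of them differ by a nonzero multiple
    of tr(MN). *)
Lemma spec1_tr_mul0 M N : M \in V -> N \in V -> \tr M = 0 -> \tr (M *m N) = 0.
Proof.
move=> MV NV tM; have [p2M p4M] := spec1_tr0 ch3 (hV MV) tM.
have t1 : \tr (N + M) = \tr N by rewrite mxtraceD tM addr0.
have t2 : \tr (N - M) = \tr N by rewrite linearB /= tM subr0.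
have [s0 [e0 _]] := spec1_traces ch3 (hV NV).
have [s1 [e1 _]] := spec1_traces ch3 (hV (memvD NV MV)).
have [s2 [e2 _]] := spec1_traces ch3 (hV (memvB NV MV)).
move: e0 e1 e2; rewrite p2D p2B t1 t2 p2M !addr0 => -> e1 e2.
set b := \tr (M *m N) in e1 e2 *; set t := \tr N in e1 e2.
have nz2 := two_neq0 ch3.
have q (x : K) : 2%:R * x = 0 -> x = 0.
  by move=> /eqP; rewrite mulf_eq0 (negbTE nz2) => /eqP.
have c1 (x : K) : x + 2%:R * b = x -> b = 0.
  by move=> /eqP; rewrite -subr_eq0 addrAC subrr add0r => /eqP/q.
have c2 (x : K) : x - 2%:R * b = x -> b = 0.
  by move=> /eqP; rewrite -subr_eq0 addrAC subrr add0r oppr_eq0 => /eqP/q.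
have c3 (x y : K) : x + 2%:R * b = y -> x - 2%:R * b = y -> b = 0.
  by move=> h1 h2; apply/q/q; rewrite -(subrr y) -{1}h1 -h2; ring.
by case: s0 s1 s2 e1 e2 => [] [] [] e1 e2;
  first [exact: c1 e1 | exact: c2 e2 | exact: c3 e1 e2].
Qed.

(** The sign at N + M may differ from the sign at N when the trace vanishes. Hence the equality of
    the signed squares of the trace is used, multiplied by (tr N)^2, rather than an equality of
    signs. *)
Lemma spec1_p4D M N : M \in V -> N \in V -> \tr M = 0 -> p4 (N + M) = p4 N.
Proof.
move=> MV NV tM; have [p2M p4M] := spec1_tr0 ch3 (hV MV) tM.
have t1 : \tr (N + M) = \tr N by rewrite mxtraceD tM addr0.
have [s0 [e0 f0]] := spec1_traces ch3 (hV NV).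
have [s1 [e1 f1]] := spec1_traces ch3 (hV (memvD NV MV)).
move: e1 f1; rewrite f0 t1 p2D (spec1_tr_mul0 MV NV tM) p2M mulr0 !addr0 e0 => e1 ->.
have -> : \tr N ^+ 4 = \tr N ^+ 2 * \tr N ^+ 2 by ring.
by rewrite (mulrA ((-1) ^+ s1)) (mulrA ((-1) ^+ s0)) e1.
Qed.

Lemma p4D (M N : 'M[K]_n) : p4 (N + M) = p4 N + p4 M
  + 4%:R * \tr (N *m N *m (M *m M)) + 2%:R * \tr (N *m M *m (N *m M))
  + 4%:R * (\tr (N *m N *m (N *m M)) + \tr (N *m M *m (M *m M))).
Proof.
have sq : (N + M) *m (N + M) = (N *m N + M *m M) + (N *m M + M *m N).
  by rewrite mulmxDl !mulmxDr [M *m N + _]addrC addrACA.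
rewrite /p4 sq; set A := N *m N + M *m M; set B := N *m M + M *m N.
have -> : \tr ((A + B) *m (A + B)) = \tr (A *m A) + 2%:R * \tr (B *m A) + \tr (B *m B).
  exact: p2D.
rewrite (trM B A).
have tA : \tr (A *m A) = \tr (N *m N *m (N *m N)) + \tr (M *m M *m (M *m M))
  + 2%:R * \tr (N *m N *m (M *m M)).
  by rewrite mulmxDl !mulmxDr !mxtraceD (trM (M *m M) (N *m N)); ring.
have tB : \tr (B *m B) = 2%:R * \tr (N *m M *m (N *m M)) + 2%:R * \tr (N *m N *m (M *m M)).
  rewrite mulmxDl !mulmxDr !mxtraceD.
  have -> : \tr (M *m N *m (M *m N)) = \tr (N *m M *m (N *m M)).
    by rewrite -!mulmxA trM !mulmxA.
  have -> : \tr (N *m M *m (M *m N)) = \tr (N *m N *m (M *m M)).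
    by rewrite !mulmxA trM !mulmxA.
  have -> : \tr (M *m N *m (N *m M)) = \tr (N *m N *m (M *m M)).
    by rewrite -!mulmxA trM !mulmxA.
  ring.
have tAB : \tr (A *m B) = 2%:R * (\tr (N *m N *m (N *m M)) + \tr (N *m M *m (M *m M))).
  rewrite mulmxDl !mulmxDr !mxtraceD.
  have -> : \tr (N *m N *m (M *m N)) = \tr (N *m N *m (N *m M)).
    by rewrite !mulmxA trM !mulmxA.
  have -> : \tr (M *m M *m (N *m M)) = \tr (N *m M *m (M *m M)) by rewrite trM.
  have -> : \tr (M *m M *m (M *m N)) = \tr (N *m M *m (M *m M)).
    by rewrite !mulmxA trM !mulmxA.
  ring.
by rewrite tA tB tAB; ring.
Qed.

Lemma p4N (M : 'M[K]_n) : p4 (- M) = p4 M.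
Proof. by rewrite /p4; have -> : - M *m - M = M *m M by rewrite mulmxN mulNmx opprK. Qed.

(** [spec1_p4D] holds for M and for -M, so the parts of the expansion that are even and odd in M
    vanish separately; modulo 3 the coefficients 4 and 2 become 1 and -1. *)
Lemma spec1_quartic M N : M \in V -> N \in V -> \tr M = 0 ->
  \tr (N *m N *m (M *m M)) = \tr (N *m M *m (N *m M)) /\
  \tr (N *m N *m (N *m M)) + \tr (N *m M *m (M *m M)) = 0.
Proof.
move=> MV NV tM; have [_ p4M] := spec1_tr0 ch3 (hV MV) tM.
have := spec1_p4D MV NV tM; have := @spec1_p4D (- M) N _ NV.
rewrite memvN linearN /= tM oppr0 => /(_ MV erefl).
rewrite !p4D p4N p4M.
have -> : - M *m - M = M *m M by rewrite mulmxN mulNmx opprK.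
rewrite !mulmxN !mulNmx opprK !linearN /=.
set X := \tr _; set Y := \tr _; set Z := \tr _; set T := \tr _ => h1 h2.
have e3 := three0 ch3.
have e4 : 4%:R = 1 :> K by rewrite -[4%N]/(1 + 3)%N natrD e3 addr0.
have e2 := two_eqN1 ch3.
move: h1 h2; rewrite e4 e2 => h1 h2.
have q (x : K) : 2%:R * x = 0 -> x = 0.
  by move=> /eqP; rewrite mulf_eq0 (negbTE (two_neq0 ch3)) => /eqP.
split.
  apply/eqP; rewrite -subr_eq0; apply/eqP; apply: (q).
  have -> : 2%:R * (X - Y) = (p4 N + 0 + 1 * X + -1 * Y + 1 * (Z + T) - p4 N)
    + (p4 N + 0 + 1 * X + -1 * Y + 1 * (- Z + - T) - p4 N) by ring.
  by rewrite h1 h2 subrr addr0.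
apply: (q).
have -> : 2%:R * (Z + T) = (p4 N + 0 + 1 * X + -1 * Y + 1 * (Z + T) - p4 N)
    - (p4 N + 0 + 1 * X + -1 * Y + 1 * (- Z + - T) - p4 N) by ring.
by rewrite h1 h2 subrr.
Qed.

Lemma spec1_sqr M N : M \in V -> N \in V -> \tr M = 0 ->
  \tr (N *m N *m (M *m M)) = \tr (N *m M *m (N *m M)).
Proof. by move=> MV NV tM; have [] := spec1_quartic MV NV tM. Qed.

Lemma spec1_cube M N : M \in V -> N \in V -> \tr M = 0 -> M *m M = 0 ->
  \tr (N *m N *m (N *m M)) = 0.
Proof.
move=> MV NV tM M2; have [_] := spec1_quartic MV NV tM.
by rewrite M2 mulmx0 mxtrace0 addr0.
Qed.

Lemma spec1_sqr_polar M N B : M \in V -> N \in V -> B \in V -> \tr M = 0 ->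
  \tr ((N *m B + B *m N) *m (M *m M)) = 2%:R * \tr (N *m M *m (B *m M)).
Proof.
move=> MV NV BV tM; have := spec1_sqr MV (memvD NV BV) tM.
have h1 := spec1_sqr MV NV tM; have h2 := spec1_sqr MV BV tM.
have -> : (N + B) *m (N + B) = N *m N + B *m B + (N *m B + B *m N).
  by rewrite mulmxDl !mulmxDr [B *m N + _]addrC addrACA.
rewrite (mulmxDl N B M) (mulmxDl (_ + _) _ (M *m M)) (mulmxDl _ _ (M *m M)).
rewrite (mxtraceD (_ + _)) (mxtraceD (N *m N *m _)) h1 h2.
rewrite -/(p2 (N *m M + B *m M)) p2D (trM (B *m M) (N *m M)) /p2 => /eqP.
by rewrite -subr_eq0 => /eqP h; apply/eqP; rewrite -subr_eq0 -{}h; apply/eqP; ring.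
Qed.

End TraceIdentities.

(** * Adapted vectors and the dimension bound *)

Section AdaptedVector.
Variables (K : fieldType) (L : closedFieldType) (f : {rmorphism K -> L}).
Hypothesis ch3 : 3%N \in [pchar K].

Definition adapted n (V : {vspace 'M[K]_n}) (x : 'cV_n) :=
  forall phi : 'rV_n, phi *m x = 0 -> x *m phi \in V -> phi = 0.

Lemma mxtrace_colrow n (u : 'cV[K]_n) (phi : 'rV_n) : \tr (u *m phi) = (phi *m u) 0 0.
Proof. by rewrite mxtrace_mulC /mxtrace big_ord1. Qed.

Lemma mx11P (A B : 'M[K]_1) : A 0 0 = B 0 0 -> A = B.
Proof. by move=> e; apply/matrixP => i j; rewrite !ord1. Qed.

(** The trace of the product of the two square-zero matrices is (phi y)(psi x), and it vanishes by
    [spec1_tr_mul0]. *)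
Lemma rank_one_no_two_cycle n (V : {vspace 'M[K]_n}) x y (phi psi : 'rV_n) :
  (forall M, M \in V -> spec1 f M) -> x *m phi \in V -> y *m psi \in V ->
  phi *m x = 0 -> psi *m y = 0 -> phi *m y = 0 \/ psi *m x = 0.
Proof.
move=> hV xV yV px py.
have t0 : \tr (x *m phi) = 0 by rewrite mxtrace_colrow px mxE.
have := spec1_tr_mul0 ch3 hV xV yV t0.
rewrite mulmxA mxtrace_colrow -(mulmxA x) (mulmxA psi x).
rewrite [psi *m x]mx11_scalar [phi *m y]mx11_scalar -scalar_mxM mxE eqxx mulr1n => /eqP.
by rewrite mulf_eq0 => /orP[] /eqP ->; [right|left]; rewrite raddf0.
Qed.

(** Columns over the prime field: a finite set, on which counting is possible; [emb] reads them over
    K. *)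
Let T n := 'cV['F_3]_n.+1.
Let emb n (w : T n) : 'cV[K]_n.+1 := \col_i (w i 0 : nat)%:R.

Let mod3 k : (k %% 3)%:R = k%:R :> K.
Proof. by rewrite [in RHS](divn_eq k 3) natrD natrM (three0 ch3) mulr0 add0r. Qed.

Let embD n (w w' : T n) : emb (w + w') = emb w + emb w'.
Proof. by apply/matrixP => i j; rewrite !mxE /= -natrD -[RHS]mod3. Qed.

Let emb0 n : emb (0 : T n) = 0.
Proof. by apply/matrixP => i j; rewrite !mxE. Qed.

Let emb_delta n i : emb (delta_mx i 0 : T n) = delta_mx i 0.
Proof. by apply/matrixP => k j; rewrite !mxE ord1 !eqxx !andbT; case: eqP. Qed.

Let embMn n (w : T n) k : emb (w *+ k) = emb w *+ k.
Proof. by elim: k => [|k IH]; rewrite ?mulr0n ?emb0 // !mulrS embD IH. Qed.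

Let nat3_inj (a b : nat) : (a < 3)%N -> (b < 3)%N -> a%:R = b%:R :> K -> a = b.
Proof.
have n1 : 1%:R == 0 :> K = false by rewrite (negbTE (oner_neq0 _)).
have n2 : 2%:R == 0 :> K = false by rewrite (negbTE (two_neq0 ch3)).
have w (a' b' : nat) : (a' <= b')%N -> (b' < 3)%N -> a'%:R = b'%:R :> K -> a' = b'.
  move=> ab b3 /eqP; rewrite eq_sym -subr_eq0 -natrB //.
  by case: (b' - a')%N (subnKC ab) => [|[|[|k]]] e; rewrite ?n1 ?n2 //; lia.
move=> a3 b3 e; case: (leqP a b) => h; first exact: w.
by symmetry; apply: w => //; exact: ltnW.
Qed.

Let emb_eq0 n (w : T n) : emb w = 0 -> w = 0.
Proof.
move=> h; apply/matrixP => i j; rewrite ord1 !mxE.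
have := congr1 (fun A : 'cV_n.+1 => A i 0) h; rewrite !mxE => e.
by apply: val_inj; apply: nat3_inj => //; exact: ltn_ord.
Qed.

(** The translates of the kernel by 0, w1 and 2 w1 are disjoint, since phi takes the distinct values
    0, phi w1 and 2 phi w1 on them. *)
Let card_ker n (phi : 'rV[K]_n.+1) : phi != 0 ->
  (3 * #|[set w : T n | (phi *m emb w == 0)%R]| <= #|{: T n}|)%N.
Proof.
move=> /rV0Pn[i ni]; set A := [set w | _]; pose w1 : T n := delta_mx i 0.
have pw1 : (phi *m emb w1) 0 0 = phi 0 i by rewrite emb_delta -colE mxE.
pose g (p : T n * 'I_3) := p.1 + w1 *+ p.2.
have gi : {in setX A [set: 'I_3] &, injective g}.
  move=> [a c] [b d]; rewrite !inE !andbT /= => /eqP pa /eqP pb e.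
  have cd : c = d.
    have := congr1 (fun w => (phi *m emb w) 0 0) e.
    rewrite /g /= !embD !embMn !mulmxDr pa pb !add0r -!scaler_nat -!scalemxAr [LHS]mxE [RHS]mxE !pw1.
    by move=> /(mulIf ni) /nat3_inj h; apply: val_inj; apply: h.
  by move: e; rewrite /g /= cd => /addIr ->.
have := card_in_imset gi; rewrite cardsX cardsT card_ord => e.
by rewrite mulnC -e -cardsT subset_leq_card // subsetT.
Qed.

(* Otherwise choose for every nonzero x some phi_x; for any two vectors with
   coordinates in the prime field one annihilates the other, but each phi_x kills
   at most a third of these vectors. *)
Lemma exists_adapted n (V : {vspace 'M[K]_n.+1}) :
  (forall M, M \in V -> spec1 f M) -> exists2 x, x != 0 & adapted V x.
Proof.
move=> hV; apply: contrapT => no.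
have ex (x : 'cV_n.+1) : exists phi : 'rV_n.+1,
    x != 0 -> [/\ phi != 0, phi *m x = 0 & x *m phi \in V].
  have [->|nx] := eqVneq x 0; first by exists 0.
  apply: contrapT => h; apply: no; exists x => // phi px pV.
  by apply/eqP/negPn/negP => np; apply: h; exists phi.
have [Phi hP] := boolp.choice ex.
pose D := [set w : T n | w != 0].
have embN w : w \in D -> emb w != 0.
  by rewrite inE; apply: contra_neq; exact: emb_eq0.
pose B (w w' : T n) : bool := Phi (emb w) *m emb w' == 0.
have hB w w' : w \in D -> w' \in D -> (1 <= B w w' + B w' w)%N.
  move=> /embN nw /embN nw'; have [_ a1 a2] := hP _ nw; have [_ b1 b2] := hP _ nw'.
  by have [e|e] := rank_one_no_two_cycle hV a2 b2 a1 b1; rewrite /B e eqxx ?addn1.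
have cD : (#|D| = #|{: T n}|.-1)%N.
  by rewrite -cardsT (cardsD1 0 [set: T n]) inE add1n /=; apply: eq_card => w; rewrite !inE andbT.
have cB w : w \in D -> (3 * (\sum_(w' in D) B w w') <= #|{: T n}| - 3)%N.
  move=> wD; have [np _ _] := hP _ (embN _ wD).
  have := card_ker np; rewrite (cardsD1 0) inE emb0 mulmx0 eqxx add1n.
  suff -> : (\sum_(w' in D) B w w' = #|[set w' | (Phi (emb w) *m emb w' == 0)%R] :\ 0%R|)%N.
    by move=> /(leq_sub2r 3); rewrite mulnS addKn.
  rewrite -sum1_card big_mkcond [RHS]big_mkcond; apply: eq_bigr => w' _.
  by rewrite !inE /B; case: (w' == 0) => //=; case: (_ == _).
(* Double counting over ordered pairs of nonzero vectors: with q the number of all vectors, (q -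
   1)^2 <= 2 sum B <= 2 (q - 1)(q - 3) / 3, which is absurd. *)
have s1 : (#|D| * #|D| <= \sum_(w in D) \sum_(w' in D) (B w w' + B w' w))%N.
  rewrite -sum_nat_const; apply: leq_sum => w wD.
  by rewrite -sum1_card; apply: leq_sum => w' w'D; exact: hB.
have s2 : (\sum_(w in D) \sum_(w' in D) (B w w' + B w' w) =
  2 * \sum_(w in D) \sum_(w' in D) B w w')%N.
  under eq_bigr => w _ do rewrite big_split /=.
  by rewrite big_split /= [X in (_ + X)%N]exchange_big /= mul2n addnn.
have s3 : (3 * \sum_(w in D) \sum_(w' in D) B w w' <= #|D| * (#|{: T n}| - 3))%N.
  by rewrite big_distrr /= -sum_nat_const; apply: leq_sum => w; exact: cB.
have D0 : (0 < #|D|)%N.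
  apply/card_gt0P; exists (delta_mx 0 0); rewrite inE; apply/eqP => /matrixP/(_ 0 0).
  by rewrite !mxE.
move: s1 s2 s3 D0; rewrite cD; nia.
Qed.

End AdaptedVector.

(** * Block projections, dimensions of images and conjugate spaces *)

Section BlockLinear.
Variables (K : fieldType) (m1 m2 n1 n2 : nat).
Lemma ulsubmx_linear : linear (@ulsubmx K m1 m2 n1 n2).
Proof. by move=> a u v; rewrite /ulsubmx !linearP. Qed.
HB.instance Definition _ := GRing.isLinear.Build K 'M[K]_(m1 + m2, n1 + n2)
  'M[K]_(m1, n1) *:%R (@ulsubmx K m1 m2 n1 n2) ulsubmx_linear.
Lemma ursubmx_linear : linear (@ursubmx K m1 m2 n1 n2).
Proof. by move=> a u v; rewrite /ursubmx !linearP. Qed.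
HB.instance Definition _ := GRing.isLinear.Build K 'M[K]_(m1 + m2, n1 + n2)
  'M[K]_(m1, n2) *:%R (@ursubmx K m1 m2 n1 n2) ursubmx_linear.
Lemma dlsubmx_linear : linear (@dlsubmx K m1 m2 n1 n2).
Proof. by move=> a u v; rewrite /dlsubmx !linearP. Qed.
HB.instance Definition _ := GRing.isLinear.Build K 'M[K]_(m1 + m2, n1 + n2)
  'M[K]_(m2, n1) *:%R (@dlsubmx K m1 m2 n1 n2) dlsubmx_linear.
Lemma drsubmx_linear : linear (@drsubmx K m1 m2 n1 n2).
Proof. by move=> a u v; rewrite /drsubmx !linearP. Qed.
HB.instance Definition _ := GRing.isLinear.Build K 'M[K]_(m1 + m2, n1 + n2)
  'M[K]_(m2, n2) *:%R (@drsubmx K m1 m2 n1 n2) drsubmx_linear.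
End BlockLinear.

Section SpaceDimensions.
Variable K : fieldType.

Lemma dim_split (aT rT : vectType K) (g : 'Hom(aT, rT)) (V : {vspace aT}) :
  \dim V = (\dim (V :&: lker g) + \dim (g @: V))%N.
Proof. by rewrite limg_ker_dim. Qed.

Lemma dim_img_inj (aT rT : vectType K) (g : 'Hom(aT, rT)) (V : {vspace aT}) :
  (forall M, M \in V -> g M = 0 -> M = 0) -> \dim (g @: V) = \dim V.
Proof.
move=> h; rewrite (dim_split g V) (_ : (V :&: lker g)%VS = 0%VS) ?dimv0 //.
apply/eqP; rewrite -subv0; apply/subvP => M; rewrite memv_cap memv_ker memv0.
by case/andP => MV /eqP /(h _ MV) ->.
Qed.

Lemma dim_le_full (aT : vectType K) (V : {vspace aT}) : (\dim V <= dim aT)%N.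
Proof. by rewrite -dimvf dimvS // subvf. Qed.

Lemma dim_eq_full (aT : vectType K) (V : {vspace aT}) v :
  (dim aT <= \dim V)%N -> v \in V.
Proof.
move=> h; have /eqP -> : V == fullv by rewrite eqEdim subvf dimvf.
exact: memvf.
Qed.

Lemma dim_mx (m n : nat) : dim 'M[K]_(m, n) = (m * n)%N.
Proof. by rewrite dim_matrix. Qed.

Definition conjP n (P M : 'M[K]_n) := P *m M *m invmx P.
Lemma conjP_linear n (P : 'M[K]_n) : linear (conjP P).
Proof. by move=> a u v; rewrite /conjP mulmxDr mulmxDl -!scalemxAr -!scalemxAl. Qed.
HB.instance Definition _ n (P : 'M[K]_n) :=
  GRing.isLinear.Build K 'M[K]_n 'M[K]_n *:%R (conjP P) (conjP_linear P).

Definition cj n (P : 'M[K]_n) (V : {vspace 'M[K]_n}) := (linfun (conjP P) @: V)%VS.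

Lemma conjPK n (P M : 'M[K]_n) : P \in unitmx -> conjP (invmx P) (conjP P M) = M.
Proof. by move=> uP; rewrite /conjP invmxK !mulmxA mulVmx // mul1mx mulmxKV. Qed.
Lemma conjPKV n (P M : 'M[K]_n) : P \in unitmx -> conjP P (conjP (invmx P) M) = M.
Proof. by move=> uP; rewrite -{1}(invmxK P) conjPK // unitmx_inv. Qed.

Lemma conjP1 n (P : 'M[K]_n) : P \in unitmx -> conjP P 1%:M = 1%:M.
Proof. by move=> uP; rewrite /conjP mulmx1 mulmxV. Qed.

Lemma invmx_mul n (P Q : 'M[K]_n) : P \in unitmx -> Q \in unitmx ->
  invmx (P *m Q) = invmx Q *m invmx P.
Proof.
move=> uP uQ; have uPQ : P *m Q \in unitmx by rewrite unitmx_mul uP.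
rewrite -[RHS](mulmxK uPQ) -[invmx Q *m invmx P *m _]mulmxA (mulmxA (invmx P)).
by rewrite mulVmx // mul1mx mulVmx // mul1mx.
Qed.

Lemma conjP_comp n (P Q M : 'M[K]_n) : P \in unitmx -> Q \in unitmx ->
  conjP P (conjP Q M) = conjP (P *m Q) M.
Proof.
move=> uP uQ; by rewrite /conjP (invmx_mul uP uQ) !mulmxA.
Qed.

Lemma mem_cj n (P : 'M[K]_n) (V : {vspace 'M[K]_n}) M : M \in V -> conjP P M \in cj P V.
Proof. by move=> MV; apply/memv_imgP; exists M; rewrite ?lfunE. Qed.

Lemma cj_ex n (P : 'M[K]_n) (V : {vspace 'M[K]_n}) M : M \in cj P V -> exists2 N, N \in V & M = conjP P N.
Proof. by case/memv_imgP => N NV ->; exists N; rewrite ?lfunE. Qed.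

Lemma mem_cjE n (P : 'M[K]_n) (V : {vspace 'M[K]_n}) M : P \in unitmx -> (conjP P M \in cj P V) = (M \in V).
Proof.
move=> uP; apply/idP/idP => [/cj_ex[N NV e]|]; last exact: mem_cj.
by rewrite -(conjPK M uP) e conjPK.
Qed.

Lemma dim_cj n (P : 'M[K]_n) (V : {vspace 'M[K]_n}) : P \in unitmx -> \dim (cj P V) = \dim V.
Proof.
move=> uP; apply: dim_img_inj => M _; rewrite lfunE /= => h.
by rewrite -(conjPK M uP) h linear0.
Qed.

Lemma sim_cj n (P : 'M[K]_n) (V : {vspace 'M_n}) : P \in unitmx ->
  mx_similar (fun M => M \in V) (fun M => M \in cj P V).
Proof. by move=> uP; exists P => // M; rewrite mem_cjE. Qed.

Lemma sim_trans n (A B C : 'M[K]_n -> Prop) :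
  mx_similar A B -> mx_similar B C -> mx_similar A C.
Proof.
move=> [P uP hP] [Q uQ hQ]; exists (Q *m P) => [|M]; first by rewrite unitmx_mul uQ.
by rewrite hP hQ -/(conjP P M) -/(conjP Q _) conjP_comp.
Qed.

Lemma sim_refl n (A : 'M[K]_n -> Prop) : mx_similar A A.
Proof. by exists 1%:M => [|M]; rewrite ?unitmx1 // invmx1 mul1mx mulmx1. Qed.

End SpaceDimensions.

Section DimensionBound.
Variables (K : fieldType) (L : closedFieldType) (f : {rmorphism K -> L}).
Hypothesis ch3 : 3%N \in [pchar K].

Definition spec1_space n (V : {vspace 'M[K]_n}) := forall M, M \in V -> spec1 f M.

Lemma spec1_cj n (P : 'M[K]_n) (V : {vspace 'M[K]_n}) : P \in unitmx -> spec1_space V -> spec1_space (cj P V).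
Proof. by move=> uP h M /cj_ex[N NV ->]; apply: spec1_conj => //; exact: h. Qed.

Lemma adapted_cj n (P : 'M[K]_n) (V : {vspace 'M[K]_n}) x : P \in unitmx -> adapted V x -> adapted (cj P V) (P *m x).
Proof.
move=> uP h phi px pV.
have e : phi *m P = 0.
  apply: h; first by rewrite -mulmxA.
  rewrite -(mem_cjE V _ uP); suff -> : conjP P (x *m (phi *m P)) = P *m x *m phi by [].
  by rewrite /conjP !mulmxA mulmxK.
by rewrite -[phi](mulmxK uP) e mul0mx.
Qed.

Definition dimension_bound n :=
  forall V : {vspace 'M[K]_n}, spec1_space V -> (\dim V <= 'C(n, 2) + 1)%N.

Lemma nil_spec_line1 n (V : {vspace 'M[K]_n}) :
  (forall M, M \in V -> nil_spec f M) -> spec1_space (V + <[1%:M]>)%VS.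
Proof.
move=> h M /memv_addP[N NV [_ /vlineP[c ->] ->]] a b _ _.
rewrite scalemx1 !ev_shift => /(h _ NV)/eqP; rewrite subr_eq0 => /eqP ->.
by move=> /(h _ NV)/eqP; rewrite subr_eq0 => /eqP ->.
Qed.

Lemma one_notin_nil n (V : {vspace 'M[K]_n.+1}) :
  (forall M, M \in V -> nil_spec f M) -> 1%:M \notin V.
Proof.
move=> h; apply/negP => /h /(_ 1); rewrite evP map_scalar_mx rmorph1 subrr det0.
by move=> /(_ (eqxx _))/eqP; rewrite oner_eq0.
Qed.

Lemma dim_add_one n (V : {vspace 'M[K]_n.+1}) : 1%:M \notin V ->
  \dim (V + <[1%:M]>) = (\dim V).+1.
Proof.
move=> n1; rewrite dimv_disjoint_sum.
  by rewrite dim_vline -[1%:M]/(1 : 'M_n.+1) oner_eq0 addn1.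
apply/eqP; rewrite -subv0; apply/subvP => M; rewrite memv_cap memv0.
move=> /andP[MV /vlineP[c e]]; move: MV; rewrite e.
have [->|nc] := eqVneq c 0; first by rewrite scale0r.
by move=> h; case/negP: n1; rewrite -[1%:M](scalerK nc) memvZ.
Qed.

(** Adjoining the scalars keeps a single eigenvalue per matrix and raises the dimension by one. In
    size 0 the identity is zero, hence the separate case. *)
Lemma nil_bound n (V : {vspace 'M[K]_n}) : dimension_bound n ->
  (forall M, M \in V -> nil_spec f M) -> (\dim V <= 'C(n, 2))%N.
Proof.
case: n V => [|n] V bn h.
  by apply: leq_trans (dim_le_full V) _; rewrite dim_mx.
have := bn _ (nil_spec_line1 h); rewrite dim_add_one ?addn1 ?ltnS //.
exact: one_notin_nil.
Qed.

Section Blocks.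
Variable m : nat.
Implicit Types (V U : {vspace 'M[K]_(1 + m)}) (M N : 'M[K]_(1 + m)).

Notation ulf := (linfun (@ulsubmx K 1 m 1 m)).
Notation urf := (linfun (@ursubmx K 1 m 1 m)).
Notation dlf := (linfun (@dlsubmx K 1 m 1 m)).
Notation drf := (linfun (@drsubmx K 1 m 1 m)).

Lemma ublockE M : dlsubmx M = 0 -> M = block_mx (ulsubmx M) (ursubmx M) 0 (drsubmx M).
Proof. by move=> <-; rewrite submxK. Qed.

(** If E in U lives on the first row with corner 1, adding multiples of E gives M any corner without
    changing its lower block. A nonzero eigenvalue of that block would then equal both 1 and -1. *)
Lemma corner_dichotomy U : spec1_space U -> (forall M, M \in U -> dlsubmx M = 0) ->
  (forall M, M \in U -> drsubmx M = 0 -> ulsubmx M = 0) \/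
  ((forall M, M \in U -> nil_spec f (drsubmx M)) /\
    exists2 E, E \in U & drsubmx E = 0 /\ ulsubmx E = 1%:M).
Proof.
move=> sU dU; case: (pselect (exists2 E, E \in U & drsubmx E = 0 /\ ulsubmx E <> 0)); last first.
  move=> no; left=> M MU dM; apply: contrapT => nu; apply: no; exists M => //.
move=> [E0 EU [dE /eqP uE]]; right.
have nz : E0 0 0 != 0.
  apply: contra_neq uE => e; apply: mx11P; rewrite !mxE.
  by rewrite -[RHS]e; congr (E0 _ _); apply: val_inj.
pose E := (E0 0 0)^-1 *: E0.
have EV : E \in U by rewrite memvZ.
have dE' : drsubmx E = 0 by rewrite /E linearZ /= dE scaler0.
have uE' : ulsubmx E = 1%:M.
  rewrite /E linearZ /=; apply: mx11P; rewrite !mxE eqxx /=.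
  rewrite [X in _ * X](_ : _ = E0 0 0) ?mulVf //.
  by congr (E0 _ _); apply: val_inj.
split; last by exists E.
move=> M MU mu emu; apply/eqP/negPn/negP => nmu.
have key (c : K) : c != 0 -> f c = mu.
  move=> nc; pose N := M + (c - (ulsubmx M) 0 0) *: E.
  have NU : N \in U by rewrite memvD // memvZ.
  have := sU _ NU; rewrite (ublockE (dU _ NU)) => /spec1_cross; apply => //.
  - by rewrite fmorph_eq0.
  - suff -> : ulsubmx N = c%:M by rewrite ev_scalar1.
    rewrite /N linearD linearZ /= uE'; apply: mx11P; rewrite !mxE eqxx /=.
    by rewrite mulr1 addrC subrK.
  - by rewrite /N linearD linearZ /= dE' scaler0 addr0.
have := key 1 (oner_neq0 _); rewrite -(key (-1)) ?oppr_eq0 ?oner_eq0 //.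
by move/eqP; rewrite rmorphN1 rmorph1 (negbTE (opp_neq f ch3 (oner_neq0 L))).
Qed.

Lemma spec1_drf U : spec1_space U -> (forall M, M \in U -> dlsubmx M = 0) ->
  spec1_space (drf @: U)%VS.
Proof.
move=> sU dU _ /memv_imgP[M MU ->]; rewrite lfunE /=.
by have := sU _ MU; rewrite (ublockE (dU _ MU)) => /spec1_dr; rewrite block_mxKdr.
Qed.

Lemma binS2 k : 'C(k.+1, 2) = ('C(k, 2) + k)%N.
Proof. by rewrite binS bin1 addnC. Qed.

Lemma dim_img_le1 (aT : vectType K) (g : 'Hom(aT, 'M[K]_1)) (A : {vspace aT}) :
  (\dim (g @: A) <= 1)%N.
Proof. by apply: leq_trans (dim_le_full _) _; rewrite dim_mx. Qed.

(** The dimension splits into free rows, at most m, corner, and lower block. By [corner_dichotomy]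
    the last two contribute at most 0 and C(m, 2) + 1, or at most 1 and C(m, 2). The totals
    coincide, so equality forces every contribution to be maximal. *)
Lemma line_dims V : dimension_bound m -> spec1_space V ->
  (forall M, M \in V -> dlsubmx M = 0) -> \dim V = ('C(m.+1, 2) + 1)%N ->
  (forall r : 'rV_m, block_mx 0 r 0 0 \in V) /\
  ((\dim (drf @: V) = ('C(m, 2) + 1)%N /\
     forall M, M \in V -> drsubmx M = 0 -> ulsubmx M = 0) \/
   [/\ forall M, M \in V -> nil_spec f (drsubmx M), \dim (drf @: V) = 'C(m, 2) &
     exists2 E, E \in V & drsubmx E = 0 /\ ulsubmx E = 1%:M]).
Proof.
move=> bm sV dV eV.
set Kr := (V :&: lker drf)%VS; set Z := (Kr :&: lker ulf)%VS.
have e1 : \dim V = (\dim Kr + \dim (drf @: V))%N := dim_split drf V.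
have e2 : \dim Kr = (\dim Z + \dim (ulf @: Kr))%N := dim_split ulf Kr.
have memZ M : M \in Z -> [/\ M \in V, drsubmx M = 0 & ulsubmx M = 0].
  by rewrite !memv_cap !memv_ker !lfunE /= => /andP[/andP[-> /eqP-> /eqP->]].
have e3 : \dim (urf @: Z) = \dim Z.
  apply: dim_img_inj => M /memZ[MV d u]; rewrite lfunE /= => r.
  by rewrite (ublockE (dV _ MV)) d u r block_mx_const.
have h3 : (\dim Z <= m)%N.
  by rewrite -e3; apply: leq_trans (dim_le_full _) _; rewrite dim_mx mul1n.
have fin : \dim Z = m -> forall r : 'rV_m, block_mx 0 r 0 0 \in V.
  move=> eZ r; have : r \in (urf @: Z)%VS by apply: dim_eq_full; rewrite dim_mx mul1n e3 eZ.
  case/memv_imgP => M /memZ[MV d u]; rewrite lfunE /= => ->.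
  by have := ublockE (dV _ MV); rewrite u d => <-.
have sB := spec1_drf sV dV.
have hb : (\dim (drf @: V) <= 'C(m, 2) + 1)%N := bm _ sB.
rewrite binS2 in eV.
have [h|[h [E EV [dE uE]]]] := corner_dichotomy sV dV.
  have eu : \dim (ulf @: Kr) = 0%N.
    apply/eqP; rewrite dimv_eq0 -subv0; apply/subvP => w /memv_imgP[M].
    rewrite memv_cap memv_ker !lfunE /= => /andP[MV /eqP d] ->.
    by rewrite memv0 h.
  by split; [apply: fin; lia|left; split=> //; lia].
have hnil B : B \in (drf @: V)%VS -> nil_spec f B.
  by case/memv_imgP => M MV ->; rewrite lfunE; exact: h.
have hn : (\dim (drf @: V) <= 'C(m, 2))%N := nil_bound bm hnil.
have hl : (\dim (ulf @: Kr) <= 1)%N := dim_img_le1 ulf Kr.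
by split; [apply: fin; lia|right; split=> //; [lia|exists E]].
Qed.

(** The first basis vector is an eigenvector of these matrices, so they act on the quotient by it
    through the lower right block. *)
Definition ustab V := (V :&: lker dlf)%VS.

Lemma mem_ustab V M : (M \in ustab V) = (M \in V) && (dlsubmx M == 0).
Proof. by rewrite memv_cap memv_ker lfunE. Qed.

Lemma adapted_inj V M : adapted V (col_mx 1%:M 0) ->
  M \in V -> dlsubmx M = 0 -> drsubmx M = 0 -> ulsubmx M = 0 -> M = 0.
Proof.
move=> ad MV dl dr ul; have eM := ublockE dl; rewrite dr ul in eM.
have r0 : row_mx 0 (ursubmx M) = 0 :> 'rV_(1 + m).
  apply: ad; first by rewrite mul_row_col mul0mx mulmx0 addr0.
  by rewrite mul_col_row mul1mx mul1mx mul0mx mul0mx -eM.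
move: r0; rewrite -row_mx0 => /eq_row_mx[_ r0].
by rewrite eM r0 block_mx_const.
Qed.

(** The count of [line_dims] with columns in place of rows: adaptedness kills the matrices supported
    on the row beside the corner, while the column below the corner contributes at most m. Equality
    makes every column occur. *)
Lemma adapted_dims V : dimension_bound m -> spec1_space V ->
  adapted V (col_mx 1%:M 0) ->
  (\dim V <= 'C(m.+1, 2) + 1)%N /\
  (\dim V = ('C(m.+1, 2) + 1)%N ->
    (forall c, exists2 N, N \in V & dlsubmx N = c) /\
    ((\dim (drf @: ustab V) = ('C(m, 2) + 1)%N /\
      forall M, M \in ustab V -> drsubmx M = 0 -> M = 0) \/
     [/\ forall M, M \in ustab V -> nil_spec f (drsubmx M),
       \dim (drf @: ustab V) = 'C(m, 2) &
       exists2 E, E \in ustab V & drsubmx E = 0 /\ ulsubmx E = 1%:M])).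
Proof.
move=> bm sV ad; set U := ustab V.
have dU M : M \in U -> dlsubmx M = 0 by rewrite mem_ustab => /andP[_ /eqP].
have UV M : M \in U -> M \in V by rewrite mem_ustab => /andP[].
have sU : spec1_space U by move=> M /UV; exact: sV.
have e0 : \dim V = (\dim U + \dim (dlf @: V))%N := dim_split dlf V.
have h0 : (\dim (dlf @: V) <= m)%N.
  by apply: leq_trans (dim_le_full _) _; rewrite dim_mx muln1.
set Kr := (U :&: lker drf)%VS.
have e1 : \dim U = (\dim Kr + \dim (drf @: U))%N := dim_split drf U.
have memK M : M \in Kr -> M \in U /\ drsubmx M = 0.
  by rewrite memv_cap memv_ker lfunE /= => /andP[-> /eqP->].
have e2 : \dim (ulf @: Kr) = \dim Kr.
  apply: dim_img_inj => M /memK[MU dr]; rewrite lfunE /= => ul.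
  by apply: (adapted_inj ad) => //; [exact: UV|exact: dU].
have h2 : (\dim (ulf @: Kr) <= 1)%N := dim_img_le1 ulf Kr.
have sB := spec1_drf sU dU.
have hb : (\dim (drf @: U) <= 'C(m, 2) + 1)%N := bm _ sB.
have fin : \dim (dlf @: V) = m -> forall c, exists2 N, N \in V & dlsubmx N = c.
  move=> e c; have : c \in (dlf @: V)%VS by apply: dim_eq_full; rewrite dim_mx muln1 e.
  by case/memv_imgP => N NV; rewrite lfunE /= => ->; exists N.
rewrite binS2.
have [h|[h [E EU [dE uE]]]] := corner_dichotomy sU dU.
  have eK : \dim Kr = 0%N.
    apply/eqP; rewrite -e2 dimv_eq0 -subv0; apply/subvP => w /memv_imgP[M /memK[MU dr]].
    by rewrite lfunE memv0 /= => ->; rewrite h.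
  split=> [|eV]; first by lia.
  split; first by apply: fin; lia.
  left; split=> [|M MU dr]; first by lia.
  by apply: (adapted_inj ad) => //; [exact: UV|exact: dU|exact: h].
have hnil B : B \in (drf @: U)%VS -> nil_spec f B.
  by case/memv_imgP => M MV ->; rewrite lfunE; exact: h.
have hn : (\dim (drf @: U) <= 'C(m, 2))%N := nil_bound bm hnil.
split=> [|eV]; first by lia.
by split; [apply: fin; lia|right; split=> //; [lia|exists E]].
Qed.

End Blocks.

Lemma adapted_normalize m (V : {vspace 'M[K]_(1 + m)}) : spec1_space V ->
  exists2 P, P \in unitmx & adapted (cj P V) (col_mx 1%:M 0).
Proof.
move=> sV; have [x nx ad] := @exists_adapted K L f ch3 m V sV.
have [P uP Px] := complete_column nx.
by exists P => //; rewrite -Px; exact: adapted_cj.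
Qed.

Theorem dimension_boundP n : dimension_bound n.
Proof.
elim: n => [|n IH] V sV; first by apply: leq_trans (dim_le_full V) _; rewrite dim_mx.
have [P uP ad] := @adapted_normalize n V sV.
by rewrite -(dim_cj _ uP); have [] := adapted_dims IH (spec1_cj uP sV) ad.
Qed.
End DimensionBound.

(** * Lifting invariant lines and blocks *)

Section RowColumnAlgebra.
Variable K : fieldType.

Definition bil n (phi : 'rV[K]_n) (N : 'M_n) (u : 'cV_n) : K := (phi *m N *m u) 0 0.

Lemma tr_mul_cr n (A : 'M[K]_n) u phi : \tr (A *m (u *m phi)) = bil phi A u.
Proof. by rewrite mulmxA mxtrace_colrow mulmxA. Qed.

Lemma tr_crcr n (A B : 'M[K]_n) u phi w psi :
  \tr (A *m (u *m phi) *m (B *m (w *m psi))) = bil phi B w * bil psi A u.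
Proof.
rewrite !mulmxA mxtrace_colrow.
have -> : psi *m (A *m u *m phi *m B *m w) = (psi *m A *m u) *m (phi *m B *m w).
  by rewrite !mulmxA.
by rewrite mxE big_ord1 mulrC.
Qed.

Lemma row_eq0 n (phi : 'rV[K]_n) : (forall c : 'cV_n, (phi *m c) 0 0 = 0) -> phi = 0.
Proof.
move=> h; apply/rowP => i; rewrite mxE -(h (delta_mx i 0)) -colE mxE.
by [].
Qed.

Lemma row_neq0 n (phi : 'rV[K]_n) : phi != 0 -> exists c : 'cV_n, (phi *m c) 0 0 = 1.
Proof.
move=> /rV0Pn[i ni]; exists ((phi 0 i)^-1 *: delta_mx i 0).
by rewrite -scalemxAr mxE -colE mxE mulVf.
Qed.

Lemma row_proportional n (phi psi : 'rV[K]_n) : phi != 0 ->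
  (forall c : 'cV_n, (phi *m c) 0 0 = 0 -> (psi *m c) 0 0 = 0) -> exists s, psi = s *: phi.
Proof.
move=> /row_neq0[c0 h0] h; exists ((psi *m c0) 0 0).
apply/eqP; rewrite -subr_eq0; apply/eqP/row_eq0 => c.
have E (chi : 'rV_n) a :
  (chi *m (c - a *: c0)) 0 0 = (chi *m c) 0 0 - a * (chi *m c0) 0 0.
  by rewrite mulmxBr -scalemxAr [LHS]mxE [X in _ + X]mxE [X in - X]mxE.
have := h (c - (phi *m c) 0 0 *: c0); rewrite !E h0 mulr1 subrr => /(_ erefl) e.
by rewrite mulmxBl -scalemxAl [LHS]mxE [X in _ + X]mxE [X in - X]mxE mulrC.
Qed.

Lemma in_column_span n d (Z : 'M[K]_(n, d)) (w : 'cV_n) :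
  (forall phi : 'rV_n, phi *m Z = 0 -> phi *m w = 0) -> exists u, w = Z *m u.
Proof.
move=> h; have : (w^T <= Z^T)%MS.
  rewrite submxE; apply/eqP/trmx_inj; rewrite trmx_mul trmxK trmx0.
  apply/row_matrixP => i; rewrite row_mul row0; apply: h.
  rewrite -row_mul; have -> : (cokermx Z^T)^T *m Z = 0.
    by apply: trmx_inj; rewrite trmx_mul trmxK mulmx_coker trmx0.
  by rewrite row0.
move=> /submxP[D e]; exists D^T.
by apply: trmx_inj; rewrite trmx_mul trmxK.
Qed.

Lemma alternating_skew n (S : 'M[K]_n) : (forall u : 'cV_n, u^T *m S *m u = 0) -> S^T = - S.
Proof.
move=> h; apply/matrixP => i j; rewrite !mxE.
have e k l : ((delta_mx k 0)^T *m S *m delta_mx l 0 : 'M_1) 0 0 = S k l.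
  by rewrite -colE trmx_delta -rowE !mxE.
have := h (delta_mx i 0 + delta_mx j 0).
rewrite [(_ + _)^T]linearD /= !mulmxDl !mulmxDr !h add0r addr0 => /(congr1 (fun M : 'M_1 => M 0 0)).
by rewrite [LHS]mxE !e mxE addrC => /eqP; rewrite addr_eq0 => /eqP.
Qed.

Definition no_stable_line n (F : {vspace 'M[K]_n}) :=
  forall w : 'cV_n, w != 0 -> ~ (forall A, A \in F -> exists c, A *m w = c *: w).

End RowColumnAlgebra.

(** * Alternating forms in dimension three *)

Section SkewThree.
Variable K : fieldType.
Hypothesis ch3 : 3%N \in [pchar K].

(** A skew matrix of size 3 acts as a cross product; with p, q, r its entries above the diagonal,
    the kernel is the line of (r, -q, p). *)
Lemma skew3_ker (S : 'M[K]_3) : S^T = - S -> S != 0 ->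
  exists2 w : 'cV_3, w != 0 & S *m w = 0 /\ forall u, S *m u = 0 -> exists c, u = c *: w.
Proof.
move=> sk nS.
have sE i j : S j i = - S i j by have := congr1 (fun M : 'M_3 => M i j) sk; rewrite !mxE.
have s0 i : S i i = 0.
  have /eqP := sE i i; rewrite -addr_eq0 -mulr2n -mulr_natl mulf_eq0.
  by rewrite (negbTE (two_neq0 ch3)) => /eqP.
pose o0 : 'I_3 := inord 0; pose o1 : 'I_3 := inord 1; pose o2 : 'I_3 := inord 2.
have io (i : 'I_3) : [\/ i = o0, i = o1 | i = o2].
  by case: i => [[|[|[|//]]] h]; [constructor 1|constructor 2|constructor 3];
     apply: val_inj; rewrite /= inordK.
have sum3 (g : 'I_3 -> K) : \sum_i g i = g o0 + g o1 + g o2.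
  rewrite !big_ord_recl big_ord0 addr0 addrA.
  by congr (g _ + g _ + g _); apply: val_inj; rewrite /= inordK.
have mulE (u : 'cV_3) i : (S *m u) i 0 = S i o0 * u o0 0 + S i o1 * u o1 0 + S i o2 * u o2 0.
  by rewrite mxE sum3.
set p := S o0 o1; set q := S o0 o2; set r := S o1 o2.
have e10 : S o1 o0 = - p by rewrite sE.
have e20 : S o2 o0 = - q by rewrite sE.
have e21 : S o2 o1 = - r by rewrite sE.
pose w : 'cV[K]_3 := \col_i (if i == o0 then r else if i == o1 then - q else p).
have d10 : (o1 == o0) = false by apply/eqP => /(congr1 val); rewrite /= !inordK.
have d20 : (o2 == o0) = false by apply/eqP => /(congr1 val); rewrite /= !inordK.
have d21 : (o2 == o1) = false by apply/eqP => /(congr1 val); rewrite /= !inordK.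
have w0 : w o0 0 = r by rewrite mxE eqxx.
have w1 : w o1 0 = - q by rewrite mxE d10 eqxx.
have w2 : w o2 0 = p by rewrite mxE d20 d21.
have colE3 (u v : 'cV[K]_3) : u o0 0 = v o0 0 -> u o1 0 = v o1 0 -> u o2 0 = v o2 0 -> u = v.
  by move=> h0 h1 h2; apply/matrixP => i j; rewrite ord1; case: (io i) => ->.
have pqr : [|| p != 0, q != 0 | r != 0].
  apply: contraR nS; rewrite !negb_or !negbK => /and3P[/eqP p0 /eqP q0 /eqP r0].
  apply/eqP/matrixP => i j; rewrite [RHS]mxE.
  by case: (io i) => ->; case: (io j) => ->; rewrite ?s0 ?e10 ?e20 ?e21 -/p -/q -/r ?p0 ?q0 ?r0 ?oppr0.
exists w.
  apply/eqP => e; move: w0 w1 w2; rewrite e !mxE => r0 /eqP q0 p0.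
  by move: pqr; rewrite -r0 -p0 eqxx; move: q0; rewrite eq_sym oppr_eq0 => /eqP ->; rewrite eqxx.
split.
  by apply: colE3; rewrite mulE ?s0 ?e10 ?e20 ?e21 w0 w1 w2 -/p -/q -/r mxE; ring.
move=> u Su.
have S0 : p * u o1 0 + q * u o2 0 = 0.
  by have := mulE u o0; rewrite Su mxE s0 mul0r add0r => <-.
have S1 : p * u o0 0 = r * u o2 0.
  have := mulE u o1; rewrite Su mxE s0 mul0r addr0 e10 -/r => /esym/eqP.
  by rewrite mulNr addrC subr_eq0 => /eqP.
have S2 : q * u o0 0 = - (r * u o1 0).
  have := mulE u o2; rewrite Su mxE s0 mul0r addr0 e20 e21 => /esym/eqP.
  by rewrite !mulNr -opprD oppr_eq0 addr_eq0 => /eqP.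
case/or3P: pqr => nz.
- exists (u o2 0 / p); apply: colE3; rewrite [RHS]mxE ?w0 ?w1 ?w2.
  + by apply: (mulfI nz); rewrite S1; field.
  + apply: (mulfI nz); have -> : p * u o1 0 = - (q * u o2 0).
      by apply/eqP; rewrite -addr_eq0 S0.
    by field.
  + by rewrite divfK.
- exists (- (u o1 0 / q)); apply: colE3; rewrite [RHS]mxE ?w0 ?w1 ?w2.
  + by apply: (mulfI nz); rewrite S2; field.
  + by field.
  + apply: (mulfI nz); have -> : q * u o2 0 = - (p * u o1 0).
      by apply/eqP; rewrite -addr_eq0 addrC S0.
    by field.
- exists (u o0 0 / r); apply: colE3; rewrite [RHS]mxE ?w0 ?w1 ?w2.
  + by rewrite divfK.
  + apply: (mulfI nz); have -> : r * u o1 0 = - (q * u o0 0) by rewrite S2 opprK.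
    by field.
  + by apply: (mulfI nz); rewrite -S1; field.
Qed.

(* S is alternating and every A in F is self-adjoint for S, so F stabilizes the
   radical of S, which is a line unless S = 0. *)
Lemma skew_irreducible (F : {vspace 'M[K]_3}) (S : 'M[K]_3) :
  1%:M \in F -> no_stable_line F ->
  (forall A (u : 'cV_3), A \in F -> u^T *m S *m A *m u = 0) -> S = 0.
Proof.
move=> F1 irr h.
have sk : S^T = - S.
  by apply: alternating_skew => u; have := h _ u F1; rewrite mulmx1.
apply/eqP/negPn/negP => nS; have [w nw [Sw kw]] := skew3_ker sk nS.
apply: (irr w nw) => A FA; apply: kw.
have : (S *m A)^T = - (S *m A) by apply: alternating_skew => u; rewrite mulmxA h.
rewrite trmx_mul sk mulmxN => /oppr_inj e.
by rewrite mulmxA -e -mulmxA Sw mulmx0.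
Qed.

End SkewThree.

Lemma quad_vanish (K : fieldType) (W : lmodType K) (Y T : W) : 3%N \in [pchar K] ->
  Y + T = 0 -> - Y + T = 0 -> T = 0 /\ Y = 0.
Proof.
move=> ch3 /eqP; rewrite addr_eq0 => /eqP -> /eqP; rewrite opprK -mulr2n -scaler_nat.
rewrite scaler_eq0 (negbTE (two_neq0 ch3)) => /eqP ->.
by rewrite oppr0.
Qed.

(** * Lifts to V of rank one nilpotents of the quotient by x *)

Section LiftedRankOne.
Variables (K : fieldType) (L : closedFieldType) (f : {rmorphism K -> L}).
Hypothesis ch3 : 3%N \in [pchar K].
Variables (n : nat) (V : {vspace 'M[K]_n}) (x : 'cV[K]_n).
Hypothesis sV : spec1_space f V.
Implicit Types (l r : 'rV[K]_n) (v e u : 'cV[K]_n) (N B M : 'M[K]_n).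

Lemma bil_eq0l phi N u : phi *m N = 0 -> bil phi N u = 0.
Proof. by rewrite /bil => ->; rewrite mul0mx mxE. Qed.

Lemma bil_eq0r phi N u : N *m u = 0 -> bil phi N u = 0.
Proof. by rewrite /bil -mulmxA => ->; rewrite mulmx0 mxE. Qed.

Lemma bilDu phi N u v : bil phi N (u + v) = bil phi N u + bil phi N v.
Proof. by rewrite /bil mulmxDr [LHS]mxE. Qed.

Lemma bilZu phi N a u : bil phi N (a *: u) = a * bil phi N u.
Proof. by rewrite /bil -scalemxAr [LHS]mxE. Qed.

Lemma bilDN phi N B u : bil phi (N + B) u = bil phi N u + bil phi B u.
Proof. by rewrite /bil mulmxDr mulmxDl [LHS]mxE. Qed.

Lemma bil_sub phi N u w : N *m u = w -> bil phi N u = (phi *m w) 0 0.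
Proof. by move=> <-; rewrite /bil mulmxA. Qed.

(** On K^n / x this matrix of V acts as the square-zero matrix v l; the correction x r has its image
    in the line of x. *)
Definition lifted v l r := [/\ l *m x = 0, l *m v = 0, r *m x = 0 & v *m l + x *m r \in V].

Lemma lifted_trace v l r : lifted v l r -> \tr (v *m l + x *m r) = 0.
Proof. by case=> lx lv rx _; rewrite mxtraceD !mxtrace_colrow lv rx !mxE addr0. Qed.

Lemma lifted_mul v l r N : lifted v l r -> N \in V -> bil l N v + bil r N x = 0.
Proof.
move=> h NV; have t := lifted_trace h; have [lx lv rx MV] := h.
have := spec1_tr_mul0 ch3 sV MV NV t.
by rewrite mxtrace_mulC mulmxDr mxtraceD !tr_mul_cr.
Qed.

Lemma lifted_sqr v l r : lifted v l r ->
  (v *m l + x *m r) *m (v *m l + x *m r) = (r *m v) 0 0 *: (x *m l).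
Proof.
case=> lx lv rx _; rewrite mulmxDl !mulmxDr.
have z u w (a b : 'rV[K]_n) : a *m w = 0 -> u *m a *m (w *m b) = 0.
  by move=> e; rewrite mulmxA -(mulmxA u) e mulmx0 mul0mx.
rewrite (z _ _ _ _ lv) (z _ _ _ _ lx) (z _ _ _ _ rx) !add0r addr0.
by rewrite mulmxA -(mulmxA x) {1}[r *m v]mx11_scalar mul_mx_scalar -scalemxAl.
Qed.

(** This is [spec1_sqr_polar] at M = v l + x r, whose square is (r v) x l. The conditions on B make
    all other products vanish on the right. *)
Lemma lifted_relation v l r N B a : lifted v l r -> N \in V -> B \in V ->
  B *m x = a *: x -> bil l B v = 0 ->
  (r *m v) 0 0 * (a * bil l N x + bil l (B *m N) x) = 2%:R * (bil l N x * bil r B v).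
Proof.
move=> h NV BV Bx lBv; have t := lifted_trace h; have [lx lv rx MV] := h.
have := spec1_sqr_polar ch3 sV MV NV BV t.
rewrite (lifted_sqr h) -scalemxAr linearZ /= tr_mul_cr bilDN.
have -> : bil l (N *m B) x = a * bil l N x.
  by rewrite /bil mulmxA -(mulmxA _ B) Bx -scalemxAr [LHS]mxE.
move=> ->; congr (_ * _).
rewrite !mulmxDr !mulmxDl !mxtraceD !tr_crcr lBv mul0r add0r.
have -> : bil l B x = 0 by rewrite (bil_sub l Bx) -scalemxAr lx scaler0 mxE.
have -> : bil r B x = 0 by rewrite (bil_sub r Bx) -scalemxAr rx scaler0 mxE.
ring.
Qed.

(** Now M^2 = 0, so tr(NMNM) = 0. With l N x = 0 this trace is (l N v)^2 + (r N x)^2, and l N v = -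
    r N x by [lifted_mul]. *)
Lemma lifted_vanish v l r N : lifted v l r -> r *m v = 0 -> N \in V ->
  bil l N x = 0 -> bil r N x = 0.
Proof.
move=> h rv NV lN; have t := lifted_trace h; have [lx lv rx MV] := h.
have := spec1_sqr ch3 sV MV NV t.
rewrite (lifted_sqr h) rv mxE scale0r mulmx0 mxtrace0.
rewrite !mulmxDr !mulmxDl !mxtraceD !tr_crcr lN.
have -> : bil l N v = - bil r N x.
  by apply/eqP; rewrite -addr_eq0; apply/eqP; exact: lifted_mul h NV.
move=> /esym/eqP; rewrite mulrNN mul0r mulr0 addr0 add0r -mulr2n -mulr_natl mulf_eq0.
by rewrite (negbTE (two_neq0 ch3)) mulf_eq0 orbb => /eqP.
Qed.

Lemma rank_one_kill e l N : l *m e = 0 -> e *m l \in V -> N \in V -> bil l N e = 0.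
Proof.
move=> le eV NV; have t : \tr (e *m l) = 0 by rewrite mxtrace_colrow le mxE.
by have := spec1_tr_mul0 ch3 sV eV NV t; rewrite mxtrace_mulC tr_mul_cr.
Qed.

Lemma rank_one_cube e l N : l *m e = 0 -> e *m l \in V -> N \in V ->
  bil l (N *m N *m N) e = 0.
Proof.
move=> le eV NV; have t : \tr (e *m l) = 0 by rewrite mxtrace_colrow le mxE.
have := spec1_cube ch3 sV eV NV t; rewrite mulmxA tr_mul_cr; apply.
by rewrite mulmxA -(mulmxA e) le mulmx0 mul0mx.
Qed.

Hypothesis adx : adapted V x.
Hypothesis surj : forall c : 'cV_n, exists2 N, N \in V & exists a, N *m x = c + a *: x.

Lemma surj_bil (c : 'cV_n) : exists2 N, N \in V & forall l B, l *m x = 0 ->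
  l *m B *m x = 0 -> bil l N x = (l *m c) 0 0 /\ bil l (B *m N) x = (l *m B *m c) 0 0.
Proof.
have [N NV [a Nx]] := surj c; exists N => // l B lx lBx; split.
  by rewrite (bil_sub l Nx) mulmxDr -scalemxAr lx scaler0 addr0.
by rewrite /bil mulmxA -mulmxA Nx mulmxDr -scalemxAr lBx scaler0 addr0.
Qed.

(** Two lifts differ by x (r - r'), which adaptedness forces to be zero. *)
Lemma lifted_unique v l r r' : lifted v l r -> lifted v l r' -> r = r'.
Proof.
move=> [_ _ rx MV] [_ _ rx' MV']; apply/eqP; rewrite -subr_eq0; apply/eqP/adx.
  by rewrite mulmxBl rx rx' subrr.
by have := memvB MV MV'; rewrite opprD addrACA subrr add0r mulmxBr.
Qed.

Lemma liftedD v l r l' r' : lifted v l r -> lifted v l' r' -> lifted v (l + l') (r + r').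
Proof.
move=> [a1 a2 a3 a4] [b1 b2 b3 b4]; split; rewrite ?mulmxDl ?a1 ?a2 ?a3 ?b1 ?b2 ?b3 ?addr0 //.
by have := memvD a4 b4; rewrite addrACA !mulmxDr.
Qed.

Lemma liftedZ v l r c : lifted v l r -> lifted v (c *: l) (c *: r).
Proof.
move=> [a1 a2 a3 a4]; split; rewrite -?scalemxAl ?a1 ?a2 ?a3 ?scaler0 //.
by have := memvZ c a4; rewrite scalerDr !scalemxAr.
Qed.

(** As N x is arbitrary modulo x, [lifted_vanish] says that r vanishes wherever l does. *)
Lemma lifted_proportional v l r : lifted v l r -> r *m v = 0 -> l != 0 ->
  exists s, r = s *: l.
Proof.
move=> h rv nl; have [lx lv rx MV] := h; apply: row_proportional => // c lc.
have [N NV hN] := surj_bil c.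
have z (l' : 'rV_n) : l' *m 0 *m x = 0 by rewrite mulmx0 mul0mx.
have [e1 _] := hN l 0 lx (z l); have [e2 _] := hN r 0 rx (z r).
by rewrite -e2; apply: lifted_vanish h rv NV _; rewrite e1.
Qed.

(** By uniqueness l |-> r is linear, and a linear map that sends every vector to a multiple of
    itself is a scalar. [P] serves to restrict l to the rows that annihilate a whole block. *)
Lemma lifted_scalar (P : 'rV[K]_n -> Prop) v :
  (forall l l', P l -> P l' -> P (l + l')) ->
  (exists l0 r0, [/\ P l0, lifted v l0 r0 & l0 != 0]) ->
  (forall l r, P l -> lifted v l r -> r *m v = 0) ->
  exists s, forall l r, P l -> lifted v l r -> r = s *: l.
Proof.
move=> PD [l0 [r0 [P0 h0 n0]]] hz; have [s es] := lifted_proportional h0 (hz _ _ P0 h0) n0.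
exists s => l r Pl h; have [[c e]|no] := pselect (exists c, l = c *: l0).
  have := liftedZ c h0; rewrite -e => h'; rewrite (lifted_unique h h') es e.
  by rewrite !scalerA mulrC.
have nl : l != 0 by apply/eqP => e; apply: no; exists 0; rewrite e scale0r.
have nl0 : l + l0 != 0.
  apply/eqP => e; apply: no; exists (-1); rewrite scaleN1r.
  by apply/eqP; rewrite -addr_eq0 e.
have hD := liftedD h h0.
have [s1 e1] := lifted_proportional h (hz _ _ Pl h) nl.
have [s2 e2] := lifted_proportional hD (hz _ _ (PD _ _ Pl P0) hD) nl0.
move: e2; rewrite e1 es scalerDr => /eqP; rewrite -subr_eq0 opprD addrACA -!scalerBl => /eqP e2.
have [d|nd] := eqVneq (s1 - s2) 0.
  move: e2; rewrite d scale0r add0r => /eqP; rewrite scaler_eq0 (negbTE n0) orbF subr_eq0.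
  by move=> /eqP ->; congr (_ *: _); apply/eqP; rewrite -subr_eq0 d.
case: no; exists (- ((s1 - s2)^-1 * (s - s2))); rewrite scaleNr -scalerA.
apply: oppr_inj; rewrite opprK -[LHS](scalerK nd); congr (_ *: _).
by rewrite scalerN; apply/eqP; rewrite eqr_oppLR -addr_eq0 e2.
Qed.

Definition liftable v := forall l, l *m x = 0 -> l *m v = 0 -> exists r, lifted v l r.

(** After v is shifted to e = v + s x, every lift becomes the rank one matrix e l. Then l N e = 0
    for all rows l that annihilate e and x, which puts N e in their span. *)
Lemma rank_one_line v : liftable v -> (exists2 l0 : 'rV_n, l0 != 0 & l0 *m x = 0 /\ l0 *m v = 0) ->
  (forall l r, lifted v l r -> r *m v = 0) ->
  exists s, let e := v + s *: x in
    (forall l : 'rV_n, l *m x = 0 -> l *m v = 0 -> l *m e = 0 /\ e *m l \in V) /\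
    (forall N : 'M_n, N \in V -> exists al be, N *m e = al *: e + be *: x).
Proof.
move=> hl [l0 n0 [l0x l0v]] hz; have [r0 h0] := hl l0 l0x l0v.
have [||l r _|s hs] := @lifted_scalar (fun=> True) v; [by []|by exists l0, r0|exact: hz|].
exists s => e.
have eP (l : 'rV_n) : l *m x = 0 -> l *m v = 0 -> l *m e = 0 /\ e *m l \in V.
  move=> lx lv; split; first by rewrite mulmxDr -scalemxAr lx lv scaler0 addr0.
  have [r h] := hl l lx lv; have [_ _ _] := h.
  by rewrite (hs _ _ I h) /e mulmxDl -scalemxAl -scalemxAr.
split=> // N NV.
have [|w ew] := @in_column_span K n (1 + 1) (row_mx e x) (N *m e).
  move=> phi; rewrite mul_mx_row -[0 in X in X -> _]row_mx0 => /eq_row_mx[pe px].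
  have pv : phi *m v = 0.
    by move: pe; rewrite mulmxDr -scalemxAr px scaler0 addr0.
  have [_ eV] := eP _ px pv.
  apply: mx11P; rewrite mulmxA [RHS]mxE; exact: rank_one_kill pe eV NV.
exists (usubmx w 0 0), (dsubmx w 0 0).
rewrite ew -{1}[w]vsubmxK mul_row_col {1}[usubmx w]mx11_scalar {1}[dsubmx w]mx11_scalar.
by rewrite !mul_mx_scalar.
Qed.

(** Expansion of l N^3 e = 0 along N e = al e + be x, using l N e = 0. *)
Lemma line_relation e l N al be : l *m x = 0 -> l *m e = 0 -> e *m l \in V ->
  N \in V -> N *m e = al *: e + be *: x ->
  be * (al * bil l N x + bil l (N *m N) x) = 0.
Proof.
move=> lx le eV NV Ne; have := rank_one_cube le eV NV.
have lNe := rank_one_kill le eV NV.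
have -> : bil l (N *m N *m N) e = al * bil l (N *m N) e + be * bil l (N *m N) x.
  by rewrite -!bilZu -bilDu -Ne /bil !mulmxA.
have -> : bil l (N *m N) e = al * bil l N e + be * bil l N x.
  by rewrite -!bilZu -bilDu -Ne /bil !mulmxA.
by rewrite lNe mulr0 add0r => <-; ring.
Qed.

(* B perturbs N in [line_relation]; comparing N, N + B and N - B isolates the
   coefficients of the resulting polynomial. *)
Theorem stable_line_of_lifts v l0 B : (forall c, v != c *: x) -> liftable v ->
  B \in V -> B *m x = 0 -> (exists b, B *m v = b *: x) ->
  l0 *m x = 0 -> l0 *m v = 0 -> l0 *m B != 0 ->
  exists2 e : 'cV_n, e != 0 & forall N : 'M_n, N \in V -> exists c, N *m e = c *: e.
Proof.
move=> nv hl BV Bx [b Bv] l0x l0v lB.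
have n0 : l0 != 0 by apply: contraNneq lB => ->; rewrite mul0mx.
have B0 : B *m x = 0 *: x by rewrite scale0r.
have nz (l r : 'rV_n) : lifted v l r -> r *m v != 0 -> l *m B = 0.
  move=> h nrv; have [lx lv rx _] := h; apply: row_eq0 => c.
  have lBx : l *m B *m x = 0 by rewrite -mulmxA Bx mulmx0.
  have [N NV hN] := surj_bil c; have [_ e] := hN l B lx lBx.
  have := lifted_relation h NV BV B0 _; rewrite (bil_sub l Bv) -scalemxAr lx scaler0 mxE.
  have rBv : bil r B v = 0 by rewrite (bil_sub r Bv) -scalemxAr rx scaler0 mxE.
  move=> /(_ erefl); rewrite mul0r add0r e rBv !mulr0 => /eqP; rewrite mulf_eq0 => /orP[/eqP h0|/eqP //].
  by case/eqP: nrv; apply: mx11P; rewrite h0 mxE.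
(* A row with r v nonzero is killed by B. The row l0 is not, so its own correction annihilates v;
   hence l + l0 still has a nonzero value at v although B does not kill it. *)
have hz (l r : 'rV_n) : lifted v l r -> r *m v = 0.
  move=> h; apply/eqP/negPn/negP => nrv; have lB0 := nz _ _ h nrv.
  have [r0 h0] := hl l0 l0x l0v.
  have r0v : r0 *m v = 0.
    by apply/eqP/negPn/negP => /(nz _ _ h0) e; case/eqP: lB.
  have := nz _ _ (liftedD h h0); rewrite mulmxDl r0v addr0 => /(_ nrv).
  by rewrite mulmxDl lB0 add0r => /eqP; rewrite (negbTE lB).
have [|s [eP hN]] := rank_one_line hl _ hz; first by exists l0.
set e := v + s *: x in eP hN; have [l0e e0V] := eP _ l0x l0v.
have Be : B *m e = b *: x by rewrite mulmxDr Bv -scalemxAr Bx scaler0 addr0.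
have l0Bx : l0 *m B *m x = 0 by rewrite -mulmxA Bx mulmx0.
have key (N : 'M_n) al be : N \in V -> N *m e = al *: e + be *: x ->
  b * bil l0 (B *m N) x = 0 /\
  be * bil l0 (B *m N) x + b * (al * bil l0 N x + bil l0 (N *m N) x) = 0.
  move=> NV Ne.
  have p0 := line_relation l0x l0e e0V NV Ne.
  have q (t : K) :
    (be + t * b) * (al * bil l0 N x + (bil l0 (N *m N) x + t * bil l0 (B *m N) x)) = 0.
    have NtV : N + t *: B \in V by rewrite memvD // memvZ.
    have Nte : (N + t *: B) *m e = al *: e + (be + t * b) *: x.
      by rewrite mulmxDl Ne -scalemxAl Be scalerA scalerDl addrA.
    rewrite -(line_relation l0x l0e e0V NtV Nte); congr (_ * (_ * _ + _)).
      by rewrite bilDN [X in _ + X]bil_eq0r ?addr0 // -scalemxAl Bx scaler0.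
    have Ntx : (N + t *: B) *m x = N *m x by rewrite mulmxDl -scalemxAl Bx scaler0 addr0.
    have -> : bil l0 ((N + t *: B) *m (N + t *: B)) x = bil l0 ((N + t *: B) *m N) x.
      by rewrite /bil -!mulmxA Ntx.
    rewrite mulmxDl bilDN -scalemxAl; congr (_ + _).
    by rewrite /bil -scalemxAr -scalemxAl [RHS]mxE.
  have q1 := q 1; have q2 := q (-1).
  have q3 (y : K) : 2%:R * y = 0 -> y = 0.
    by move=> /eqP; rewrite mulf_eq0 (negbTE (two_neq0 ch3)) => /eqP.
  set P := al * _ in p0 q1 q2 *; set Q := bil l0 (N *m N) x in p0 q1 q2 *.
  set R := bil l0 (B *m N) x in q1 q2 *.
  split; apply: q3.
    have -> : 2%:R * (b * R) = (be + 1 * b) * (P + (Q + 1 * R))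
      + (be + -1 * b) * (P + (Q + -1 * R)) - 2%:R * (be * (P + Q)) by ring.
    by rewrite q1 q2 p0 mulr0 subr0 addr0.
  have -> : 2%:R * (be * R + b * (P + Q)) = (be + 1 * b) * (P + (Q + 1 * R))
      - (be + -1 * b) * (P + (Q + -1 * R)) by ring.
  by rewrite q1 q2 subrr.
have [c lBc] := row_neq0 lB.
have [N1 N1V hN1] := surj_bil c; have [_ e1] := hN1 l0 B l0x l0Bx.
have [al1 [be1 Ne1]] := hN _ N1V.
have b0 : b = 0.
  by have [+ _] := key _ _ _ N1V Ne1; rewrite e1 lBc mulr1.
have key2 (N : 'M_n) al be : N \in V -> N *m e = al *: e + be *: x -> be * bil l0 (B *m N) x = 0.
  by move=> NV Ne; have [_ ] := key _ _ _ NV Ne; rewrite b0 mul0r addr0.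
have be10 : be1 = 0 by have := key2 _ _ _ N1V Ne1; rewrite e1 lBc mulr1.
exists e.
  rewrite /e addr_eq0 -scaleNr; exact: nv.
move=> N NV; have [al [be Ne]] := hN _ NV; exists al.
have [be_0|nbe] := eqVneq be 0; first by rewrite Ne be_0 scale0r addr0.
have /eqP := key2 _ _ _ NV Ne; rewrite mulf_eq0 (negbTE nbe) => /eqP q0.
(* At N the second factor of [key2] is zero. Adding N1, where that factor is 1 and be1 = 0, gives a
   matrix with the same coefficient be and a nonzero factor. *)
have NN1 : (N + N1) *m e = (al + al1) *: e + (be + be1) *: x.
  by rewrite mulmxDl Ne Ne1 addrACA -!scalerDl.
have := key2 _ _ _ (memvD NV N1V) NN1.
rewrite mulmxDr bilDN q0 add0r e1 lBc mulr1 be10 addr0 => be0.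
by rewrite be0 eqxx in nbe.
Qed.

Section ThreeDimensionalBlock.
Variables (z : 'M[K]_(n, 3)) (F : {vspace 'M[K]_3}) (l0 : 'rV[K]_n).
Hypothesis F1 : 1%:M \in F.
Hypothesis irrF : no_stable_line F.
Hypothesis hl : forall (u : 'cV_3) l, l *m x = 0 -> l *m z = 0 -> exists r, lifted (z *m u) l r.
Hypothesis hF : forall A, A \in F -> exists B : 'M_n, exists rho : 'rV_3,
  [/\ B \in V, B *m x = 0, B *m z = z *m A + x *m rho &
      forall l, l *m x = 0 -> l *m z = 0 -> l *m B = 0].
Hypotheses (l00 : l0 != 0) (l0x : l0 *m x = 0) (l0z : l0 *m z = 0).

Lemma lifted_sum l (Rm : 'M[K]_(3, n)) (u : 'cV_3) : l *m x = 0 -> l *m z = 0 ->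
  (forall i, lifted (z *m delta_mx i 0) l (row i Rm)) -> lifted (z *m u) l (u^T *m Rm).
Proof.
move=> lx lz h.
have uE : u = \sum_i u i 0 *: delta_mx i 0.
  by rewrite {1}[u]matrix_sum_delta; apply: eq_bigr => i _; rewrite big_ord1.
have e : z *m u *m l + x *m (u^T *m Rm) =
    \sum_i u i 0 *: (z *m delta_mx i 0 *m l + x *m row i Rm).
  rewrite {1}uE mulmx_sumr mulmx_suml; under [RHS]eq_bigr => i _ do rewrite scalerDr.
  rewrite big_split /=; congr (_ + _).
    by apply: eq_bigr => i _; rewrite -scalemxAr -scalemxAl.
  rewrite mulmx_sum_row mulmx_sumr; apply: eq_bigr => i _.
  by rewrite -scalemxAr mxE.
split=> //; first by rewrite mulmxA lz mul0mx.
  rewrite -mulmxA; suff -> : Rm *m x = 0 by rewrite mulmx0.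
  by apply/row_matrixP => i; rewrite row_mul row0; have [_ _ ->] := h i.
by rewrite e; apply: memv_suml => i _; apply: memvZ; have [_ _ _] := h i.
Qed.

(** For fixed l the corrections of the lifts of z u, read on the block, form a bilinear form S.
    Applied to the matrices over F, [lifted_relation] gives u^T S A u = 0, so S = 0 by
    irreducibility. *)
Lemma lifted_kill_block (u : 'cV_3) l r : l *m z = 0 -> lifted (z *m u) l r -> r *m z = 0.
Proof.
move=> lz h; have [lx _ rx _] := h.
have [l_0|nl] := eqVneq l 0.
  have h0 : lifted (z *m u) 0 0 by split; rewrite ?mul0mx ?mulmx0 ?addr0 ?mem0v.
  by move: h; rewrite l_0 => h; rewrite (lifted_unique h h0) mul0mx.
have ex i : exists r', lifted (z *m delta_mx i 0) l r' by apply: hl.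
have [g hg] := boolp.choice ex; pose Rm : 'M[K]_(3, n) := \matrix_i g i.
have hR i : lifted (z *m delta_mx i 0) l (row i Rm) by rewrite rowK.
have S0 : Rm *m z = 0.
  apply: (skew_irreducible ch3 F1 irrF) => A u' FA.
  have h' := lifted_sum u' lx lz hR; have [_ _ rx' _] := h'.
  have [B [rho [BV Bx Bz lB]]] := hF FA; have lB0 := lB l lx lz.
  have [c lc] := row_neq0 nl; have [N NV hN] := surj_bil c.
  have z0 : l *m 0 *m x = 0 :> 'M_1 by rewrite mulmx0 mul0mx.
  have [e1 _] := hN l 0 lx z0.
  have B0 : B *m x = 0 *: x by rewrite scale0r.
  have := lifted_relation h' NV BV B0 _; rewrite (bil_eq0l _ lB0) => /(_ erefl).
  rewrite mul0r add0r [bil l (B *m N) x]bil_eq0l ?mulmxA ?lB0 ?mul0mx // mulr0.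
  rewrite e1 lc mul1r => /esym/eqP; rewrite mulf_eq0 (negbTE (two_neq0 ch3)) => /eqP e.
  apply: mx11P; rewrite [RHS]mxE -e.
  have Bv : B *m (z *m u') = z *m (A *m u') + x *m (rho *m u').
    by rewrite (mulmxA B) Bz mulmxDl !mulmxA.
  by rewrite (bil_sub _ Bv) mulmxDr [_ *m (x *m _)]mulmxA rx' mul0mx addr0 !mulmxA.
have := lifted_sum u lx lz hR => h'.
by rewrite (lifted_unique h h') -mulmxA S0 mulmx0.
Qed.

(** The argument for a line, with z + x s in place of e and with a matrix D over the identity of F
    as the perturbation. *)
Theorem stable_block_of_lifts : exists s : 'rV_3, forall N : 'M_n, N \in V ->
  exists A, N *m (z + x *m s) = (z + x *m s) *m A.
Proof.
(* Each column of z has its own scalar; together they form the row s. *)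
have ex i : exists si, forall l r, l *m z = 0 -> lifted (z *m delta_mx i 0) l r -> r = si *: l.
  have [r0 h0] := hl (delta_mx i 0) l0x l0z.
  apply: (@lifted_scalar (fun l => l *m z = 0)) => [l l' lz lz'||l r lz h].
  - by rewrite mulmxDl lz lz' addr0.
  - by exists l0, r0.
  - by rewrite mulmxA (lifted_kill_block lz h) mul0mx.
have [g hg] := boolp.choice ex; exists (\row_i g i); set s := \row_i g i.
set z' := z + x *m s.
have lz' l : l *m x = 0 -> l *m z = 0 -> l *m z' = 0.
  by move=> lx lz; rewrite mulmxDr lz mulmxA lx mul0mx addr0.
have z'V (u : 'cV_3) l : l *m x = 0 -> l *m z = 0 -> z' *m u *m l \in V.
  move=> lx lz; pose Rm : 'M[K]_(3, n) := \matrix_i (g i *: l).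
  have hR i : lifted (z *m delta_mx i 0) l (row i Rm).
    by have [r h] := hl (delta_mx i 0) lx lz; rewrite rowK -(hg i l r).
  have [_ _ _] := lifted_sum u lx lz hR.
  suff -> : z' *m u *m l = z *m u *m l + x *m (u^T *m Rm) by [].
  rewrite /z' !mulmxDl; congr (_ + _); rewrite -!mulmxA; congr (x *m _).
  have -> : Rm = s^T *m l.
    apply/row_matrixP => i; rewrite rowK row_mul.
    have -> : row i s^T = (g i)%:M by apply: mx11P; rewrite !mxE eqxx mulr1n.
    by rewrite mul_scalar_mx.
  rewrite mulmxA [RHS]mulmxA; congr (_ *m l).
  by apply: mx11P; rewrite -trmx_mul [RHS]mxE.
have kill N l : N \in V -> l *m x = 0 -> l *m z = 0 -> l *m N *m z' = 0.
  move=> NV lx lz; apply: row_eq0 => u; have := rank_one_kill _ (z'V u l lx lz) NV.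
  by rewrite /bil !mulmxA lz' // mul0mx => /(_ erefl).
have dec N : N \in V -> exists A be, N *m z' = z' *m A + x *m be.
  move=> NV.
  have ex' (j : 'I_3) : exists w, N *m col j z' = row_mx z' x *m w.
    apply: in_column_span => phi; rewrite mul_mx_row -[0 in X in X -> _]row_mx0.
    move=> /eq_row_mx[pz px].
    have pz0 : phi *m z = 0 by move: pz; rewrite mulmxDr mulmxA px mul0mx addr0.
    by rewrite colE !mulmxA (kill N phi NV px pz0) mul0mx.
  have [w hw] := boolp.choice ex'; pose W : 'M_(3 + 1, 3) := \matrix_(i, j) w j i 0.
  exists (usubmx W), (dsubmx W); rewrite -mul_row_col vsubmxK.
  apply: (can_inj trmxK); apply/row_matrixP => j; rewrite -!tr_col; congr (_^T).
  rewrite [LHS]colE -mulmxA -colE hw [RHS]colE -mulmxA -colE; congr (_ *m _).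
  by apply/colP => i; rewrite !mxE.
have rel N A be l : N \in V -> l *m x = 0 -> l *m z = 0 -> N *m z' = z' *m A + x *m be ->
  bil l N x *: (be *m A) + bil l (N *m N) x *: be = 0.
  move=> NV lx lz Nz; apply: row_eq0 => u.
  have := rank_one_cube _ (z'V u l lx lz) NV; rewrite mulmxA lz' // mul0mx => /(_ erefl) <-.
  rewrite /bil !mulmxA.
  have e2 : l *m N *m N *m z' = l *m N *m x *m be.
    by rewrite -mulmxA Nz mulmxDr !mulmxA (kill N l NV lx lz) mul0mx add0r.
  have -> : l *m N *m N *m N *m z' *m u = l *m N *m x *m be *m A *m u + l *m N *m N *m x *m be *m u.
    by rewrite -[_ *m N *m z']mulmxA Nz mulmxDr mulmxDl !mulmxA e2.
  rewrite {2}[l *m N *m x]mx11_scalar {2}[l *m N *m N *m x]mx11_scalar.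
  by rewrite !mul_scalar_mx mulmxDl -!scalemxAl.
have [D [rho [DV Dx Dz lD]]] := hF F1.
have [de Dz'] : exists de, D *m z' = z' + x *m de.
  exists (rho - s); rewrite /z' (mulmxDr D) Dz (mulmxA D) Dx mul0mx addr0 mulmx1 mulmxBr -addrA.
  by congr (_ + _); rewrite addrC subrK.
(* Replacing N by N + t D makes [rel] a polynomial in t of degree 2 with constant term zero; the
   values t = 1 and t = -1 separate the other two coefficients. *)
have key N A be l : N \in V -> l *m x = 0 -> l *m z = 0 -> N *m z' = z' *m A + x *m be ->
  bil l N x *: de = 0 /\
  bil l N x *: (be + de *m A) + bil l (N *m N) x *: de = 0.
  move=> NV lx lz Nz; have p0 := rel N A be l NV lx lz Nz.
  have lD0 := lD l lx lz.
  have q (t : K) : bil l N x *: ((be + t *: de) *m (A + t%:M))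
      + bil l (N *m N) x *: (be + t *: de) = 0.
    have NtV : N + t *: D \in V by rewrite memvD // memvZ.
    have Ntz : (N + t *: D) *m z' = z' *m (A + t%:M) + x *m (be + t *: de).
      rewrite mulmxDl Nz -scalemxAl Dz' !mulmxDr mul_mx_scalar scalerDr -scalemxAr.
      by rewrite addrACA.
    have Ntx : (N + t *: D) *m x = N *m x by rewrite mulmxDl -scalemxAl Dx scaler0 addr0.
    have lNt : l *m (N + t *: D) = l *m N by rewrite mulmxDr -scalemxAr lD0 scaler0 addr0.
    have <- : bil l (N + t *: D) x = bil l N x by rewrite /bil lNt.
    have <- : bil l ((N + t *: D) *m (N + t *: D)) x = bil l (N *m N) x.
      by rewrite /bil !mulmxA lNt -mulmxA Ntx mulmxA.
    exact: rel.
  have q1 := q 1; have q2 := q (-1).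
  have qE (t : K) : bil l N x *: ((be + t *: de) *m (A + t%:M))
      + bil l (N *m N) x *: (be + t *: de) =
      (bil l N x *: (be *m A) + bil l (N *m N) x *: be)
      + t *: (bil l N x *: (be + de *m A) + bil l (N *m N) x *: de)
      + (t * t) *: (bil l N x *: de).
    have -> : (be + t *: de) *m (A + t%:M) = be *m A + t *: (de *m A) + (t *: be + (t * t) *: de).
      by rewrite mulmxDr !mulmxDl !mul_mx_scalar -!scalemxAl scalerA.
    by move: (be *m A) (de *m A) => X Y; apply/rowP => j; rewrite !mxE; ring.
  move: q1 q2; rewrite !qE p0 !add0r mulNr mulrN opprK mulr1 !scale1r scaleN1r.
  by move=> h1 h2; have [] := quad_vanish ch3 h1 h2.
have [c lc] := row_neq0 l00; have [N1 N1V hN] := surj_bil c.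
have z0 : l0 *m 0 *m x = 0 :> 'M_1 by rewrite mulmx0 mul0mx.
have [e1 _] := hN l0 0 l0x z0.
have de0 : de = 0.
  have [A [be Nz]] := dec _ N1V; have [+ _] := key _ _ _ _ N1V l0x l0z Nz.
  by rewrite e1 lc scale1r.
have key2 N A be : N \in V -> N *m z' = z' *m A + x *m be -> bil l0 N x *: be = 0.
  move=> NV Nz; have [_] := key _ _ _ _ NV l0x l0z Nz.
  by rewrite de0 mul0mx scaler0 !addr0.
move=> N NV; have [A [be Nz]] := dec _ NV; exists A.
suff be0 : be = 0 by rewrite Nz be0 mulmx0 addr0.
have [A1 [be1 Nz1]] := dec _ N1V.
have be10 : be1 = 0 by have := key2 _ _ _ N1V Nz1; rewrite e1 lc scale1r.
have /eqP := key2 _ _ _ NV Nz; rewrite scaler_eq0 => /orP[/eqP q0|/eqP //].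
have NNz : (N + N1) *m z' = z' *m (A + A1) + x *m (be + be1).
  by rewrite mulmxDl Nz Nz1 !mulmxDr addrACA.
have := key2 _ _ _ (memvD NV N1V) NNz.
by rewrite bilDN q0 add0r e1 lc scale1r be10 addr0.
Qed.

End ThreeDimensionalBlock.

End LiftedRankOne.

(** * Four dimensions: the block fills the quotient *)

Section FourDimensional.
Variables (K : fieldType) (L : closedFieldType) (f : {rmorphism K -> L}).
Hypothesis ch3 : 3%N \in [pchar K].
Variables (V : {vspace 'M[K]_(1 + 3)}) (F : {vspace 'M[K]_3}).
Hypothesis sV : spec1_space f V.
Hypothesis F1 : 1%:M \in F.
Hypothesis irrF : no_stable_line F.
Hypothesis trF : forall A, A \in F -> \tr A = 0.
Hypothesis surj : forall c : 'cV_3, exists2 N, N \in V & dlsubmx N = c.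

Let sqr_identity (a : 'M[K]_1) r c k (X : 'M[K]_3) :
  block_mx a r c k \in V -> block_mx 0 0 0 X \in V -> \tr X = 0 ->
  \tr (c *m r *m (X *m X)) + \tr (k *m k *m (X *m X)) = \tr (k *m X *m (k *m X)).
Proof.
move=> NV XV tX.
have t0 : \tr (block_mx 0 0 0 X : 'M[K]_(1 + 3)) = 0 by rewrite mxtrace_block tX mxtrace0 addr0.
have := spec1_sqr ch3 sV XV NV t0.
rewrite !mulmx_block !mul0mx !mulmx0 !addr0 !add0r !mulmx0 !mul0mx !addr0 ?add0r.
by rewrite !mxtrace_block !mxtrace0 !add0r mulmxDl mxtraceD.
Qed.

Hypothesis D1 : block_mx 0 0 0 1%:M \in V.
Hypothesis hF : forall A, A \in F -> exists rho, block_mx 0 rho 0 A \in V.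

(** At X = I the two terms in k of [sqr_identity] coincide, which leaves tr(c r) = 0. *)
Let rc0 (a : 'M[K]_1) r c k : block_mx a r c k \in V -> r *m c = 0.
Proof.
move=> NV; have := sqr_identity NV D1 (trF F1); rewrite !mulmx1 => /eqP.
by rewrite -subr_eq0 addrK mxtrace_colrow => /eqP e; apply: mx11P; rewrite e mxE.
Qed.

(** Adding the lift of A to N keeps the column c and replaces r by r + rho; [rc0] for both gives rho
    c = 0, and c is arbitrary. *)
Let lift0 A : A \in F -> block_mx 0 0 0 A \in V.
Proof.
move=> FA; have [rho hr] := hF FA; suff e : rho = 0 by rewrite e in hr.
apply: row_eq0 => c; have [N NV Nc] := surj c.
have : block_mx (ulsubmx N) (ursubmx N) c (drsubmx N) \in V by rewrite -Nc submxK.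
move=> NV'; have := rc0 NV'; have := memvD NV' hr; rewrite add_block_mx addr0 => /rc0.
by rewrite mulmxDl addr0 => + e; rewrite e add0r => ->; rewrite mxE.
Qed.

(** Subtracting [sqr_identity] at A from that at A + I leaves 2 tr(c r A) = 0, because r c = 0 and
    the terms in k cancel. *)
Let rAc0 (a : 'M[K]_1) r c k A : block_mx a r c k \in V -> A \in F -> r *m A *m c = 0.
Proof.
move=> NV FA; have i1 := sqr_identity NV (lift0 FA) (trF FA).
have FA1 : A + 1%:M \in F by rewrite memvD.
have := sqr_identity NV (lift0 FA1) (trF FA1).
have rc := rc0 NV.
have e3 : (A + 1%:M) *m (A + 1%:M) = A *m A + 2%:R *: A + 1%:M.
  by rewrite mulmxDl !mulmxDr !mulmx1 mul1mx scaler_nat mulr2n !addrA.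
have e4 : k *m (A + 1%:M) = k *m A + k by rewrite mulmxDr mulmx1.
rewrite e3 e4 -/(p2 (k *m A + k)) p2D mulmxA /p2 => i2.
have ex (Y : 'M[K]_3) : \tr (Y *m (A *m A + 2%:R *: A + 1%:M)) =
  \tr (Y *m (A *m A)) + 2%:R * \tr (Y *m A) + \tr Y.
  by rewrite !mulmxDr mulmx1 -scalemxAr !mxtraceD mxtraceZ.
move: i2; rewrite !ex mxtrace_colrow rc mxE => i2.
have e5 : \tr (c *m r *m A) = (r *m A *m c) 0 0 by rewrite -mulmxA mxtrace_colrow.
apply: mx11P; rewrite [RHS]mxE -e5; apply: (mulfI (two_neq0 ch3)); rewrite mulr0.
move: i1 i2; set a1 := \tr _; set b1 := \tr _; set c1 := \tr _.
set a2 := \tr _; set b2 := \tr _; set b3 := \tr _ => i1 i2.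
have -> : 2%:R * a2 = (a1 + 2%:R * a2 + 0 + (b1 + 2%:R * b2 + b3))
  - (c1 + 2%:R * b2 + b3) - (a1 + b1 - c1) by ring.
by rewrite i2 i1 !subrr.
Qed.

(** Chosen matrices of V with prescribed columns have rows given by a bilinear form S of the column.
    By [rAc0], u^T S A u = 0 for A in F, so S = 0 by irreducibility. *)
Lemma four_dim_block N : N \in V -> ursubmx N = 0.
Proof.
have [g hg] := boolp.choice (fun i : 'I_3 =>
  let: ex_intro2 N NV Nc := surj (delta_mx i 0) in ex_intro (fun N => N \in V /\ dlsubmx N = delta_mx i 0) N (conj NV Nc)).
pose S : 'M[K]_3 := \matrix_i ursubmx (g i).
pose comb (c : 'cV[K]_3) := \sum_i c i 0 *: g i.
have combV c : comb c \in V by apply: memv_suml => i _; apply: memvZ; have [] := hg i.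
have cE (c : 'cV[K]_3) : c = \sum_i c i 0 *: delta_mx i 0.
  by rewrite {1}[c]matrix_sum_delta; apply: eq_bigr => i _; rewrite big_ord1.
have combc c : dlsubmx (comb c) = c.
  by rewrite linear_sum [RHS]cE; apply: eq_bigr => i _; rewrite linearZ /=; have [_ ->] := hg i.
have combr c : ursubmx (comb c) = c^T *m S.
  rewrite linear_sum mulmx_sum_row; apply: eq_bigr => i _.
  by rewrite linearZ /= mxE rowK.
have S0 : S = 0.
  apply: (skew_irreducible ch3 F1 irrF) => A u FA; rewrite -combr -{2}(combc u).
  by apply: (rAc0 (a := ulsubmx (comb u)) (k := drsubmx (comb u))) FA; rewrite submxK.
move=> NV; apply: row_eq0 => c.
(* Since S = 0, this shift gives N the column c without changing its row, and [rc0] then tests the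
   row against every c. *)
pose N' := N + comb (c - dlsubmx N).
have N'V : N' \in V by rewrite memvD.
have d : dlsubmx N' = c by rewrite /N' linearD /= combc addrC subrK.
have u : ursubmx N' = ursubmx N by rewrite /N' linearD /= combr S0 mulmx0 addr0.
rewrite -u -d (rc0 (a := ulsubmx N') (k := drsubmx N')) ?mxE //.
by rewrite submxK.
Qed.

End FourDimensional.

(** * The model spaces *)

Section Shapes.
Variables (K : fieldType) (L : closedFieldType) (f : {rmorphism K -> L}).

Definition strict_upper n (M : 'M[K]_n) := forall i j : 'I_n, (j <= i)%N -> M i j = 0.
Definition upper n (M : 'M[K]_n) := forall i j : 'I_n, (j < i)%N -> M i j = 0.

Lemma upper_ev n (M : 'M[K]_n) a : upper M -> ev f M a = [exists i, a == f (M i i)].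
Proof.
move=> uM; rewrite evP -det_tr det_trig; last first.
  apply/is_trig_mxP => i j ij; rewrite !mxE uM // rmorph0 -val_eqE /= gtn_eqF //.
  by rewrite mulr0n subr0.
rewrite prodf_seq_eq0 /=; apply/hasP/existsP => [[i _]|[i /eqP e]].
  by rewrite !mxE eqxx subr_eq0 eq_sym; exists i.
by exists i; rewrite ?mem_index_enum // !mxE eqxx e subrr.
Qed.

Lemma strict_upper_upper n (M : 'M[K]_n) : strict_upper M -> upper M.
Proof. by move=> h i j /ltnW; exact: h. Qed.

Lemma strict_upper_nil n (M : 'M[K]_n) : strict_upper M -> nil_spec f M.
Proof.
move=> h a; rewrite upper_ev; last exact: strict_upper_upper.
by case/existsP => i /eqP ->; rewrite h // rmorph0.
Qed.

Lemma V1star_upper n (I : {set 'I_n}) (M : 'M[K]_n) : V1star I M -> upper M.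
Proof.
move=> [c h] i j ij; rewrite h ?(ltnW ij) // mxE (_ : i == j = false) ?mulr0 //.
by apply/negbTE/eqP => e; rewrite e ltnn in ij.
Qed.

Lemma V1star_ev n (I : {set 'I_n}) (M : 'M[K]_n) c : I != set0 ->
  (forall i j : 'I_n, (j <= i)%N -> M i j = c * Dmx K I i j) -> ev f M (f c).
Proof.
move=> /set0Pn[i iI] h; rewrite upper_ev; last by apply: (@V1star_upper _ I); exists c.
by apply/existsP; exists i; rewrite h // mxE eqxx iI mulr1.
Qed.

Lemma V1star_block m (I : {set 'I_m}) (J : {set 'I_(1 + m)}) (t : bool) a r B c :
  (lshift m ord0 \in J) = t -> (forall j, (rshift 1 j \in J) = (j \in I)) ->
  (forall i j : 'I_(1 + m), (j <= i)%N -> (block_mx a r 0 B : 'M_(1 + m)) i j = c * Dmx K J i j) <->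
  (a = (c * t%:R)%:M /\ forall i j : 'I_m, (j <= i)%N -> B i j = c * Dmx K I i j).
Proof.
move=> J0 JI; split=> [h|[ha hB] i j].
  split.
    have := h (lshift m ord0) (lshift m ord0) (leqnn _).
    by rewrite block_mxEul mxE eqxx J0 => e; apply: mx11P; rewrite e mxE eqxx mulr1n.
  move=> i j ij; have := h (rshift 1 i) (rshift 1 j); rewrite block_mxEdr /= leq_add2l => -> //.
  by rewrite !mxE JI (inj_eq (@rshift_inj _ _)).
case: (split_ordP i) => i' ->; case: (split_ordP j) => j' ->.
- rewrite !ord1 => _; rewrite block_mxEul ha !mxE eqxx J0 mulr1n.
  by rewrite -[_ == _]/(true) /=.
- by rewrite /= ord1.
- by rewrite block_mxEdl !mxE -val_eqE /= ord1 mulr0.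
- rewrite /= leq_add2l => ij; rewrite block_mxEdr hB // !mxE JI.
  by rewrite (inj_eq (@rshift_inj _ _)).
Qed.

Definition consI m (t : bool) (I : {set 'I_m}) : {set 'I_(1 + m)} :=
  [set i | if split i is inr j then j \in I else t].

Lemma consI0 m t (I : {set 'I_m}) : (lshift m ord0 \in consI t I) = t.
Proof. by rewrite inE (unsplitK (inl _ : 'I_1 + 'I_m)). Qed.
Lemma consIS m t (I : {set 'I_m}) j : (rshift 1 j \in consI t I) = (j \in I).
Proof. by rewrite inE (unsplitK (inr _ : 'I_1 + 'I_m)). Qed.

Lemma bkS p i : bk p.+1 i.+1 = bk p i.
Proof. by rewrite /bk addSn !ltnS. Qed.

(** Removing the first basis vector lowers p by one; [W1star_block0] is the base of this
    recursion. *)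
Lemma W1star_blockS m p (F : {vspace 'M[K]_3}) (M : 'M[K]_(1 + m)) :
  W1star p.+1 F M <-> [/\ dlsubmx M = 0, ulsubmx M = 0 & W1star p F (drsubmx M)].
Proof.
have bS (i : 'I_m) : bk p.+1 (rshift 1 i) = bk p i by exact: bkS.
split=> [[h1 h2 [A FA h3]]|[dl ul [h1 h2 [A FA h3]]]].
  split.
  - apply/matrixP => i j; rewrite ord1 !mxE.
    have [e|e] := eqVneq (bk p i) 0%N; last by rewrite h1 // bS lt0n.
    by apply: h2; rewrite ?bS ?e.
  - apply/matrixP => i j; rewrite !ord1 !mxE; exact: h2.
  - split=> [i j|i j|].
    + by rewrite -!bS => /h1; rewrite !mxE.
    + by rewrite -!bS => n1 e ij; rewrite !mxE; apply: h2; rewrite ?bS.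
    + exists A => // i j bi bj; rewrite !mxE h3 ?bS //.
have eM : M = block_mx 0 (ursubmx M) 0 (drsubmx M) by rewrite -ul -dl submxK.
have b0 (i : 'I_1) : bk p.+1 (lshift m i) = 0%N by rewrite ord1.
split=> [i j|i j|].
- rewrite eM; case: (split_ordP i) => i' ->; case: (split_ordP j) => j' ->.
  + by rewrite block_mxEul mxE.
  + by rewrite b0.
  + by rewrite block_mxEdl mxE.
  + by rewrite !bS block_mxEdr; exact: h1.
- rewrite eM; case: (split_ordP i) => i' ->; case: (split_ordP j) => j' ->.
  + by rewrite block_mxEul mxE.
  + by rewrite (ord1 i').
  + by rewrite block_mxEdl mxE.
  + by rewrite !bS block_mxEdr /= leq_add2l; exact: h2.
- exists A => // i j; rewrite eM.
  case: (split_ordP i) => i' ->; case: (split_ordP j) => j' ->; rewrite ?b0 // !bS.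
  by rewrite block_mxEdr !subSS; exact: h3.
Qed.

Lemma W1star_block0 k (F : {vspace 'M[K]_3}) (M : 'M[K]_(3 + k)) :
  W1star 0 F M <-> [/\ dlsubmx M = 0, ulsubmx M \in F & strict_upper (drsubmx M)].
Proof.
have bl (i : 'I_3) : bk 0 (lshift k i) = 1%N by rewrite /bk /= ltn_ord.
have br (i : 'I_k) : bk 0 (rshift 3 i) = 2%N by rewrite /bk.
have io (i : 'I_3) : inord (i - 0) = i by rewrite subn0 inord_val.
split=> [[h1 h2 [A FA h3]]|[dl ul su]].
  split.
  - by apply/matrixP => i j; rewrite !mxE h1 // bl br.
  - suff -> : ulsubmx M = A by [].
    by apply/matrixP => i j; rewrite !mxE h3 ?bl //= !io.
  - by move=> i j ij; rewrite !mxE h2 ?br //= leq_add2l.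
have eM : M = block_mx (ulsubmx M) (ursubmx M) 0 (drsubmx M) by rewrite -dl submxK.
split=> [i j|i j|].
- rewrite eM; case: (split_ordP i) => i' ->; case: (split_ordP j) => j' ->; rewrite ?bl ?br //.
  by rewrite block_mxEdl mxE.
- rewrite eM; case: (split_ordP i) => i' ->; case: (split_ordP j) => j' ->; rewrite ?bl ?br //.
  by rewrite block_mxEdr /= leq_add2l => _ _; exact: su.
- exists (ulsubmx M) => // i j; rewrite {1}eM.
  case: (split_ordP i) => i' ->; case: (split_ordP j) => j' ->; rewrite ?bl ?br //.
  by rewrite block_mxEul /= !io.
Qed.

Lemma W1star_ev n p (F : {vspace 'M[K]_3}) (M : 'M[K]_n) (A : 'M[K]_3) a :
  (p + 3 <= n)%N -> W1star p F M ->
  (forall i j : 'I_n, bk p i = 1%N -> bk p j = 1%N ->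
     M i j = A (inord (i - p)) (inord (j - p))) -> ev f A a -> ev f M a.
Proof.
elim: p n M => [|p IH] n M.
  case: n M => [|[|[|k]]] // M _ /(@W1star_block0 k) [dl _ _] hA eA.
  have := ev_ublock f (ulsubmx (M : 'M_(3 + k))) (ursubmx (M : 'M_(3 + k))) (drsubmx (M : 'M_(3 + k))) a.
  rewrite -{1}dl submxK => ->; suff -> : ulsubmx (M : 'M_(3 + k)) = A by rewrite eA.
  apply/matrixP => i j; rewrite !mxE hA /bk /= ?ltn_ord // !subn0 !inord_val.
  by [].
case: n M => // m M pm /(@W1star_blockS m) [dl ul hW] hA eA.
have := ev_ublock f (ulsubmx (M : 'M_(1 + m))) (ursubmx (M : 'M_(1 + m))) (drsubmx (M : 'M_(1 + m))) a.
rewrite -{1}dl submxK => ->; rewrite (IH m (drsubmx (M : 'M_(1 + m)))) ?orbT //.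
by move=> i j bi bj; rewrite !mxE (hA (rshift 1 i) (rshift 1 j)) ?bkS // !subSS.
Qed.

End Shapes.

Section StrictUpperSpace.
Variables (K : fieldType) (n : nat).

Definition lower_part (M : 'M[K]_n) : 'M[K]_n :=
  \matrix_(i, j) if (j <= i)%N then M i j else 0.
Lemma lower_part_linear : linear lower_part.
Proof.
by move=> a u v; apply/matrixP => i j; rewrite !mxE; case: ifP; rewrite ?mulr0 ?addr0.
Qed.
HB.instance Definition _ := GRing.isLinear.Build K 'M[K]_n 'M[K]_n *:%R lower_part lower_part_linear.

Definition suspace : {vspace 'M[K]_n} := lker (linfun lower_part).

Lemma suspaceP M : reflect (strict_upper M) (M \in suspace).
Proof.
rewrite memv_ker lfunE /=; apply: (iffP eqP) => [/matrixP h i j ij|h].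
  by have := h i j; rewrite !mxE ij.
by apply/matrixP => i j; rewrite !mxE; case: ifP => // /h.
Qed.

End StrictUpperSpace.

Section MiddleBlock.
Variables (K : fieldType) (L : closedFieldType) (f : {rmorphism K -> L}).

Definition Wemb n p (A : 'M[K]_3) : 'M[K]_n :=
  \matrix_(i, j) if (bk p i == 1%N) && (bk p j == 1%N) then A (inord (i - p)) (inord (j - p)) else 0.

Lemma Wemb_mid n p A (i j : 'I_n) : bk p i = 1%N -> bk p j = 1%N ->
  Wemb n p A i j = A (inord (i - p)) (inord (j - p)).
Proof. by move=> e1 e2; rewrite mxE e1 e2. Qed.

Lemma Wemb_W n p (F : {vspace 'M[K]_3}) A : A \in F -> W1star p F (Wemb n p A).
Proof.
move=> FA; split=> [i j|i j n1 _ _|].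
- rewrite mxE; case: ifP => // /andP[/eqP -> /eqP ->]; by rewrite ltnn.
- by rewrite mxE (negbTE n1).
- by exists A => // i j; exact: Wemb_mid.
Qed.

(** The defaults make the middle block a total linear map of M; for p + 3 <= n they are never
    reached. *)
Definition Wext n p (M : 'M[K]_n) : 'M[K]_3 :=
  \matrix_(i, j) if insub (p + i)%N is Some i' then
    if insub (p + j)%N is Some j' then M i' j' else 0 else 0.

Lemma Wext_linear n p : linear (@Wext n p).
Proof.
move=> a u v; apply/matrixP => i j; rewrite !mxE.
by case: insub => [?|]; [case: insub => [?|]|]; rewrite ?mxE ?mulr0 ?addr0.
Qed.
HB.instance Definition _ n p :=
  GRing.isLinear.Build K 'M[K]_n 'M[K]_3 *:%R (@Wext n p) (@Wext_linear n p).

Lemma bk_mid p (i : 'I_3) : bk p (p + i) = 1%N.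
Proof. by rewrite /bk ltnNge leq_addr /= ltn_add2l ltn_ord. Qed.

Lemma mid_bk p k : bk p k = 1%N -> exists i : 'I_3, k = (p + i)%N.
Proof.
rewrite /bk; case: ltnP => // pk; case: ltnP => // kp _.
have h : (k - p < 3)%N by lia.
by exists (Ordinal h); rewrite /= subnKC.
Qed.

Lemma WextP n p (M : 'M[K]_n) (A : 'M[K]_3) : (p + 3 <= n)%N ->
  (forall i j : 'I_n, bk p i = 1%N -> bk p j = 1%N -> M i j = A (inord (i - p)) (inord (j - p))) <->
  Wext p M = A.
Proof.
move=> pn; have lt (i : 'I_3) : (p + i < n)%N by apply: leq_trans pn; rewrite ltn_add2l.
have ins (i : 'I_3) : insub (p + i)%N = Some (Ordinal (lt i)) :> option 'I_n by exact: insubT.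
split=> [h|<- i j /mid_bk[i' ei] /mid_bk[j' ej]].
  apply/matrixP => i j; rewrite mxE ins ins /= h /= ?bk_mid //.
  by rewrite !addKn !inord_val.
rewrite ei ej !addKn !inord_val mxE ins ins /=.
by congr (M _ _); apply: val_inj.
Qed.

Lemma W1star_ext n p (F : {vspace 'M[K]_3}) (M : 'M[K]_n) : (p + 3 <= n)%N -> W1star p F M -> Wext p M \in F.
Proof. by move=> pn [_ _ [A FA hA]]; move/(WextP _ _ pn): hA => ->. Qed.

Lemma Wext_emb n p A : (p + 3 <= n)%N -> Wext p (Wemb n p A) = A.
Proof. by move=> pn; apply/(WextP _ _ pn) => i j; exact: Wemb_mid. Qed.

Lemma W1star_ev_ext n p (F : {vspace 'M[K]_3}) (M : 'M[K]_n) a : (p + 3 <= n)%N -> W1star p F M ->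
  ev f (Wext p M) a -> ev f M a.
Proof. by move=> pn WM; apply: (W1star_ev pn WM); apply/(WextP _ _ pn). Qed.

End MiddleBlock.

(** * Statements of the induction, block conjugation and corner entries *)

Section Assembly.
Variables (K : fieldType) (L : closedFieldType) (f : {rmorphism K -> L}).
Hypothesis ch3 : 3%N \in [pchar K].

Definition case1 n (V : {vspace 'M[K]_n}) :=
  exists2 I : {set 'I_n}, I != set0 & mx_similar (fun M => M \in V) (V1star I).
Definition case2 n (V : {vspace 'M[K]_n}) :=
  exists p : nat, exists2 F : {vspace 'M[K]_3},
    (p + 3 <= n)%N /\ exceptional F & mx_similar (fun M => M \in V) (W1star p F).

Definition struct_at n := forall V : {vspace 'M[K]_n},
  spec1_space f V -> \dim V = ('C(n, 2) + 1)%N -> case1 V \/ case2 V.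

(** The extremal case of Gerstenhaber's theorem on spaces of nilpotents. *)
Definition gerstenhaber_at n := forall V : {vspace 'M[K]_n},
  (forall M, M \in V -> nil_spec f M) -> \dim V = 'C(n, 2) ->
  exists2 Q, Q \in unitmx & forall B, B \in V <-> strict_upper (conjP Q B).

(** Kept as a hypothesis for 3 <= m: its proof goes through the same lemmas in size 3, where m = 2
    and the hypothesis is vacuous. *)
Definition no_large_nil_subspace := forall F F' : {vspace 'M[K]_3}, exceptional F -> (F' <= F)%VS ->
  (3 <= \dim F')%N -> exists2 A, A \in F' & exists2 lam, lam != 0 & ev f A lam.

Lemma nil_spec_conj n (P M : 'M[K]_n) : P \in unitmx -> nil_spec f M -> nil_spec f (conjP P M).
Proof. by move=> uP h a; rewrite ev_conj //; exact: h. Qed.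

(** The strictly upper triangular matrices are a space of nilpotents, so [nil_bound] turns the
    inclusion into an equality. *)
Lemma gerstenhaber_of_sub n (V : {vspace 'M[K]_n}) Q : \dim V = 'C(n, 2) -> Q \in unitmx ->
  (forall B, B \in V -> strict_upper (conjP Q B)) ->
  forall B, B \in V <-> strict_upper (conjP Q B).
Proof.
move=> dV uQ h.
have sub : (cj Q V <= suspace K n)%VS.
  by apply/subvP => _ /cj_ex[B BV ->]; apply/suspaceP/h.
have e : cj Q V = suspace K n.
  apply/eqP; rewrite eqEdim sub dim_cj // dV; apply: (nil_bound (@dimension_boundP K L f ch3 n)).
  by move=> M /suspaceP; exact: strict_upper_nil.
move=> B; split; first exact: h.
by move=> /suspaceP; rewrite -e mem_cjE.
Qed.

Definition bdiag d m (Q : 'M[K]_m) : 'M[K]_(d + m) := block_mx 1%:M 0 0 Q.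

Lemma bdiag_unit d m (Q : 'M[K]_m) : Q \in unitmx -> bdiag d Q \in unitmx.
Proof. by rewrite !unitmxE det_ublock det1 mul1r. Qed.

Lemma conj_bdiag d m (Q : 'M[K]_m) a r c B : Q \in unitmx ->
  conjP (bdiag d Q) (block_mx a r c B) = block_mx a (r *m invmx Q) (Q *m c) (conjP Q B).
Proof.
move=> uQ; rewrite /conjP.
have -> : invmx (bdiag d Q) = block_mx 1%:M 0 0 (invmx Q).
  rewrite /bdiag invmx_block_diag ?invmx1 //; exact: bdiag_unit.
by rewrite !mulmx_block !mul1mx !mul0mx !mulmx0 !mulmx1 !addr0 !add0r.
Qed.

(** Among 0, 1 and -1 at most one equals -x. *)
Lemma two_shifts (x : L) : exists s1 s2 : K,
  [/\ f s1 != f s2, x + f s1 != 0 & x + f s2 != 0].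
Proof.
have n1 : (1 : L) != 0 := oner_neq0 _.
have n2 : (1 : L) != -1 := opp_neq f ch3 n1.
have [->|nx] := eqVneq x 0.
  by exists 1, (-1); rewrite rmorphN1 rmorph1 !add0r oppr_eq0 n1 n2.
have [e|ne] := eqVneq (x + 1) 0.
  exists 0, (-1); rewrite rmorph0 rmorphN1 addr0 nx eq_sym oppr_eq0 n1; split=> //.
  apply/eqP => e'; move/eqP: n2; apply.
  by apply: (@addrI _ x); rewrite e e'.
by exists 0, 1; rewrite rmorph0 rmorph1 addr0 nx ne eq_sym n1.
Qed.

(** [Ev M x] marks an eigenvalue x of the lower block of M that s M0 shifts by s. When the corner of
    M + s M0 and x + s are both nonzero they are equal; two values of s then decide the corner of M,
    according to whether the corner of M0 is 0 or 1. *)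
Lemma corner_eigen m (U : {vspace 'M[K]_(1 + m)}) M0 (Ev : 'M[K]_(1 + m) -> L -> Prop) :
  spec1_space f U -> (forall M, M \in U -> dlsubmx M = 0) -> M0 \in U -> Ev 0 0 ->
  (forall M x, M \in U -> Ev M x -> forall s : K, x + f s != 0 ->
     ev f (drsubmx M + s *: drsubmx M0) (x + f s)) ->
  (forall M x, M \in U -> Ev M x -> ulsubmx M = 0) \/
  (forall M x, M \in U -> Ev M x -> f (ulsubmx M 0 0) = x).
Proof.
move=> sU dU M0U E0 hE; pose al (M : 'M[K]_(1 + m)) : K := (ulsubmx M : 'M_1) 0 0.
have key M x s : M \in U -> Ev M x -> x + f s != 0 ->
    f (al M) + f s * f (al M0) != 0 -> f (al M) + f s * f (al M0) = x + f s.
  move=> MU EM nx na; have NU : M + s *: M0 \in U by rewrite memvD // memvZ.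
  have := sU _ NU; rewrite (ublockE (dU _ NU)) => /spec1_cross; apply=> //.
    rewrite [ulsubmx _]mx11_scalar ev_scalar1 linearD linearZ /=.
    rewrite (_ : (ulsubmx M + s *: ulsubmx M0 : 'M_1) 0 0 = al M + s * al M0).
      by rewrite rmorphD rmorphM.
    by rewrite [LHS]mxE [X in _ + X]mxE.
  by rewrite linearD linearZ /=; exact: hE.
have [z|nz] := eqVneq (f (al M0)) 0.
  left=> M x MU EM; apply: mx11P; rewrite [RHS]mxE; apply: (fmorph_inj f); rewrite rmorph0.
  apply/eqP/negPn/negP => na; have [s1 [s2 [ns h1 h2]]] := two_shifts x.
  have k s : x + f s != 0 -> f (al M) = x + f s.
    by move=> h; rewrite -(key M x s MU EM h) z mulr0 addr0.
  by case/eqP: ns; apply: (@addrI _ x); rewrite -(k _ h1) -(k _ h2).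
have a1 : f (al M0) = 1.
  have := key 0 0 1 (mem0v _) E0; rewrite /al linear0 mxE rmorph0 rmorph1 !add0r mul1r.
  by apply=> //; exact: oner_neq0.
right=> M x MU EM; apply/eqP/negPn/negP => na.
have [s1 [s2 [ns h1 h2]]] := two_shifts x.
have k s : x + f s != 0 -> f (al M) = - f s.
  move=> h; apply/eqP; rewrite -addr_eq0; apply/eqP; apply: contrapT => /eqP nz'.
  have := key M x s MU EM h; rewrite a1 mulr1 => /(_ nz')/addIr e.
  by case/eqP: na.
by case/eqP: ns; apply: oppr_inj; rewrite -(k _ h1) -(k _ h2).
Qed.

(** As the rows are free, V is determined by the admissible pairs of a corner and a lower block,
    which [G] describes. *)
Lemma line_sim m (V : {vspace 'M[K]_(1 + m)}) Q (G : 'M[K]_1 -> 'M[K]_m -> Prop) :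
  (forall M, M \in V -> dlsubmx M = 0) -> (forall r : 'rV_m, block_mx 0 r 0 0 \in V) ->
  Q \in unitmx -> (forall M, M \in V -> G (ulsubmx M) (conjP Q (drsubmx M))) ->
  (forall a B, G a B -> exists2 M, M \in V & ulsubmx M = a /\ conjP Q (drsubmx M) = B) ->
  mx_similar (fun M => M \in V)
    (fun M : 'M_(1 + m) => dlsubmx M = 0 /\ G (ulsubmx M) (drsubmx M)).
Proof.
move=> dV hr uQ h1 h2; exists (bdiag 1 Q); first exact: bdiag_unit.
move=> M; rewrite -/(conjP (bdiag 1 Q) M).
have cM : conjP (bdiag 1 Q) M = block_mx (ulsubmx M) (ursubmx M *m invmx Q)
   (Q *m dlsubmx M) (conjP Q (drsubmx M)) by rewrite -{1}[M]submxK conj_bdiag.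
rewrite cM block_mxKdl block_mxKul block_mxKdr; split=> [MV|[d g]].
  by rewrite dV // mulmx0; split=> //; exact: h1.
have dM : dlsubmx M = 0 by rewrite -[LHS](mulKmx uQ) d mulmx0.
have [M1 M1V [u1 c1]] := h2 _ _ g.
have d1 : drsubmx M1 = drsubmx M by rewrite -(conjPK (drsubmx M1) uQ) c1 conjPK.
rewrite -[M](subrK M1) memvD //.
have := hr (ursubmx (M - M1)); congr (_ \in V).
rewrite -[RHS]submxK; congr block_mx.
- by rewrite linearB /= u1 subrr.
- by rewrite linearB /= dM dV // subrr.
- by rewrite linearB /= d1 subrr.
Qed.

Lemma sim_iff n (A B C : 'M[K]_n -> Prop) : (forall M, B M <-> C M) ->
  mx_similar A B -> mx_similar A C.
Proof. by move=> h [P uP hP]; exists P => // M; rewrite hP h. Qed.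

End Assembly.

(** * Spaces with an invariant line *)

Section LineAssembly.
Variables (K : fieldType) (L : closedFieldType) (f : {rmorphism K -> L}).
Hypothesis ch3 : 3%N \in [pchar K].

(** For eigenvalues u, v and -(u + v), the second power sum is 2 (u - v)^2 + 6 u v, which is 2 (u -
    v)^2 in characteristic 3. *)
Lemma equal_eigenvalues (M : 'M[K]_3) : \tr M = 0 -> p2 M = 0 ->
  forall a b, ev f M a -> ev f M b -> a = b.
Proof.
move=> t0 q0; have [s [sz es [t1 t2 _]]] := trace_eigenvalues (map_mx f M).
move: t1 t2; rewrite -map_mxM !trace_map_mx t0 -/(p2 M) q0 rmorph0.
case: s sz es => [|x [|y [|w [|]]]] // _ es.
rewrite !big_cons !big_nil !addr0 => s1 s2.
have e3 : 3%:R = 0 :> L := three0L f ch3.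
have q (u v z : L) : 0 = u + (v + z) -> 0 = u ^+ 2 + (v ^+ 2 + z ^+ 2) -> u = v.
  move=> h1 h2; apply/eqP; rewrite -subr_eq0 -sqrf_eq0.
  have hz : z = - (u + v) by apply/eqP; rewrite -addr_eq0 addrC h1 addrA.
  have : 2%:R * (u - v) ^+ 2 = 0.
    have -> : 2%:R * (u - v) ^+ 2 = u ^+ 2 + (v ^+ 2 + z ^+ 2) - 3%:R * (2%:R * u * v).
      by rewrite hz; ring.
    by rewrite -h2 e3 mul0r subrr.
  by move=> /eqP; rewrite mulf_eq0 (negbTE (two_neq0L f ch3)).
have xy := q _ _ _ s1 s2.
have xw : x = w by apply: (q x w y); [rewrite (addrC w)|rewrite (addrC (w ^+ 2))].
move=> a b; rewrite /ev -!es !inE -xy -xw !orbb.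
by move=> /eqP -> /eqP ->.
Qed.

Lemma single_tr0 (A : 'M[K]_3) : (forall a b, ev f A a -> ev f A b -> a = b) -> \tr A = 0.
Proof.
move=> h; apply: (fmorph_inj f); rewrite rmorph0 -trace_map_mx.
have [s [sz es [-> _ _]]] := trace_eigenvalues (map_mx f A).
case: s sz es => [|x [|y [|w [|]]]] // _ es.
have ex z : z \in [:: x; y; w] -> z = x.
  by rewrite es => h'; apply: (h _ _ h'); rewrite /ev -es mem_head.
rewrite !big_cons big_nil addr0 (ex y) ?inE ?eqxx ?orbT // (ex w) ?inE ?eqxx ?orbT //.
have -> : x + (x + x) = 3%:R * x by ring.
by rewrite (three0L f ch3) mul0r.
Qed.

Section Exceptional.
Variable F : {vspace 'M[K]_3}.
Hypothesis eF : exceptional F.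

Lemma exc_single A a b : A \in F -> ev f A a -> ev f A b -> a = b.
Proof. by have [_ h _] := eF; move=> FA; exact: h FA a b. Qed.

Lemma exc_spec1 : spec1_space f F.
Proof. by move=> A FA a b _ _; exact: exc_single. Qed.

Lemma exc_tr A : A \in F -> \tr A = 0.
Proof. by move=> FA; apply: single_tr0 => a b; exact: exc_single. Qed.

(** Otherwise adjoining the scalars would give dimension 5 in M_3, where the bound is 4. *)
Lemma exc_one : 1%:M \in F.
Proof.
apply/negPn/negP => n1; have := dimension_boundP (f := f) ch3 (n := 3) (V := (F + <[1%:M]>)%VS).
rewrite dim_add_one //; have [-> _ _] := eF; move=> h.
suff : (5 <= 4)%N by [].
apply: h => M /memv_addP[N NV [_ /vlineP[c ->] ->]] a b _ _.
by rewrite scalemx1 !ev_shift => h1 h2; apply: (addIr (- f c)); exact: exc_single h1 h2.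
Qed.

End Exceptional.

Lemma Dmx_set0 n (i j : 'I_n) : Dmx K set0 i j = 0.
Proof. by rewrite mxE inE andbF. Qed.

Lemma V1star_conj_ev m Q (M : 'M[K]_m) I c : Q \in unitmx -> I != set0 ->
  (forall i j : 'I_m, (j <= i)%N -> conjP Q M i j = c * Dmx K I i j) -> ev f M (f c).
Proof. by move=> uQ nI h; rewrite -(ev_conj f M _ uQ); exact: V1star_ev nI h. Qed.

(** The bit t tells whether the first index joins I. *)
Lemma V1star_corner m (U : {vspace 'M[K]_(1 + m)}) (I : {set 'I_m}) Q :
  spec1_space f U -> (forall M, M \in U -> dlsubmx M = 0) -> I != set0 -> Q \in unitmx ->
  (exists2 M0, M0 \in U & conjP Q (drsubmx M0) = Dmx K I) ->
  exists t : bool, forall M c, M \in U ->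
    (forall i j : 'I_m, (j <= i)%N -> conjP Q (drsubmx M) i j = c * Dmx K I i j) ->
    ulsubmx M = (c * t%:R)%:M.
Proof.
move=> sU dU nI uQ [M0 M0U hM0].
pose Ev (M : 'M[K]_(1 + m)) (x : L) := exists2 c, x = f c &
  forall i j : 'I_m, (j <= i)%N -> conjP Q (drsubmx M) i j = c * Dmx K I i j.
have [||h|h] := @corner_eigen K L f ch3 m U M0 Ev sU dU M0U.
- by exists 0; rewrite ?rmorph0 // => i j _; rewrite !linear0 mxE mul0r.
- move=> M x MU [c -> hc] s _; rewrite -rmorphD; apply: (V1star_conj_ev uQ nI) => i j ij.
  by rewrite linearD linearZ /= hM0 mulrDl -hc // !mxE.
- by exists false => M c MU hc; rewrite mulr0 raddf0; apply: (h M (f c)) => //; exists c.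
- exists true => M c MU hc; rewrite mulr1 [ulsubmx M]mx11_scalar; congr (_%:M).
  by apply: (fmorph_inj f); apply: h => //; exists c.
Qed.

(** If the corner were the eigenvalue of the middle block, the matrices of U with zero corner would
    give a space of nilpotents of codimension at most one in F, contrary to
    [no_large_nil_subspace]. *)
Lemma W1star_corner m (U : {vspace 'M[K]_(1 + m)}) p (F : {vspace 'M[K]_3}) Q :
  no_large_nil_subspace f -> exceptional F -> (p + 3 <= m)%N ->
  spec1_space f U -> (forall M, M \in U -> dlsubmx M = 0) -> Q \in unitmx ->
  (forall M, M \in U -> W1star p F (conjP Q (drsubmx M))) ->
  (forall A, A \in F -> exists2 M, M \in U & conjP Q (drsubmx M) = Wemb m p A) ->
  forall M, M \in U -> ulsubmx M = 0.
Proof.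
move=> eo eF pm sU dU uQ hW hA; have [M0 M0U hM0] := hA _ (exc_one eF).
pose ex (M : 'M[K]_(1 + m)) := Wext p (conjP Q (drsubmx M)).
have exF M : M \in U -> ex M \in F by move=> MU; apply: W1star_ext pm (hW _ MU).
have exM0 : ex M0 = 1%:M by rewrite /ex hM0 Wext_emb.
have exD M s : ex (M + s *: M0) = ex M + s%:M.
  by rewrite /ex !linearD /= !linearZ /= -/(ex M0) exM0 scalemx1.
pose Ev (M : 'M[K]_(1 + m)) (x : L) := ev f (ex M) x.
have [||h|h] := @corner_eigen K L f ch3 m U M0 Ev sU dU M0U.
- by rewrite /Ev /ex !linear0 /ev map_mx0 eigenvalue_det sub0r -raddfN det_scalar oppr0 expr0n.
- move=> M x MU EM s _; rewrite -(ev_conj f _ _ uQ).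
  have NU : M + s *: M0 \in U by rewrite memvD // memvZ.
  have := W1star_ev_ext (f := f) (a := x + f s) pm (hW _ NU).
  rewrite -/(ex (M + s *: M0)) exD ev_shift addrK linearD linearZ /=; exact.
- move=> M MU; have [x ex'] := ev_exists f (ex M : 'M_2.+1).
  by apply: (h M x).
set exf := (linfun (@Wext K m p) \o (linfun (conjP Q) \o linfun (@drsubmx K 1 m 1 m)))%VF.
have exfE M : exf M = ex M by rewrite !comp_lfunE !lfunE.
pose ulf := linfun (@ulsubmx K 1 m 1 m).
set F' := (exf @: (U :&: lker ulf))%VS.
have F'F : (F' <= F)%VS.
  apply/subvP => A /memv_imgP[M]; rewrite memv_cap => /andP[MU _] ->.
  by rewrite exfE; exact: exF.
have dF' : (3 <= \dim F')%N.
  have sub : (F <= F' + <[1%:M]>)%VS.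
    apply/subvP => A FA; have [M MU hM] := hA _ FA.
    have eA : ex M = A by rewrite /ex hM Wext_emb.
    apply/memv_addP; exists (ex (M - (ulsubmx M 0 0) *: M0)).
      apply/memv_imgP; exists (M - (ulsubmx M 0 0) *: M0); last by rewrite exfE.
      rewrite memv_cap memvB ?memvZ //= memv_ker lfunE /= linearB linearZ /=.
      apply/eqP/mx11P; rewrite [LHS]mxE [X in _ + X]mxE [X in - X]mxE.
      have -> : ulsubmx M0 0 0 = 1.
        apply: (fmorph_inj f); rewrite rmorph1; apply: h => //; rewrite /Ev exM0.
        by rewrite /ev map_scalar_mx rmorph1 eigenvalue_det subrr det0.
      by rewrite mulr1 subrr mxE.
    exists ((ulsubmx M 0 0)%:M); first by apply/vlineP; exists (ulsubmx M 0 0); rewrite scalemx1.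
    by rewrite -scaleNr exD raddfN /= eA subrK.
  have := leq_trans (dimvS sub) (dimv_add_leqif _ _).
  have [-> _ _] := eF; rewrite dim_vline -[1%:M]/(1 : 'M_3) oner_eq0 addn1.
  by rewrite ltnS.
have [A /memv_imgP[M + eA] [x nx ex']] := eo F F' eF F'F dF'.
rewrite memv_cap memv_ker lfunE /= => /andP[MU /eqP u0].
by case/eqP: nx; rewrite -(h M x MU) ?u0 ?mxE ?rmorph0 // /Ev -exfE -eA.
Qed.

(** Three shapes arise: I is the first index alone when the lower blocks are nilpotent; I is
    extended according to t; p goes up by one when the quotient has an exceptional block. *)
Lemma assembly_line m (V : {vspace 'M[K]_(1 + m)}) : struct_at f m -> gerstenhaber_at f m ->
  ((3 <= m)%N -> no_large_nil_subspace f) -> spec1_space f V -> (forall M, M \in V -> dlsubmx M = 0) ->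
  \dim V = ('C(m.+1, 2) + 1)%N -> case1 V \/ (3 <= m)%N /\ case2 V.
Proof.
move=> Sm Gm eo sV dV eV.
have [hr hc] := line_dims ch3 (dimension_boundP (f := f) ch3 (n := m)) sV dV eV.
have sB := spec1_drf sV dV.
have memB M : M \in V -> drsubmx M \in (linfun (@drsubmx K 1 m 1 m) @: V)%VS.
  by move=> MV; apply/memv_imgP; exists M; rewrite ?lfunE.
have exB B : B \in (linfun (@drsubmx K 1 m 1 m) @: V)%VS -> exists2 M, M \in V & drsubmx M = B.
  by case/memv_imgP => M MV ->; exists M; rewrite ?lfunE.
case: hc => [[dB inj]|[nB dB [E EV [dE uE]]]]; last first.
  have [|Q uQ hQ] := Gm _ _ dB; first by move=> _ /exB[M MV <-]; exact: nB.
  left; exists (consI true set0).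
    by apply/set0Pn; exists (lshift m ord0); rewrite consI0.
  apply: sim_iff (line_sim (G := fun _ B => strict_upper B) dV hr uQ _ _); last first.
  - move=> a B sB'; have : conjP (invmx Q) B \in (linfun (@drsubmx K 1 m 1 m) @: V)%VS.
      by apply/hQ; rewrite conjPKV.
    case/exB => M MV dM; exists (M + ((a - ulsubmx M) 0 0) *: E); first by rewrite memvD // memvZ.
    rewrite !linearD !linearZ /= dE uE ?linear0 ?scaler0 addr0 dM conjPKV //; split=> //.
    by rewrite scalemx1 -mx11_scalar addrC subrK.
  - by move=> M MV; apply/hQ; exact: memB.
  move=> M; rewrite -{3}[M]submxK; split=> [[d sB']|[c h]].
    exists ((ulsubmx M) 0 0); rewrite d; apply/(V1star_block _ _ _ _ (consI0 _ _) (consIS _ _)).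
    rewrite mulr1 -mx11_scalar; split=> // i j ij.
    by rewrite sB' // Dmx_set0 mulr0.
  have d : dlsubmx M = 0.
    apply/matrixP => i j; have := h (rshift 1 i) (lshift m j) _; rewrite block_mxEdl => -> //; last by rewrite ord1.
    by rewrite !mxE -val_eqE /= ord1 mulr0.
  split=> //; move: h; rewrite d => /(V1star_block _ _ _ _ (consI0 _ _) (consIS _ _))[_ h] i j ij.
  by rewrite h // Dmx_set0 mulr0.
have uniq M N : M \in V -> N \in V -> drsubmx M = drsubmx N -> ulsubmx M = ulsubmx N.
  move=> MV NV e; apply/eqP; rewrite -subr_eq0 -linearB /=; apply/eqP/inj.
    exact: memvB.
  by rewrite linearB /= e subrr.
have [[I nI [Q uQ hQ]]|[p [F [pm eF] [Q uQ hQ]]]] := Sm _ sB dB.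
  have [|t ht] := V1star_corner sV dV nI uQ.
    have : conjP (invmx Q) (Dmx K I) \in (linfun (@drsubmx K 1 m 1 m) @: V)%VS.
      apply/hQ; rewrite -/(conjP Q _) conjPKV //; exists 1 => i j _; by rewrite mul1r.
    by case/exB => M MV dM; exists M => //; rewrite dM conjPKV.
  left; exists (consI t I).
    by case/set0Pn: nI => j jI; apply/set0Pn; exists (rshift 1 j); rewrite consIS.
  pose G (a : 'M[K]_1) (B : 'M[K]_m) := exists2 c, a = (c * t%:R)%:M &
    forall i j : 'I_m, (j <= i)%N -> B i j = c * Dmx K I i j.
  apply: sim_iff (line_sim (G := G) dV hr uQ _ _); last first.
  - move=> a B [c ea hB]; have : conjP (invmx Q) B \in (linfun (@drsubmx K 1 m 1 m) @: V)%VS.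
      by apply/hQ; rewrite -/(conjP Q _) conjPKV //; exists c.
    case/exB => M MV dM; exists M => //; rewrite dM conjPKV //; split=> //.
    by rewrite ea; apply: ht => //; rewrite dM conjPKV.
  - move=> M MV; have [c hc] : V1star I (conjP Q (drsubmx M)) by apply/hQ; exact: memB.
    by exists c => //; exact: ht.
  move=> M; rewrite -{4}[M]submxK; split=> [[d [c ea hB]]|[c h]].
    by exists c; rewrite d; apply/(V1star_block _ _ _ _ (consI0 _ _) (consIS _ _)).
  have d : dlsubmx M = 0.
    apply/matrixP => i j; have := h (rshift 1 i) (lshift m j) _; rewrite block_mxEdl => -> //; last by rewrite ord1.
    by rewrite !mxE -val_eqE /= ord1 mulr0.
  split=> //; move: h; rewrite d => /(V1star_block _ _ _ _ (consI0 _ _) (consIS _ _))[ea h].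
  by exists c.
have m3 : (3 <= m)%N by apply: leq_trans pm; rewrite leq_addl.
have hWB B : W1star p F B -> exists2 M, M \in V & conjP Q (drsubmx M) = B.
  move=> WB; have : conjP (invmx Q) B \in (linfun (@drsubmx K 1 m 1 m) @: V)%VS.
    by apply/hQ; rewrite -/(conjP Q _) conjPKV.
  by case/exB => M MV dM; exists M => //; rewrite dM conjPKV.
have hVW M : M \in V -> W1star p F (conjP Q (drsubmx M)) by move=> MV; apply/hQ; exact: memB.
have u0 := W1star_corner (eo m3) eF pm sV dV uQ hVW (fun A FA => hWB _ (Wemb_W m p FA)).
right; split=> //; exists p.+1, F; first by split=> //; rewrite addSn.
apply: sim_iff (line_sim (G := fun a B => a = 0 /\ W1star p F B) dV hr uQ _ _); last first.
- by move=> a B [-> /hWB[M MV hM]]; exists M => //; split=> //; exact: u0.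
- by move=> M MV; split; [exact: u0|exact: hVW].
by move=> M; rewrite W1star_blockS; split=> [[? []]|[]].
Qed.

End LineAssembly.

(** * Transport by similarity, and sizes at most two *)

Section Reduction.
Variables (K : fieldType) (L : closedFieldType) (f : {rmorphism K -> L}).
Hypothesis ch3 : 3%N \in [pchar K].

Definition max_spec1 n (V : {vspace 'M[K]_n}) :=
  spec1_space f V /\ \dim V = ('C(n, 2) + 1)%N.

Lemma max_cj n (P : 'M[K]_n) (V : {vspace 'M[K]_n}) : P \in unitmx ->
  max_spec1 V -> max_spec1 (cj P V).
Proof. by move=> uP [sV dV]; split; [exact: spec1_cj|rewrite dim_cj]. Qed.

Lemma case1_cj n (P : 'M[K]_n) (V : {vspace 'M[K]_n}) : P \in unitmx ->
  case1 (cj P V) -> case1 V.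
Proof. by move=> uP [I nI h]; exists I => //; exact: sim_trans (sim_cj V uP) h. Qed.

Lemma case2_cj n (P : 'M[K]_n) (V : {vspace 'M[K]_n}) : P \in unitmx ->
  case2 (cj P V) -> case2 V.
Proof. by move=> uP [p [F hF h]]; exists p, F => //; exact: sim_trans (sim_cj V uP) h. Qed.

Lemma cj_comp n (P Q : 'M[K]_n) (V : {vspace 'M[K]_n}) : P \in unitmx -> Q \in unitmx ->
  cj P (cj Q V) = cj (P *m Q) V.
Proof.
move=> uP uQ; have uPQ : P *m Q \in unitmx by rewrite unitmx_mul uP.
apply/vspaceP => M; apply/idP/idP => [/cj_ex[_ /cj_ex[N NV ->] ->]|/cj_ex[N NV ->]].
  by rewrite conjP_comp // mem_cjE.
by rewrite -conjP_comp // !mem_cjE.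
Qed.

Definition stable_line n (V : {vspace 'M[K]_n}) :=
  exists2 e : 'cV_n, e != 0 & forall N : 'M_n, N \in V -> exists c, N *m e = c *: e.

Lemma stable_line_cj n (P : 'M[K]_n) (V : {vspace 'M[K]_n}) : P \in unitmx ->
  stable_line (cj P V) -> stable_line V.
Proof.
move=> uP [e ne h]; exists (invmx P *m e).
  by apply: contra_neq ne => e0; rewrite -(mulKVmx uP e) e0 mulmx0.
move=> N NV; have [c hc] := h _ (mem_cj P NV); exists c.
rewrite -(mulKmx uP (N *m _)) scalemxAr -hc /conjP; congr (_ *m _).
by rewrite !mulmxA.
Qed.

Lemma stable_line_struct m (V : {vspace 'M[K]_(1 + m)}) : struct_at f m -> gerstenhaber_at f m ->
  ((3 <= m)%N -> no_large_nil_subspace f) -> max_spec1 V -> stable_line V ->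
  case1 V \/ (3 <= m)%N /\ case2 V.
Proof.
move=> Sm Gm eo mV [e ne he]; have [P uP Pe] := complete_column ne.
have [sV dV] := max_cj uP mV.
have dl0 M : M \in cj P V -> dlsubmx M = 0.
  case/cj_ex => N NV ->; have [c hc] := he _ NV.
  have Ne : N *m e = e *m c%:M by rewrite mul_mx_scalar.
  by have [_ ->] := stable_block uP Pe Ne.
have [h|[m3 h]] := assembly_line ch3 Sm Gm eo sV dl0 dV; [left|right].
  exact: case1_cj h.
by split=> //; exact: case2_cj h.
Qed.

(** As I is nonempty, the coefficient of [Dmx I] is an eigenvalue and vanishes on nilpotents; the
    dimension does the rest. *)
Lemma gerstenhaber_of_case1 n (V : {vspace 'M[K]_n.+1}) :
  (forall M, M \in V -> nil_spec f M) -> \dim V = 'C(n.+1, 2) ->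
  case1 (V + <[1%:M]>)%VS ->
  exists2 Q, Q \in unitmx & forall B, B \in V <-> strict_upper (conjP Q B).
Proof.
move=> nV dV [I nI [Q uQ hQ]]; exists Q => //; apply: (@gerstenhaber_of_sub K L f ch3 _ V Q) => // B BV.
have [c hc] : V1star I (conjP Q B).
  apply/hQ; apply/memv_addP; exists B => //.
  by exists 0; rewrite ?mem0v ?addr0.
have c0 : c = 0.
  apply: (fmorph_inj f); rewrite rmorph0; apply: (nV _ BV).
  exact: (V1star_conj_ev f uQ nI hc).
by move=> i j ij; rewrite hc // c0 mul0r.
Qed.

Lemma max_add_one n (V : {vspace 'M[K]_n.+1}) :
  (forall M, M \in V -> nil_spec f M) -> \dim V = 'C(n.+1, 2) ->
  max_spec1 (V + <[1%:M]>)%VS.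
Proof.
move=> nV dV; split; first exact: nil_spec_line1.
by rewrite dim_add_one ?dV ?addn1 //; exact: one_notin_nil nV.
Qed.

(** The second case cannot hold for V + K I: the identity has no zero on its diagonal, whereas
    [W1star] does outside the middle block. Only for n = 3 is there no index outside. *)
Lemma gerstenhaber_of_struct n : n != 3%N -> struct_at f n -> gerstenhaber_at f n.
Proof.
case: n => [|n] n3 Sn V nV dV.
  exists 1%:M; first exact: unitmx1.
  move=> B; split=> [_ []//|_]; suff -> : B = 0 by exact: mem0v.
  by apply/matrixP => -[].
have [sW dW] := max_add_one nV dV.
apply: gerstenhaber_of_case1 => //; have [//|[p [F [pn _] [Q uQ hQ]]]] := Sn _ sW dW.
have : W1star p F (conjP Q 1%:M).
  by apply/hQ; apply/memv_addP; exists 0; [exact: mem0v|exists 1%:M; rewrite ?memv_line ?add0r].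
rewrite conjP1 // => -[_ h2 _].
have [i bi] : exists i : 'I_n.+1, bk p i != 1%N.
  have [p0|p_gt0] := posnP p.
    have n_gt : (3 < n.+1)%N by rewrite ltn_neqAle eq_sym n3 (leq_trans _ pn) ?leq_addl.
    by exists (Ordinal n_gt); rewrite p0.
  by exists ord0; rewrite /bk p_gt0.
have := h2 i i bi erefl (leqnn _); rewrite mxE eqxx => /eqP; rewrite oner_eq0.
by [].
Qed.

Lemma struct0 : struct_at f 0.
Proof.
move=> V _ dV; have := dim_le_full V; rewrite dim_mx dV; by [].
Qed.

Lemma struct_flip m : struct_at f m -> gerstenhaber_at f m -> ((3 <= m)%N -> no_large_nil_subspace f) ->
  (forall V : {vspace 'M[K]_(1 + m)}, max_spec1 V -> stable_line V) -> struct_at f m.+1.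
Proof.
move=> Sm Gm eo h V sV dV; have mV : @max_spec1 (1 + m) V by split.
by have [|[]] := stable_line_struct Sm Gm eo mV (h _ mV); [left|right].
Qed.

Lemma struct1 : struct_at f 1.
Proof.
apply: struct_flip => //; [exact: struct0|apply: gerstenhaber_of_struct; [by []|exact: struct0]|].
move=> V _; exists (const_mx 1).
  by apply/eqP => /matrixP/(_ 0 0)/eqP; rewrite !mxE oner_eq0.
move=> N _; exists (N 0 0); apply/matrixP => i j.
by rewrite mxE big_ord1 !mxE !ord1.
Qed.

Lemma traceless2 (V : {vspace 'M[K]_2}) : \dim V = 2%N ->
  exists2 h, h \in V & h != 0 /\ \tr h = 0.
Proof.
move=> dV; pose g (M : 'M[K]_2) : 'M[K]_1 := (\tr M)%:M.
have gl : linear g by move=> a u v; rewrite /g linearP /= raddfD /= scale_scalar_mx.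
pose G : {linear 'M[K]_2 -> 'M[K]_1} := HB.pack g (GRing.isLinear.Build K _ _ _ g gl).
have e : (\dim V = \dim (V :&: lker (linfun G)) + \dim (linfun G @: V))%N.
  exact: dim_split.
have h1 : (\dim (linfun G @: V) <= 1)%N by exact: dim_img_le1.
have : (0 < \dim (V :&: lker (linfun G)))%N by lia.
rewrite lt0n dimv_eq0 => /eqP n0.
have := memv_pick (V :&: lker (linfun G)); set h := vpick _.
rewrite memv_cap memv_ker lfunE /= => /andP[hV /eqP t]; exists h => //; split.
  by rewrite vpick0; apply/eqP.
by move/(congr1 (fun M : 'M_1 => M 0 0)): t; rewrite !mxE eqxx mulr1n.
Qed.

(** A nonzero traceless h in V is nilpotent, its two eigenvalues being opposite with squares of sum
    zero. In a basis that starts with its kernel, tr(hN) = 0 says that N stabilizes that kernel. *)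
Lemma stable_line2 (V : {vspace 'M[K]_(1 + 1)}) : max_spec1 V -> stable_line V.
Proof.
move=> [sV dV]; have [h hV [nh th]] := traceless2 dV.
have [q2 _] := spec1_tr0 ch3 (sV _ hV) th.
have eh : ev f h 0.
  have [s [sz es [t1 t2 _]]] := trace_eigenvalues (map_mx f h).
  move: t1 t2; rewrite -map_mxM !trace_map_mx th -/(p2 h) q2 rmorph0.
  case: s sz es => [|x [|y []]] // _ es; rewrite !big_cons !big_nil !addr0.
  move=> /eqP; rewrite eq_sym addr_eq0 => /eqP -> /eqP.
  rewrite sqrrN -mulr2n -mulr_natl eq_sym mulf_eq0 (negbTE (two_neq0L f ch3)) sqrf_eq0 /=.
  by move=> /eqP y0; rewrite /ev -es y0 !inE eqxx orbT.
have [e ne he] : exists2 e : 'cV_2, e != 0 & h *m e = 0.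
  have : eigenvalue h 0.
    move: eh; rewrite evP raddf0 subr0 det_map_mx fmorph_eq0 => /eqP d.
    by rewrite eigenvalue_det raddf0 subr0 d.
  by case/eigenvalue_col => e ne; rewrite scale0r => he; exists e.
have [P uP Pe] := complete_column (ne : (e : 'cV_(1 + 1)) != 0).
apply: (stable_line_cj uP); exists (col_mx 1%:M 0).
  by rewrite -Pe; apply: contra_neq ne => e0; rewrite -(mulKmx uP e) e0 mulmx0.
have he0 : h *m e = e *m 0 by rewrite he mulmx0.
have [u0 d0] := stable_block uP Pe he0.
have hV' := mem_cj P hV; have sV' := spec1_cj uP sV.
set h' := conjP P h in hV'; rewrite -/(conjP P h) -/h' in u0 d0.
have t0 : \tr h' = 0 by rewrite /h' /conjP mxtrace_mulC mulmxA mulVmx // mul1mx.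
have h'E : h' = block_mx 0 (ursubmx h') 0 0.
  rewrite -{1}[h']submxK u0 d0; congr block_mx; apply: mx11P.
  by move: t0; rewrite -{1}[h']submxK mxtrace_block u0 mxtrace0 add0r /mxtrace big_ord1 => ->; rewrite mxE.
have nur : ursubmx h' 0 0 != 0.
  apply: contra_neq nh => z; rewrite -(conjPK h uP) -/h' h'E.
  have -> : ursubmx h' = 0 by apply: mx11P; rewrite z mxE.
  by rewrite block_mx_const linear0.
move=> N NV; have := spec1_tr_mul0 ch3 sV' hV' NV t0.
rewrite h'E -{1}[N]submxK mulmx_block !mul0mx !addr0 !add0r mxtrace_block mxtrace0 addr0.
rewrite /mxtrace big_ord1 mxE big_ord1 => /eqP; rewrite mulf_eq0 (negbTE nur) => /eqP dl.
have dl0 : dlsubmx N = 0 by apply: mx11P; rewrite dl mxE.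
exists (ulsubmx N 0 0); rewrite -{1}[N]submxK mul_block_col !mulmx0 !mulmx1 !addr0 dl0.
by rewrite scale_col_mx scaler0 scalemx1 -mx11_scalar.
Qed.

Lemma struct2 : struct_at f 2.
Proof.
apply: struct_flip => //; [exact: struct1|apply: gerstenhaber_of_struct; [by []|exact: struct1]|].
exact: stable_line2.
Qed.

Lemma gerstenhaber2 : gerstenhaber_at f 2.
Proof. by apply: gerstenhaber_of_struct => //; exact: struct2. Qed.

(** With a stable line, F would be similar to some [V1star I]. The identity lies in F, so I is
    everything, which exceptional spaces exclude. *)
Lemma exc_no_stable_line (F : {vspace 'M[K]_3}) : exceptional F -> no_stable_line F.
Proof.
move=> eF w nw hw; have mF : @max_spec1 (1 + 2) F.
  by split; [exact: exc_spec1|have [-> _ _] := eF].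
have eo : (3 <= 2)%N -> no_large_nil_subspace f by [].
have ln : @stable_line (1 + 2) F by exists w.
have [[I nI [Q uQ hQ]]|[]//] := stable_line_struct struct2 gerstenhaber2 eo mF ln.
have [_ _] := eF; apply; exists Q => // M; suff <- : I = [set: 'I_3] by exact: hQ.
have := exc_one f ch3 eF; rewrite hQ -/(conjP Q _) conjP1 // => -[c hc].
apply/setP => i; rewrite inE; have := hc i i (leqnn _); rewrite !mxE eqxx.
by case: (i \in I) => //= /eqP; rewrite mulr0 oner_eq0.
Qed.

End Reduction.

(** * Reduction to a quotient by an adapted vector *)

Section NormalForm.
Variables (K : fieldType) (L : closedFieldType) (f : {rmorphism K -> L}).
Hypothesis ch3 : 3%N \in [pchar K].

Definition triangular_form m (V : {vspace 'M[K]_(1 + m)}) :=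
  [/\ forall B : 'M_m, strict_upper B -> exists R, block_mx 0 R 0 B \in V,
      forall M, M \in ustab V -> upper (drsubmx M) &
      exists2 D, D \in ustab V & (drsubmx D = 0 /\ ulsubmx D = 1%:M) \/
        exists2 I : {set 'I_m}, I != set0 &
          drsubmx D = Dmx K I /\ exists t : bool, ulsubmx D = (t%:R)%:M].

Definition block_form m (V : {vspace 'M[K]_(1 + m)}) p (F : {vspace 'M[K]_3}) :=
  [/\ (p + 3 <= m)%N, exceptional F &
      forall B : 'M_m, W1star p F B -> exists R, block_mx 0 R 0 B \in V].

(** The quotient structure is transported by [bdiag 1 Q], which fixes the first basis vector and so
    keeps it adapted. *)
Lemma normal_form m (V : {vspace 'M[K]_(1 + m)}) : struct_at f m -> gerstenhaber_at f m ->
  ((3 <= m)%N -> no_large_nil_subspace f) -> max_spec1 f V ->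
  exists2 P, P \in unitmx & let V' := cj P V in
    [/\ adapted V' (col_mx 1%:M 0), forall c, exists2 N, N \in V' & dlsubmx N = c &
        triangular_form V' \/ exists p F, block_form V' p F].
Proof.
move=> Sm Gm eo mV; have [P0 uP0 ad0] := @adapted_normalize K L f ch3 m V (proj1 mV).
set V0 := cj P0 V in ad0; have [sV0 dV0] : max_spec1 f V0 := max_cj uP0 mV.
have [_ /(_ dV0) [surj0 hc]] := adapted_dims ch3 (@dimension_boundP K L f ch3 m) sV0 ad0.
have dU M : M \in ustab V0 -> dlsubmx M = 0 by rewrite mem_ustab => /andP[_ /eqP].
have UV M : M \in ustab V0 -> M \in V0 by rewrite mem_ustab => /andP[].
have sU : spec1_space f (ustab V0) by move=> M /UV; exact: sV0.
have exB B : B \in (linfun (@drsubmx K 1 m 1 m) @: ustab V0)%VS ->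
   exists2 M, M \in ustab V0 & drsubmx M = B.
  by case/memv_imgP => M MV ->; exists M; rewrite ?lfunE.
have memB M : M \in ustab V0 -> drsubmx M \in (linfun (@drsubmx K 1 m 1 m) @: ustab V0)%VS.
  by move=> MV; apply/memv_imgP; exists M; rewrite ?lfunE.
suff [Q uQ hQ] : exists2 Q : 'M[K]_m, Q \in unitmx &
    triangular_form (cj (bdiag 1 Q) V0) \/ exists p F, block_form (cj (bdiag 1 Q) V0) p F.
  have uB := bdiag_unit 1 uQ.
  exists (bdiag 1 Q *m P0); first by rewrite unitmx_mul uB.
  rewrite /= -cj_comp //; split=> //.
  - suff <- : bdiag 1 Q *m col_mx 1%:M 0 = col_mx 1%:M 0 by exact: adapted_cj.
    by rewrite mul_block_col ?mulmx1 ?mulmx0 ?mul0mx ?addr0.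
  - move=> c; have [N NV Nc] := surj0 (invmx Q *m c).
    exists (conjP (bdiag 1 Q) N); first exact: mem_cj.
    by rewrite -[N]submxK conj_bdiag // block_mxKdl Nc mulKVmx.
have lift Q M B : Q \in unitmx -> M \in ustab V0 -> ulsubmx M = 0 -> conjP Q (drsubmx M) = B ->
    exists R, block_mx 0 R 0 B \in cj (bdiag 1 Q) V0.
  move=> uQ MU u hB; exists (ursubmx M *m invmx Q); have := mem_cj (bdiag 1 Q) (UV _ MU).
  by rewrite -{1}[M]submxK conj_bdiag // u (dU _ MU) mulmx0 hB.
have unlift Q M : Q \in unitmx -> M \in ustab (cj (bdiag 1 Q) V0) ->
    exists2 N, N \in ustab V0 & ulsubmx M = ulsubmx N /\ drsubmx M = conjP Q (drsubmx N).
  move=> uQ; rewrite mem_ustab => /andP[/cj_ex[N NV ->]].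
  rewrite -[N]submxK conj_bdiag // block_mxKul block_mxKdl block_mxKdr => /eqP d.
  exists N => //.
  by rewrite mem_ustab NV /= -[dlsubmx N](mulKmx uQ) d mulmx0.
have pushU Q M : Q \in unitmx -> M \in ustab V0 ->
    exists2 D, D \in ustab (cj (bdiag 1 Q) V0) &
      ulsubmx D = ulsubmx M /\ drsubmx D = conjP Q (drsubmx M).
  move=> uQ MU; exists (conjP (bdiag 1 Q) M).
    by rewrite mem_ustab mem_cj ?UV //= -{1}[M]submxK conj_bdiag // block_mxKdl dU // mulmx0.
  by rewrite -{1 3}[M]submxK conj_bdiag // block_mxKul block_mxKdr.
case: hc => [[dB inj]|[nB dB [E EU [dE uE]]]]; last first.
  have [|Q uQ hQ] := Gm _ _ dB; first by move=> B /exB[M MU <-]; exact: nB.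
  exists Q => //; left; split.
  - move=> B sB; have : conjP (invmx Q) B \in (linfun (@drsubmx K 1 m 1 m) @: ustab V0)%VS.
      by apply/hQ; rewrite conjPKV.
    case/exB => M MU dM; apply: (lift Q (M - (ulsubmx M 0 0) *: E)) => //.
    + by rewrite memvB // memvZ.
    + by rewrite linearB linearZ /= uE scalemx1 -mx11_scalar subrr.
    + by rewrite [drsubmx _]linearB linearZ /= dE scaler0 subr0 dM conjPKV.
  - move=> M /(unlift _ _ uQ)[N NU [_ ->]]; apply: strict_upper_upper; apply/hQ; exact: memB.
  - by have [D DU [uD dD]] := pushU Q E uQ EU; exists D => //; left; rewrite uD dD dE linear0.
have sB := spec1_drf sU dU.
have [[I nI [Q uQ hQ]]|[p [F [pm eF] [Q uQ hQ]]]] := Sm _ sB dB.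
  exists Q => //; left.
  have [M0 M0U hM0] : exists2 M0, M0 \in ustab V0 & conjP Q (drsubmx M0) = Dmx K I.
    have : conjP (invmx Q) (Dmx K I) \in (linfun (@drsubmx K 1 m 1 m) @: ustab V0)%VS.
      apply/hQ; rewrite -/(conjP Q _) conjPKV //; exists 1 => i j _; by rewrite mul1r.
    by case/exB => M MV dM; exists M => //; rewrite dM conjPKV.
  have [|t ht] := V1star_corner ch3 sU dU nI uQ; first by exists M0.
  split.
  - move=> B sB'; have : conjP (invmx Q) B \in (linfun (@drsubmx K 1 m 1 m) @: ustab V0)%VS.
      apply/hQ; rewrite -/(conjP Q _) conjPKV //; exists 0 => i j ij.
      by rewrite sB' // mul0r.
    case/exB => M MU dM; apply: (lift Q M) => //; last by rewrite dM conjPKV.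
    rewrite (ht M 0) ?mul0r ?raddf0 // => i j ij.
    by rewrite dM conjPKV // sB' // mul0r.
  - move=> M /(unlift _ _ uQ)[N NU [_ ->]]; apply: (@V1star_upper _ _ I).
    by apply/hQ; exact: memB.
  - have [D DU [uD dD]] := pushU Q M0 uQ M0U; exists D => //; right; exists I => //.
    rewrite dD hM0; split=> //; exists t; rewrite uD (ht M0 1) ?mul1r // => i j _.
    by rewrite hM0 mul1r.
exists Q => //; right; exists p, F; split=> // B WB.
have m3 : (3 <= m)%N by apply: leq_trans pm; rewrite leq_addl.
have hWB B' : W1star p F B' -> exists2 M, M \in ustab V0 & conjP Q (drsubmx M) = B'.
  move=> WB'; have : conjP (invmx Q) B' \in (linfun (@drsubmx K 1 m 1 m) @: ustab V0)%VS.
    by apply/hQ; rewrite -/(conjP Q _) conjPKV.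
  by case/exB => M MV dM; exists M => //; rewrite dM conjPKV.
have hVW M : M \in ustab V0 -> W1star p F (conjP Q (drsubmx M)).
  by move=> MV; apply/hQ; exact: memB.
have u0 := W1star_corner ch3 (eo m3) eF pm sU dU uQ hVW (fun A FA => hWB _ (Wemb_W m p FA)).
by have [M MU hM] := hWB _ WB; apply: (lift Q M) => //; exact: u0.
Qed.

Section FirstVector.
Variables (m : nat) (V : {vspace 'M[K]_(1 + m)}).
Notation x0 := (col_mx 1%:M 0 : 'cV[K]_(1 + m)).

Lemma row_x0 (l : 'rV[K]_(1 + m)) : l *m x0 = 0 -> l = row_mx 0 (rsubmx l).
Proof. by rewrite -{1}[l]hsubmxK mul_row_col mulmx1 mulmx0 addr0 -{2}[l]hsubmxK => ->. Qed.

Lemma mul_x0 (N : 'M[K]_(1 + m)) : N *m x0 = col_mx (ulsubmx N) (dlsubmx N).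
Proof. by rewrite -{1}[N]submxK mul_block_col !mulmx1 !mulmx0 !addr0. Qed.

Lemma surj_x0 : (forall c, exists2 N, N \in V & dlsubmx N = c) ->
  forall c : 'cV_(1 + m), exists2 N, N \in V & exists a : K, N *m x0 = c + a *: x0.
Proof.
move=> h c; have [N NV Nc] := h (dsubmx c); exists N => //.
exists (ulsubmx N 0 0 - usubmx c 0 0); rewrite mul_x0 Nc -{2}[c]vsubmxK scale_col_mx.
rewrite add_col_mx scaler0 addr0 scalemx1; congr col_mx.
by apply: mx11P; rewrite !mxE eqxx mulr1n addrC subrK.
Qed.

Lemma lifted_x0 (w : 'cV[K]_m) (l R : 'rV_m) : l *m w = 0 -> block_mx 0 R 0 (w *m l) \in V ->
  lifted V x0 (col_mx 0 w) (row_mx 0 l) (row_mx 0 R).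
Proof.
move=> lw h; split; rewrite ?mul_row_col ?mul0mx ?mulmx0 ?mulmx1 ?addr0 ?add0r //.
by rewrite !mul_col_row !mul0mx !mulmx0 mul1mx add_block_mx !addr0 !add0r.
Qed.

Lemma liftable_x0 (w : 'cV[K]_m) :
  (forall l : 'rV_m, l *m w = 0 -> exists R, block_mx 0 R 0 (w *m l) \in V) ->
  liftable V x0 (col_mx 0 w).
Proof.
move=> h l lx; rewrite (row_x0 lx) mul_row_col mul0mx add0r => lw.
by have [R hR] := h _ lw; exists (row_mx 0 R); exact: lifted_x0.
Qed.

Lemma stable_line_x0 (w : 'cV[K]_m) (B : 'M_m) (R0 l0 : 'rV_m) :
  spec1_space f V -> adapted V x0 -> (forall c, exists2 N, N \in V & dlsubmx N = c) ->
  w != 0 -> (forall l : 'rV_m, l *m w = 0 -> exists R, block_mx 0 R 0 (w *m l) \in V) ->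
  block_mx 0 R0 0 B \in V -> B *m w = 0 -> l0 *m w = 0 -> l0 *m B != 0 -> stable_line V.
Proof.
move=> sV ad su nw hw BV Bw lw lB.
have := @stable_line_of_lifts K L f ch3 _ V x0 sV ad (surj_x0 su) (col_mx 0 w)
  (row_mx 0 l0) (block_mx 0 R0 0 B).
apply=> //.
- move=> c; apply: contra_neq nw => /esym; rewrite scale_col_mx scaler0 => /eq_col_mx[_ <-].
  by [].
- exact: liftable_x0.
- by rewrite mul_x0 block_mxKul block_mxKdl col_mx0.
- exists ((R0 *m w) 0 0); rewrite mul_block_col !mul0mx !add0r Bw scale_col_mx scaler0.
  by rewrite scalemx1 -mx11_scalar.
- by rewrite mul_row_col mul0mx mulmx0 addr0.
- by rewrite mul_row_col mul0mx lw addr0.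
- rewrite mul_row_block !mul0mx !mulmx0 !add0r; apply: contra_neq lB => e.
  by move: e; rewrite -row_mx0 => /eq_row_mx[_ ->].
Qed.

End FirstVector.
End NormalForm.

(** * The case n = 3 *)

Section ThreeDimensional.
Variables (K : fieldType) (L : closedFieldType) (f : {rmorphism K -> L}).
Hypothesis ch3 : 3%N \in [pchar K].

Lemma nil_cube (M : 'M[K]_3) : nil_spec f M -> M *m M *m M = 0.
Proof.
move=> h; apply: (map_mx_inj (f := f)); rewrite map_mx0 !map_mxM.
set A : 'M[L]_2.+1 := map_mx f M.
have [r hr] := closed_field_poly_normal (char_poly A).
have lc : lead_coef (char_poly A) = 1 by apply/eqP; exact: char_poly_monic.
rewrite lc scale1r in hr.
have r0 z : z \in r -> z = 0.
  move=> zr; apply: h; rewrite /ev -/A eigenvalue_root_char hr root_prod_XsubC.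
  by [].
have e : char_poly A = 'X^(size r).
  rewrite hr big_seq (eq_bigr (fun=> 'X)) => [|z /r0 ->]; last by rewrite subr0.
  by rewrite -big_seq big_const_seq count_predT iter_mulr_1.
have sz : size r = 3%N.
  have := size_char_poly A; rewrite e size_polyXn => -[->].
  by [].
have := Cayley_Hamilton A; rewrite e sz rmorphXn /= horner_mx_X => <-.
by rewrite !exprS expr0 mulr1 mulrA.
Qed.

(** The cube itself vanishes here, so polarization yields matrix identities instead of trace
    identities. *)
Lemma nil_cubic (V : {vspace 'M[K]_3}) N M : (forall M, M \in V -> nil_spec f M) ->
  M \in V -> N \in V ->
  N *m M *m M + M *m N *m M + M *m M *m N = 0 /\ N *m N *m M + N *m M *m N + M *m N *m N = 0.
Proof.
move=> nV MV NV; set X := _ + M *m M *m N; set Y := _ + M *m N *m N.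
have cM := nil_cube (nV _ MV); have cN := nil_cube (nV _ NV).
have eD A B : (A + B) *m (A + B) *m (A + B) = A *m A *m A
  + (A *m A *m B + A *m B *m A + B *m A *m A) + (A *m B *m B + B *m A *m B + B *m B *m A)
  + B *m B *m B :> 'M[K]_3.
  rewrite !(mulmxDl, mulmxDr).
  move: (A *m A *m A) (A *m A *m B) (A *m B *m A) (A *m B *m B) (B *m A *m A) (B *m A *m B)
    (B *m B *m A) (B *m B *m B) => T1 T2 T3 T4 T5 T6 T7 T8.
  by apply/matrixP => i j; rewrite !mxE; ring.
have h1 := nil_cube (nV _ (memvD NV MV)).
have h2 := nil_cube (nV _ (memvB NV MV)).
move: h1 h2; rewrite !eD !mulmxN !mulNmx !opprK cM cN oppr0 !addr0 !add0r => h1 h2.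
have [||e1 e2] := @quad_vanish K _ Y X ch3; first exact: h1.
  by rewrite -h2 /X /Y !opprD.
by [].
Qed.

Section Normalized.
Variable V : {vspace 'M[K]_(1 + 2)}.
Notation x0 := (col_mx 1%:M 0 : 'cV[K]_(1 + 2)).
Notation w0 := (delta_mx 0 0 : 'cV[K]_2).
Notation v0 := (col_mx 0 w0 : 'cV[K]_(1 + 2)).
Notation l0 := (row_mx 0 (delta_mx 0 1) : 'rV[K]_(1 + 2)).
Hypothesis tV : forall B : 'M_2, strict_upper B -> exists R, block_mx 0 R 0 B \in V.

Lemma row2_w0 (l : 'rV[K]_2) : l *m w0 = 0 -> l = (l 0 1) *: delta_mx 0 1.
Proof.
move=> lw; apply/rowP => i; rewrite !mxE eqxx.
have [->|ni] := eqVneq i 1; first by rewrite mulr1.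
have -> : i = 0 by case: i ni => [[|[|]]] // h _; apply: val_inj.
have := congr1 (fun M : 'M_1 => M 0 0) lw; rewrite -colE !mxE => ->.
by rewrite mulr0.
Qed.

Lemma v0_liftable : liftable V x0 v0.
Proof.
apply: liftable_x0 => l lw; apply: tV => i j ij.
rewrite (row2_w0 lw) mxE big_ord1 !mxE !eqxx /= andbT.
case: i j ij => [[|[|]]] // hi [[|[|]]] // hj _ /=;
  by rewrite ?mulr0n ?mul0r ?mulr0 //.
Qed.

Lemma l0_x0 : l0 *m x0 = 0. Proof. by rewrite mul_row_col mul0mx mulmx0 addr0. Qed.
Lemma l0_v0 : l0 *m v0 = 0.
Proof. by rewrite mul_row_col mulmx0 add0r mul_delta_mx_cond. Qed.
Lemma l0_neq0 : l0 != 0.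
Proof.
apply/eqP; rewrite -row_mx0 => /eq_row_mx[_ /rowP/(_ 1)/eqP].
by rewrite !mxE !eqxx oner_eq0.
Qed.

Lemma lifted_l0 l r : lifted V x0 v0 l r -> l = (rsubmx l 0 1) *: l0.
Proof.
case=> lx lv _ _; rewrite {1}(row_x0 lx) scale_row_mx scaler0; congr row_mx.
apply: row2_w0; move: lv; rewrite {1}(row_x0 lx) mul_row_col mul0mx add0r.
by [].
Qed.

Lemma e0_neq0 (s : K) : v0 + s *: x0 != 0.
Proof.
apply/eqP => /(congr1 dsubmx); rewrite linearD linearZ /= !col_mxKd scaler0 addr0 linear0.
by move/matrixP/(_ 0 0)/eqP; rewrite !mxE !eqxx oner_eq0.
Qed.

Lemma line_of_beta s :
  (forall N, N \in V -> exists al be, N *m (v0 + s *: x0) = al *: (v0 + s *: x0) + be *: x0) ->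
  (forall N al be, N \in V -> N *m (v0 + s *: x0) = al *: (v0 + s *: x0) + be *: x0 -> be = 0) ->
  stable_line V.
Proof.
move=> h hb; exists (v0 + s *: x0); first exact: e0_neq0.
move=> N NV; have [al [be Ne]] := h _ NV; exists al.
by rewrite Ne (hb _ _ _ NV Ne) scale0r addr0.
Qed.

End Normalized.

End ThreeDimensional.

Section StructThree.
Variables (K : fieldType) (L : closedFieldType) (f : {rmorphism K -> L}).
Hypothesis ch3 : 3%N \in [pchar K].
Notation x0 := (col_mx 1%:M 0 : 'cV[K]_(1 + 2)).
Notation w0 := (delta_mx 0 0 : 'cV[K]_2).
Notation v0 := (col_mx 0 w0 : 'cV[K]_(1 + 2)).
Notation l0 := (row_mx 0 (delta_mx 0 1) : 'rV[K]_(1 + 2)).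

(** If the product of two linear forms of N is zero and the second is 1 at N1, the first is zero. *)
Lemma vanish_off_hyperplane (V : {vspace 'M[K]_(1 + 2)}) (e : 'cV[K]_(1 + 2)) N1 :
  N1 \in V -> bil l0 N1 x0 = 1 ->
  (exists al be, N1 *m e = al *: e + be *: x0) ->
  (forall N al be, N \in V -> N *m e = al *: e + be *: x0 -> be * bil l0 N x0 = 0) ->
  forall N al be, N \in V -> N *m e = al *: e + be *: x0 -> be = 0.
Proof.
move=> N1V b1 [al1 [be1 Ne1]] h N al be NV Ne.
have be10 : be1 = 0 by have := h _ _ _ N1V Ne1; rewrite b1 mulr1.
have [//|nbe] := eqVneq be 0.
have /eqP := h _ _ _ NV Ne; rewrite mulf_eq0 (negbTE nbe) => /eqP q0.
have NN1 : (N + N1) *m e = (al + al1) *: e + (be + be1) *: x0.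
  by rewrite mulmxDl Ne Ne1 addrACA -!scalerDl.
have := h _ _ _ (memvD NV N1V) NN1.
by rewrite bilDN q0 add0r b1 mulr1 be10 addr0.
Qed.

(** V = F + K I is maximal and has a triangular quotient. The lifts found in V lie in F, where the
    cubic identities replace the quartic ones. *)
Lemma nil_stable_line (F : {vspace 'M[K]_(1 + 2)}) :
  (forall M, M \in F -> nil_spec f M) -> \dim F = 3%N -> stable_line F.
Proof.
move=> nF dF; set V := (F + <[1%:M]>)%VS.
have mV : max_spec1 f V := @max_add_one K L f 2 F nF dF.
have eo : (3 <= 2)%N -> no_large_nil_subspace f by [].
have [P uP [ad su]] := normal_form ch3 (struct2 ch3) (gerstenhaber2 ch3) eo mV.
case=> [[tV _ _]|[p [F' [pm _ _]]]]; last by move: pm; rewrite addn3.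
apply: (stable_line_cj uP); set V' := cj P V in ad su tV *; set F' := cj P F.
have mV' : max_spec1 f V' := max_cj uP mV.
have [sV' _] := mV'.
have nF' M : M \in F' -> nil_spec f M by case/cj_ex => N NF ->; apply: nil_spec_conj => //; exact: nF.
have F'V M : M \in F' -> M \in V'.
  by case/cj_ex => N NF ->; apply: mem_cj; rewrite (subvP (addvSl _ _)).
have dec M : M \in V' -> exists2 N, N \in F' & exists c : K, M = N + c%:M.
  case/cj_ex => _ /memv_addP[N NF [_ /vlineP[c ->] ->]] ->; exists (conjP P N); first exact: mem_cj.
  by exists c; rewrite linearD linearZ /= conjP1 // scalemx1.
(* A matrix of V with eigenvalue 0 has zero scalar part. *)
have toF (l : 'rV_(1 + 2)) M : l != 0 -> l *m M = 0 -> M \in V' -> M \in F'.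
  move=> nl lM MV; have [N NF [c eM]] := dec _ MV.
  have : ev f M 0.
    rewrite /ev; apply/eigenvalueP; exists (map_mx f l); last by rewrite map_mx_eq0.
    by rewrite -map_mxM lM map_mx0 scale0r.
  rewrite eM ev_shift sub0r => /(nF' _ NF)/eqP; rewrite oppr_eq0 fmorph_eq0 => /eqP c0.
  by rewrite c0 raddf0 addr0.
have sur (c : 'cV_(1 + 2)) : exists2 N, N \in F' & exists a : K, N *m x0 = c + a *: x0.
  have [M MV [a hM]] := surj_x0 su c; have [N NF [s eM]] := dec _ MV.
  exists N => //; exists (a - s); have -> : N = M - s%:M by rewrite eM addrK.
  by rewrite mulmxBl hM mul_scalar_mx scalerBl addrA.
have kill l r : lifted V' x0 v0 l r -> l != 0 -> v0 *m l + x0 *m r \in F'.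
  move=> [lx lv _ MV] nl; apply: (toF l) => //.
  by rewrite mulmxDr !mulmxA lv lx !mul0mx addr0.
have hz l r : lifted V' x0 v0 l r -> r *m v0 = 0.
  move=> h; have [lx lv rx MV] := h; have [l_0|nl] := eqVneq l 0.
    have h0 : lifted V' x0 v0 0 0 by split; rewrite ?mul0mx ?mulmx0 ?addr0 ?mem0v.
    by move: h; rewrite l_0 => h; rewrite (lifted_unique ad h h0) mul0mx.
  have MF := kill _ _ h nl; have [c lc] := row_neq0 nl.
  have [N NF [a Nx]] := sur c.
  have lM : l *m (v0 *m l + x0 *m r) = 0 by rewrite mulmxDr !mulmxA lv lx !mul0mx addr0.
  have sq := lifted_sqr h.
  move: (v0 *m l + x0 *m r) MF lM sq => M MF lM sq.
  (* Multiplied on the left by l, which kills M, the first identity becomes (r v)(l N x) l = 0, and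
     N was chosen with l N x = 1. *)
  have [+ _] := nil_cubic ch3 nF' MF NF.
  move/(congr1 (mulmx l)); rewrite !mulmxDr !mulmxA lM !mul0mx !addr0 -(mulmxA (l *m N)).
  rewrite sq -scalemxAr mulmx0 mulmxA -(mulmxA l) Nx mulmxDr -scalemxAr lx.
  rewrite scaler0 addr0 [l *m c]mx11_scalar lc mul1mx => /eqP.
  by rewrite scaler_eq0 (negbTE nl) orbF => /eqP e; apply: mx11P; rewrite e mxE.
have exl : exists2 l : 'rV_(1 + 2), l != 0 & l *m x0 = 0 /\ l *m v0 = 0.
  by exists l0; [exact: l0_neq0|split; [exact: l0_x0|exact: l0_v0]].
have [s [eP hN]] := rank_one_line ch3 sV' ad (surj_x0 su) (v0_liftable tV) exl hz.
set e := v0 + s *: x0 in eP hN.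
suff st : stable_line F' by [].
exists e; first exact: e0_neq0.
have [l0e e0V] := eP _ (l0_x0 K) (l0_v0 K).
have eF : e *m l0 \in F'.
  by apply: (toF l0) => //; [exact: l0_neq0|rewrite mulmxA l0e mul0mx].
have [c lc] := row_neq0 (l0_neq0 K).
have [N1 N1F [a1 N1x]] := sur c.
have b1 : bil l0 N1 x0 = 1.
  by rewrite (bil_sub _ N1x) mulmxDr -scalemxAr l0_x0 scaler0 addr0.
have key N al be : N \in F' -> N *m e = al *: e + be *: x0 -> be * bil l0 N x0 = 0.
  move=> NF Ne; have [_] := nil_cubic ch3 nF' eF NF.
  have lNe := rank_one_kill ch3 sV' l0e e0V (F'V _ NF).
  have lNe0 : l0 *m N *m e = 0 by apply: mx11P; rewrite [RHS]mxE.
  move/(congr1 (mulmx l0)); rewrite !mulmxDr !mulmxA l0e lNe0 !mul0mx !addr0 mulmx0.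
  rewrite -(mulmxA (l0 *m N)) Ne mulmxDr -!scalemxAr lNe0 scaler0 add0r => /(congr1 (mulmxr c)).
  rewrite /mulmxr mul0mx -mulmxA [l0 *m c]mx11_scalar lc mulmx1 => /(congr1 (fun M : 'M_1 => M 0 0)).
  by rewrite !mxE /bil mxE.
move=> N NF; have [al [be Ne]] := hN _ (F'V _ NF); exists al.
have N1e := hN _ (F'V _ N1F).
by rewrite Ne (vanish_off_hyperplane N1F b1 N1e key NF Ne) scale0r addr0.
Qed.

(** A nil subspace of dimension 3 has a stable line, and F is the sum of it and the scalars, so F
    would have the same stable line. *)
Lemma exceptional_no_large_nil : no_large_nil_subspace f.
Proof.
move=> F F' eF F'F dF'; apply: contrapT => no.
have nF A : A \in F' -> nil_spec f A.
  move=> AF a ea; apply/eqP/negPn/negP => na; apply: no; exists A => //; by exists a.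
have dF : \dim F' = 3%N.
  apply/eqP; rewrite eqn_leq dF' andbT.
  exact: (nil_bound (@dimension_boundP K L f ch3 3) nF).
have [e ne he] := @nil_stable_line F' nF dF.
apply: (@exc_no_stable_line K L f ch3 F eF e ne) => A AF.
have eFF : (F' + <[1%:M]>)%VS = F.
  apply/eqP; rewrite eqEdim subv_add F'F /= -memvE (exc_one f ch3 eF).
  by rewrite dim_add_one ?dF; [have [-> _ _] := eF|exact: one_notin_nil nF].
move: AF; rewrite -eFF => /memv_addP[N NF [_ /vlineP[c ->] ->]].
have [d hd] := he _ NF; exists (d + c).
by rewrite scalemx1 mulmxDl mul_scalar_mx hd scalerDl.
Qed.

End StructThree.

(** * Three dimensions: spaces with a nonzero trace, and the classification *)

Section StructThreeTrace.
Variables (K : fieldType) (L : closedFieldType) (f : {rmorphism K -> L}).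
Hypothesis ch3 : 3%N \in [pchar K].
Notation x0 := (col_mx 1%:M 0 : 'cV[K]_(1 + 2)).
Notation w0 := (delta_mx 0 0 : 'cV[K]_2).
Notation v0 := (col_mx 0 w0 : 'cV[K]_(1 + 2)).
Notation l0 := (row_mx 0 (delta_mx 0 1) : 'rV[K]_(1 + 2)).

(** Of the shifts by 0, 1 and -1, each of a and b becomes zero for at most one, so some shift makes
    both nonzero. *)
Lemma one_single n (V : {vspace 'M[K]_n}) : spec1_space f V -> 1%:M \in V ->
  forall M a b, M \in V -> ev f M a -> ev f M b -> a = b.
Proof.
move=> sV V1 M a b MV ea eb; apply/eqP/negPn/negP => nab.
have n1 : (1 : L) != 0 := oner_neq0 _.
have n2 : (1 : L) != -1 := opp_neq f ch3 n1.
have key (s : K) : a + f s = 0 \/ b + f s = 0.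
  have [?|na] := eqVneq (a + f s) 0; first by left.
  have [?|nb] := eqVneq (b + f s) 0; first by right.
  case/eqP: nab; apply: (addIr (f s)).
  have NV : M + s%:M \in V by rewrite memvD // -scalemx1 memvZ.
  by apply: (sV _ NV) => //; rewrite ev_shift addrK.
have := key 0; have := key 1; have := key (-1); rewrite rmorph0 rmorphN1 rmorph1 !addr0.
have c1 (x : L) : x = 0 -> x + 1 = 0 -> False by move=> -> /eqP; rewrite add0r (negbTE n1).
have c2 (x : L) : x = 0 -> x - 1 = 0 -> False.
  by move=> -> /eqP; rewrite add0r oppr_eq0 (negbTE n1).
have c3 (x : L) : x + 1 = 0 -> x - 1 = 0 -> False.
  by move=> h1 h2; move/eqP: n2; apply; apply: (@addrI _ x); rewrite h1 h2.
case=> h1 [] h2 [] h3;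
  first [exact: (c1 _ h3 h2)|exact: (c2 _ h3 h1)|exact: (c3 _ h2 h1)].
Qed.

Section Normalized.
Variable V : {vspace 'M[K]_(1 + 2)}.
Hypothesis sV : spec1_space f V.
Hypothesis ad : adapted V x0.
Hypothesis su : forall c, exists2 N, N \in V & dlsubmx N = c.
Hypothesis tV : triangular_form V.

Let upperV B : B \in ustab V -> [/\ B \in V, B *m x0 = ulsubmx B 0 0 *: x0,
  B *m v0 = drsubmx B 0 0 *: v0 + (ursubmx B *m w0) 0 0 *: x0,
  l0 *m B = drsubmx B 1 1 *: l0 & \tr B = ulsubmx B 0 0 + (drsubmx B 0 0 + drsubmx B 1 1)].
Proof.
move=> BU; have [_ /(_ _ BU) uB _] := tV.
move: BU; rewrite mem_ustab => /andP[BV /eqP dl].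
have u10 : drsubmx B 1 0 = 0 by exact: uB.
split=> //.
- by rewrite mul_x0 dl {1}[ulsubmx B]mx11_scalar scale_col_mx scaler0 scalemx1.
- rewrite -{1}[B]submxK mul_block_col !mulmx0 !add0r !scale_col_mx !scaler0 add_col_mx add0r addr0.
  congr col_mx; first by rewrite scalemx1 -mx11_scalar.
  rewrite -colE; apply/colP => i; rewrite [LHS]mxE [RHS]mxE [X in _ = _ * X]mxE eqxx andbT.
  by case: i => [[|[|]]] // hi; rewrite ?mulr1 ?mulr0 -?u10;
     [congr (drsubmx B _ _); apply: val_inj|congr (drsubmx B _ _); apply: val_inj].
- rewrite -{1}[B]submxK dl mul_row_block !mul0mx !mulmx0 !add0r scale_row_mx scaler0.
  congr row_mx; rewrite -rowE; apply/rowP => i; rewrite [LHS]mxE [RHS]mxE [X in _ = _ * X]mxE eqxx /=.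
  by case: i => [[|[|]]] // hi; rewrite ?mulr1 ?mulr0 -?u10;
     [congr (drsubmx B _ _); apply: val_inj|congr (drsubmx B _ _); apply: val_inj].
- rewrite -{1}[B]submxK mxtrace_block {1}/mxtrace big_ord1; congr (_ + _).
  rewrite /mxtrace big_ord_recl big_ord1; congr (_ + drsubmx B _ _); exact: val_inj.
Qed.

(** With diagonal a, d0, d1 of B, [lifted_relation] reads (a + d1) rv = 2 d0 rv, that is tr(B) rv =
    3 d0 rv = 0. *)
Let hz_of_trace B : B \in ustab V -> \tr B != 0 ->
  forall l r, lifted V x0 v0 l r -> r *m v0 = 0.
Proof.
move=> BU tB l r h; have [BV Bx Bv lB tE] := upperV BU.
have [lx lv rx MV] := h; have [l_0|nl] := eqVneq l 0.
  have h0 : lifted V x0 v0 0 0 by split; rewrite ?mul0mx ?mulmx0 ?addr0 ?mem0v.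
  by move: h; rewrite l_0 => h; rewrite (lifted_unique ad h h0) mul0mx.
have [c lc] := row_neq0 nl; have [N NV hN] := surj_bil (surj_x0 su) c.
have z0 : l *m 0 *m x0 = 0 :> 'M_1 by rewrite mulmx0 mul0mx.
have [e1 _] := hN l 0 lx z0; rewrite lc in e1.
have lB' : l *m B = drsubmx B 1 1 *: l.
  by rewrite (lifted_l0 h) -scalemxAl lB !scalerA mulrC.
have lBv : bil l B v0 = 0 by rewrite /bil lB' -scalemxAl lv scaler0 mxE.
have := lifted_relation ch3 sV h NV BV Bx lBv.
have -> : bil l (B *m N) x0 = drsubmx B 1 1.
  by rewrite /bil mulmxA lB' -!scalemxAl [LHS]mxE -/(bil l N x0) e1 mulr1.
have -> : bil r B v0 = drsubmx B 0 0 * (r *m v0) 0 0.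
  by rewrite (bil_sub r Bv) mulmxDr -!scalemxAr rx scaler0 addr0 [LHS]mxE.
rewrite e1 mulr1 mul1r => e; apply: mx11P; rewrite [RHS]mxE.
move: e tB; rewrite tE; set rv := (r *m v0) 0 0; set a := ulsubmx B 0 0.
set d0 := drsubmx B 0 0; set d1 := drsubmx B 1 1 => e tB.
apply: (mulfI tB); rewrite mulr0.
have -> : (a + (d0 + d1)) * rv = rv * (a + d1) - 2%:R * (d0 * rv) + 3%:R * (d0 * rv) by ring.
by rewrite e subrr (three0 ch3) mul0r addr0.
Qed.

(** The diagonal entries of D are 0 or 1 and not all 0, so trace zero in characteristic 3 means
    three ones. Then D = I + x rho, and [spec1_sqr] reduces to (rho N x)^2 = 0, which gives rho =
    0. *)
Let trace_or_one : (exists2 B, B \in ustab V & \tr B != 0) \/ 1%:M \in V.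
Proof.
have [_ _ [D DU hD]] := tV; have [DV Dx Dv lD tE] := upperV DU.
have [t0|nt] := eqVneq (\tr D) 0; last by left; exists D.
case: hD => [[dD uD]|[I nI [dD [t uD]]]].
  by move: t0; rewrite tE dD uD !mxE !eqxx !addr0 => /eqP; rewrite oner_eq0.
right.
have [tt i0 i1] : [/\ t, 0 \in I & 1 \in I].
  have i01 : (0 \in I) || (1 \in I).
    case/set0Pn: nI => i iI; apply/orP; case: i iI => [[|[|]]] // hi iI; [left|right];
    by move: iI; congr (_ \in I); apply: val_inj.
  move: t0; rewrite tE dD uD !mxE !eqxx /= mulr1n => /eqP.
  move: i01; case: (0 \in I); case: (1 \in I); case: t {uD} => //= _;
    rewrite ?addr0 ?add0r -?(natrD _ 1 1) ?(oner_eq0, negbTE (two_neq0 ch3)) //.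
have drD : drsubmx D = 1%:M.
  rewrite dD; apply/matrixP => i j; rewrite !mxE; have -> : i \in I.
    by case: i => [[|[|]]] // hi; [move: i0|move: i1]; congr (_ \in I); apply: val_inj.
  by rewrite andbT.
have ulD : ulsubmx D = 1%:M by rewrite uD tt.
have dlD : dlsubmx D = 0 by move: DU; rewrite mem_ustab => /andP[_ /eqP].
set rho : 'rV[K]_(1 + 2) := row_mx 0 (ursubmx D).
have rx : rho *m x0 = 0 by rewrite mul_row_col mul0mx mulmx0 addr0.
have DE : D = 1%:M + x0 *m rho.
  rewrite -[LHS]submxK ulD drD dlD /rho mul_col_row !mul0mx mul1mx scalar_mx_block add_block_mx.
  by rewrite mul1mx !addr0 add0r.
suff r0 : rho = 0 by move: DV; rewrite DE r0 mulmx0 addr0.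
apply: row_eq0 => c; have [N NV [a Nx]] := surj_x0 su c.
have := spec1_sqr ch3 sV DV NV t0; rewrite DE.
have YY : x0 *m rho *m (x0 *m rho) = 0 by rewrite mulmxA -(mulmxA x0) rx mulmx0 mul0mx.
move: (tr_crcr N N x0 rho x0 rho) YY; move: (x0 *m rho) => Y tY YY.
have -> : (1%:M + Y) *m (1%:M + Y) = 1%:M + 2%:R *: Y.
  by rewrite mulmxDl !mulmxDr !mulmx1 mul1mx YY addr0 scaler_nat mulr2n addrA.
rewrite mulmxDr mulmx1 mxtraceD -scalemxAr mxtraceZ [N *m (1%:M + Y)]mulmxDr mulmx1.
rewrite -/(p2 (N + N *m Y)) p2D /p2 tY [\tr (N *m Y *m N)]mxtrace_mulC mulmxA.
move=> /eqP; rewrite -subr_eq0 opprD addrA addrN sub0r oppr_eq0 mulf_eq0 orbb => /eqP.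
by rewrite (bil_sub rho Nx) mulmxDr -scalemxAr rx scaler0 addr0.
Qed.

Let i0 : 'I_(1 + 2) := lshift 2 ord0.
Let i1 : 'I_(1 + 2) := rshift 1 ord0.
Let i2 : 'I_(1 + 2) := rshift 1 ord_max.

Let sum3 (g : 'I_(1 + 2) -> K) : \sum_i g i = g i0 + g i1 + g i2.
Proof.
rewrite (big_ord_recl 2) (big_ord_recl 1) big_ord1 addrA.
by congr (g _ + g _ + g _); apply: val_inj.
Qed.

Let x0E i : x0 i 0 = (i == i0)%:R.
Proof.
rewrite /i0; case: (split_ordP i) => j ->; rewrite ?col_mxEu ?col_mxEd ?ord1 mxE //.
Qed.
Let v0E i : v0 i 0 = (i == i1)%:R.
Proof.
rewrite /i1; case: (split_ordP i) => j ->; rewrite ?col_mxEu ?col_mxEd !mxE ?ord1 //.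
by rewrite (inj_eq (@rshift_inj _ _)) andbT.
Qed.
Let l0E i : l0 0 i = (i == i2)%:R.
Proof.
rewrite /i2; case: (split_ordP i) => j ->; rewrite ?row_mxEl ?row_mxEr !mxE ?ord1 //=.
Qed.

(** For size 3, [line_relation] says that the product of the coefficient be, the entry N i2 i0 and
    the trace of N is zero. The last two do not vanish identically on V, so be does. *)
Lemma trace_stable_line : (exists2 M, M \in V & \tr M != 0) -> stable_line V.
Proof.
move=> [M MV tM].
have [[B BU tB]|V1] := trace_or_one; last first.
  have := single_tr0 ch3 (fun a b => @one_single _ V sV V1 M a b MV).
  by move=> t0; rewrite t0 eqxx in tM.
have hz := hz_of_trace BU tB; have [tV' _ _] := tV.
have exl : exists2 l : 'rV_(1 + 2), l != 0 & l *m x0 = 0 /\ l *m v0 = 0.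
  by exists l0; [exact: l0_neq0|split; [exact: l0_x0|exact: l0_v0]].
have [s [eP hN]] := rank_one_line ch3 sV ad (surj_x0 su) (v0_liftable tV') exl hz.
set e := v0 + s *: x0 in eP hN.
have [l0e e0V] := eP _ (l0_x0 K) (l0_v0 K).
have rel N al be : N \in V -> N *m e = al *: e + be *: x0 ->
    be * (N i2 i0 * \tr N) = 0.
  move=> NV Ne; have := line_relation ch3 sV (l0_x0 K) l0e e0V NV Ne.
  have lNe := rank_one_kill ch3 sV l0e e0V NV.
  have eE i : e i 0 = (i == i1)%:R + s * (i == i0)%:R by rewrite mxE v0E mxE x0E.
  have bE (M' : 'M[K]_(1 + 2)) (u : 'cV_(1 + 2)) : bil l0 M' u = \sum_j M' i2 j * u j 0.
    by rewrite /bil -mulmxA mxE sum3 !l0E /= !mul0r !add0r mul1r mxE.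
  have mx0 (M' : 'M[K]_(1 + 2)) : bil l0 M' x0 = M' i2 i0.
    by rewrite bE sum3 !x0E /= mulr1 !mulr0 !addr0.
  move: lNe; rewrite bE sum3 !eE /= !mulr0 !mulr1 !addr0 !add0r mulr0 addr0 => lNe.
  have n21 : N i2 i1 = - (s * N i2 i0).
    by apply/eqP; rewrite -addr_eq0 -lNe; apply/eqP; ring.
  have alE : al = N i1 i1 + s * N i1 i0.
    have := congr1 (fun u : 'cV_(1 + 2) => u i1 0) Ne.
    rewrite [LHS]mxE sum3 !eE [RHS]mxE [X in _ = X + _]mxE [X in _ = _ + X]mxE x0E eE /=.
    move=> h; transitivity (al * (1 + s * 0) + be * 0); first by ring.
    by rewrite -h; ring.
  rewrite !mx0 mxE sum3 n21 alE /mxtrace sum3 => <-.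
  by ring.
have [N1 N1V b1] : exists2 N1, N1 \in V & N1 i2 i0 != 0.
  have [c lc] := row_neq0 (l0_neq0 K); have [N NV [a Nx]] := surj_x0 su c; exists N => //.
  have : bil l0 N x0 = 1 by rewrite (bil_sub _ Nx) mulmxDr -scalemxAr l0_x0 scaler0 addr0.
  rewrite /bil -mulmxA mxE sum3 !l0E /= !mul0r !add0r mul1r mxE sum3 !x0E /= mulr1 !mulr0 !addr0.
  by move=> ->; exact: oner_neq0.
(* Two nonzero linear forms are both nonzero at N1, at M or at N1 + M. *)
have [N2 N2V [b2 t2]] : exists2 N2, N2 \in V & N2 i2 i0 != 0 /\ \tr N2 != 0.
  have [t1|nt1] := eqVneq (\tr N1) 0; last by exists N1.
  have [b0|nb0] := eqVneq (M i2 i0) 0; last by exists M.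
  by exists (N1 + M); [rewrite memvD|rewrite mxE b0 addr0 mxtraceD t1 add0r].
apply: (line_of_beta hN) => N al be NV Ne.
have [al2 [be2 Ne2]] := hN _ N2V.
have be20 : be2 = 0.
  have /eqP := rel _ _ _ N2V Ne2; rewrite mulf_eq0 => /orP[/eqP //|].
  by rewrite mulf_eq0 (negbTE b2) (negbTE t2).
apply/eqP/negPn/negP => nbe.
(* Since be2 = 0, the coefficient be is the same at N + t N2. If it is nonzero, one of two affine
   functions of t with nonzero slope vanishes at each of 0, 1 and -1, so one of them vanishes
   twice. *)
have key (t : K) : N i2 i0 + t * N2 i2 i0 = 0 \/ \tr N + t * \tr N2 = 0.
  have NtV : N + t *: N2 \in V by rewrite memvD // memvZ.
  have Ne' : (N + t *: N2) *m e = (al + t * al2) *: e + be *: x0.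
    rewrite mulmxDl Ne -scalemxAl Ne2 be20 scale0r addr0 scalerA scalerDl.
    by rewrite addrAC.
  have /eqP := rel _ _ _ NtV Ne'; rewrite mulf_eq0 (negbTE nbe) /= mulf_eq0 mxtraceD mxtraceZ.
  by rewrite [(_ + _ : 'M_(_)) i2 i0]mxE [(_ *: _ : 'M_(_)) i2 i0]mxE => /orP[]/eqP ->; [left|right].
have lin (a b t u : K) : b != 0 -> a + t * b = 0 -> a + u * b = 0 -> t = u.
  move=> nb h1 h2; apply: (mulIf nb); apply: (@addrI _ a).
  by rewrite h1 h2.
have n1 : (1 : K) != 0 := oner_neq0 _.
have n10 : (0 : K) <> 1 by move/eqP; rewrite eq_sym (negbTE n1).
have n20 : (0 : K) <> -1 by move/eqP; rewrite eq_sym oppr_eq0 (negbTE n1).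
have n12 : (1 : K) <> -1.
  by move/eqP; rewrite -addr_eq0 -(natrD _ 1 1) (negbTE (two_neq0 ch3)).
case: (key 0) => h0; case: (key 1) => h1; case: (key (-1)) => h2;
  first [exact: n10 (lin _ _ _ _ b2 h0 h1)|exact: n20 (lin _ _ _ _ b2 h0 h2)
        |exact: n12 (lin _ _ _ _ b2 h1 h2)|exact: n10 (lin _ _ _ _ t2 h0 h1)
        |exact: n20 (lin _ _ _ _ t2 h0 h2)|exact: n12 (lin _ _ _ _ t2 h1 h2)].
Qed.

End Normalized.

(** A nonzero trace yields a stable line. If all traces vanish, [equal_eigenvalues] applies in every
    closed extension, so V itself is exceptional unless it is similar to [V1star] of the full
    set. *)
Lemma struct3 : struct_at f 3.
Proof.
move=> V sV dV; have mV : @max_spec1 K L f (1 + 2) V by split.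
have eo : (3 <= 2)%N -> no_large_nil_subspace f by [].
have [[M MV tM]|no] := pselect (exists2 M, M \in V & \tr M != 0).
  have [P uP [ad su hc]] := normal_form ch3 (struct2 ch3) (gerstenhaber2 ch3) eo mV.
  case: hc => [tV|[p [F [pm _ _]]]]; last by move: pm; rewrite addn3.
  have [sV' _] := max_cj uP mV.
  have st : @stable_line K (1 + 2) V.
    apply: (stable_line_cj uP); apply: (trace_stable_line sV' ad su tV).
    exists (conjP P M); first exact: mem_cj.
    by rewrite /conjP mxtrace_mulC mulmxA mulVmx // mul1mx.
  by have [|[]] := stable_line_struct ch3 (struct2 ch3) (gerstenhaber2 ch3) eo mV st; [left|].
have t0 M : M \in V -> \tr M = 0.
  by move=> MV; apply/eqP/negPn/negP => nt; apply: no; exists M.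
have [h1|n1] := pselect (mx_similar (fun M => M \in V) (V1star [set: 'I_3])).
  left; exists [set: 'I_3] => //; by apply/set0Pn; exists 0; rewrite inE.
right; exists 0, V; first split=> //.
  split=> // L' f' M MV a b.
  have [q _] := spec1_tr0 ch3 (sV _ MV) (t0 _ MV).
  by move=> ea eb; apply: (@equal_eigenvalues K L' f' ch3 M (t0 _ MV) q).
apply: sim_iff (sim_refl _) => M; rewrite (@W1star_block0 K 0 V M); split=> [MV|[_ MV _]].
  split; [by apply/matrixP => -[]| |by case].
  move: MV; congr (_ \in V); apply/matrixP => i j; rewrite !mxE.
  by congr (M _ _); apply: val_inj.
move: MV; congr (_ \in V); apply/matrixP => i j; rewrite !mxE.
by congr (M _ _); apply: val_inj.
Qed.

End StructThreeTrace.

(** * Spaces with an invariant exceptional block *)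

Section BlockAssembly.
Variables (K : fieldType) (L : closedFieldType) (f : {rmorphism K -> L}).
Hypothesis ch3 : 3%N \in [pchar K].

Lemma three_values (x d mu : L) : d != 0 ->
  (forall s : K, s \in [:: 0; 1; -1] -> x + f s * d = 0 \/ x + f s * d = mu) -> False.
Proof.
move=> nd h.
have n2 : d != - d := opp_neq f ch3 nd.
have h0 := h 0 (mem_head _ _); have := h 1; have := h (-1).
rewrite !inE !eqxx ?orbT => /(_ isT) h2 /(_ isT) h1.
move: h0 h1 h2; rewrite rmorph0 rmorph1 rmorphN1 mul0r mul1r mulN1r addr0.
have c1 (y : L) : x = y -> x + d = y -> False.
  by move=> -> /eqP; rewrite -subr_eq0 addrAC subrr add0r (negbTE nd).
have c2 (y : L) : x = y -> x - d = y -> False.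
  by move=> -> /eqP; rewrite -subr_eq0 addrAC subrr add0r oppr_eq0 (negbTE nd).
have c3 (y : L) : x + d = y -> x - d = y -> False.
  by move=> h1 h2; move/eqP: n2; apply; apply: (@addrI _ x); rewrite h1 h2.
by case=> h0 [] h1 [] h2;
  first [exact: (c1 _ h0 h1)|exact: (c2 _ h0 h2)|exact: (c3 _ h1 h2)].
Qed.

(** F' collects the blocks of the matrices that vanish on the quotient. It is large enough to
    contain a matrix with a nonzero eigenvalue; adding its multiples moves the eigenvalue on the
    block, so the action on the quotient must be nilpotent. *)
Lemma assembly3 k (V : {vspace 'M[K]_(3 + k)}) (F : {vspace 'M[K]_3}) : gerstenhaber_at f k ->
  exceptional F -> max_spec1 f V -> (forall M, M \in V -> dlsubmx M = 0) ->
  (forall A, A \in F -> exists2 M, M \in V & ulsubmx M = A) -> case2 V.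
Proof.
move=> Gk eF [sV dV] dl hF.
have VE M : M \in V -> M = block_mx (ulsubmx M) (ursubmx M) 0 (drsubmx M).
  by move=> MV; rewrite -(dl _ MV) submxK.
set ulf := linfun (@ulsubmx K 3 k 3 k); set drf := linfun (@drsubmx K 3 k 3 k).
set urf := linfun (@ursubmx K 3 k 3 k).
have [dF _ _] := eF.
have FE : (ulf @: V)%VS = F.
  apply/esym/eqP; rewrite eqEdim dF; apply/andP; split.
    by apply/subvP => A /hF[M MV <-]; apply/memv_imgP; exists M; rewrite ?lfunE.
  have := dimension_boundP ch3 (f := f) (n := 3) (V := (ulf @: V)%VS); apply.
  move=> A /memv_imgP[M MV ->]; rewrite lfunE /=.
  by have := sV _ MV; rewrite {1}(VE _ MV) => /spec1_ul.
have ulF M : M \in V -> ulsubmx M \in F.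
  by move=> MV; rewrite -FE; apply/memv_imgP; exists M; rewrite ?lfunE.
set B := (drf @: V)%VS; set N1 := (V :&: lker drf)%VS; set F' := (ulf @: N1)%VS.
set Z := (N1 :&: lker ulf)%VS.
have memN M : M \in N1 -> M \in V /\ drsubmx M = 0.
  by rewrite memv_cap memv_ker lfunE /= => /andP[-> /eqP->].
have memZ M : M \in Z -> [/\ M \in V, drsubmx M = 0 & ulsubmx M = 0].
  by rewrite memv_cap memv_ker lfunE /= => /andP[/memN[-> ->] /eqP->].
have e1 : \dim V = (\dim N1 + \dim B)%N by exact: dim_split.
have e2 : \dim N1 = (\dim Z + \dim F')%N by exact: dim_split.
have e3 : \dim (urf @: Z) = \dim Z.
  apply: dim_img_inj => M /memZ[MV d u]; rewrite lfunE /= => r.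
  by rewrite (VE _ MV) d u r block_mx_const.
have h3 : (\dim Z <= 3 * k)%N.
  by rewrite -e3; apply: leq_trans (dim_le_full _) _; rewrite dim_mx.
have sB : spec1_space f B.
  move=> A /memv_imgP[M MV ->]; rewrite lfunE /=.
  by have := sV _ MV; rewrite {1}(VE _ MV) => /spec1_dr.
have hb : (\dim B <= 'C(k, 2) + 1)%N by exact: dimension_boundP sB.
have F'F : (F' <= F)%VS.
  by apply/subvP => A /memv_imgP[M /memN[MV _] ->]; rewrite lfunE; exact: ulF.
have hF' : (\dim F' <= 4)%N by rewrite -dF; exact: dimvS.
have eC : 'C(3 + k, 2) = (3 + 3 * k + 'C(k, 2))%N by rewrite !binS2; lia.
rewrite eC in dV.
(* The dimension 3 k + 4 + C(k, 2) of V is at most 3 k + dim F' + C(k, 2) + 1. *)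
have dF' : (3 <= \dim F')%N by lia.
have [A0 A0F' [lam nlam e0]] := @exceptional_no_large_nil K L f ch3 F F' eF F'F dF'.
have F1 : 1%:M \in F := exc_one f ch3 eF.
have star M mu A' x : M \in V -> ev f (drsubmx M) mu -> mu != 0 -> A' \in F' ->
    ev f (ulsubmx M + A') x -> x = 0 \/ x = mu.
  move=> MV emu nmu /memv_imgP[N /memN[NV dN] ->]; rewrite lfunE /= => ex.
  have [->|nx] := eqVneq x 0; [by left|right].
  have NV' := memvD MV NV.
  have := sV _ NV'; rewrite (VE _ NV') => /spec1_cross; apply=> //.
    by rewrite linearD.
  by rewrite linearD /= dN addr0.
have nB M : M \in V -> nil_spec f (drsubmx M).
  move=> MV mu emu; apply/eqP/negPn/negP => nmu.
  have [F'1|nF'1] := boolP (1%:M \in F').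
    have [x ex] := ev_exists f (ulsubmx M : 'M_2.+1).
    apply: (@three_values x 1 mu (oner_neq0 _)) => s _; rewrite mulr1.
    apply: (star M mu (s%:M)) => //; first by rewrite -scalemx1 memvZ.
    by rewrite ev_shift addrK.
  (* Without scalars in F', the block of M is reduced modulo F' to a scalar t, and t + s lam is an
     eigenvalue after adding s A0. *)
  have FE' : (F' + <[1%:M]>)%VS = F.
    apply/eqP; rewrite eqEdim subv_add F'F -memvE F1 /=.
    by rewrite (@dim_add_one K 2) // dF.
  have := ulF _ MV; rewrite -FE' => /memv_addP[A1 A1F [_ /vlineP[t ->] eA]].
  apply: (@three_values (f t) lam mu nlam) => s _.
  apply: (star M mu (- A1 + s *: A0)) => //; first by rewrite memvD ?memvN ?memvZ.
  rewrite eA scalemx1 (_ : _ + _ = s *: A0 + t%:M); last by rewrite addrC addrACA addNr add0r.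
  rewrite ev_shift addrAC subrr add0r; exact: ev_scale.
have nB' A : A \in B -> nil_spec f A.
  by case/memv_imgP => M MV ->; rewrite lfunE; exact: nB.
have hn : (\dim B <= 'C(k, 2))%N := nil_bound (@dimension_boundP K L f ch3 k) nB'.
have dB : \dim B = 'C(k, 2) by lia.
have [Q uQ hQ] := Gk _ nB' dB.
have dZ : \dim Z = (3 * k)%N by lia.
have eF' : F' = F by apply/eqP; rewrite eqEdim F'F dF; lia.
have hr C : block_mx 0 C 0 0 \in V.
  have : C \in (urf @: Z)%VS by apply: dim_eq_full; rewrite dim_mx e3 dZ.
  case/memv_imgP => M /memZ[MV d u]; rewrite lfunE /= => ->.
  by have := VE _ MV; rewrite u d => <-.
exists 0, F; first by split=> //; rewrite add0n leq_addr.
exists (bdiag 3 Q); first exact: bdiag_unit.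
move=> M; rewrite W1star_block0 -/(conjP (bdiag 3 Q) M).
have cM : conjP (bdiag 3 Q) M = block_mx (ulsubmx M) (ursubmx M *m invmx Q)
   (Q *m dlsubmx M) (conjP Q (drsubmx M)) by rewrite -{1}[M]submxK conj_bdiag.
rewrite cM block_mxKdl block_mxKul block_mxKdr; split=> [MV|[d uF su]].
  rewrite dl // mulmx0; split=> //; first exact: ulF.
  by apply/hQ; apply/memv_imgP; exists M; rewrite ?lfunE.
have dM : dlsubmx M = 0 by rewrite -[LHS](mulKmx uQ) d mulmx0.
have /memv_imgP[M1 M1V] : drsubmx M \in B by apply/hQ.
rewrite lfunE /= => dM1.
have : ulsubmx M - ulsubmx M1 \in F' by rewrite eF' memvB // ulF.
case/memv_imgP => N /memN[NV dN]; rewrite lfunE /= => uN.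
have e : M = M1 + N + block_mx 0 (ursubmx (M - M1 - N)) 0 0.
  apply/eqP; rewrite addrC -subr_eq opprD addrA; apply/eqP.
  rewrite -[LHS]submxK; congr block_mx.
  - by rewrite !linearB /= uN subrr.
  - by rewrite !linearB /= dM !dl // !subrr.
  - by rewrite !linearB /= dM1 dN subrr subr0.
by rewrite e memvD // memvD.
Qed.

Lemma stable_block_struct k (V : {vspace 'M[K]_(3 + k)}) (F : {vspace 'M[K]_3})
    (z : 'M[K]_(3 + k, 3)) : gerstenhaber_at f k -> exceptional F -> max_spec1 f V -> \rank z = 3%N ->
  (forall N, N \in V -> exists A, N *m z = z *m A) ->
  (forall A, A \in F -> exists2 N, N \in V & N *m z = z *m A) -> case2 V.
Proof.
move=> Gk eF mV rz hs hF; have [P uP Pz] := complete_columns rz.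
apply: (case2_cj uP); apply: (assembly3 Gk eF (max_cj uP mV)).
  move=> _ /cj_ex[N NV ->]; have [A hA] := hs _ NV.
  by have [_] := stable_block uP Pz hA.
move=> A /hF[N NV hN]; exists (conjP P N); first exact: mem_cj.
by have [] := stable_block uP Pz hN.
Qed.

Lemma four_dim_stable (V : {vspace 'M[K]_(1 + 3)}) (F : {vspace 'M[K]_3}) :
  spec1_space f V -> 1%:M \in F -> no_stable_line F -> (forall A, A \in F -> \tr A = 0) ->
  (forall c, exists2 N, N \in V & dlsubmx N = c) ->
  (forall A, A \in F -> exists R, block_mx 0 R 0 A \in V) ->
  exists s : 'rV_3, forall N : 'M_(1 + 3), N \in V ->
    exists A, N *m col_mx s 1%:M = col_mx s 1%:M *m A.
Proof.
move=> sV F1 irrF trF su hF; have [R1 hR1] := hF _ F1.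
(* This shear clears the row R1 beside the identity block, as [four_dim_block] requires, and leaves
   the column blocks unchanged. *)
pose P : 'M[K]_(1 + 3) := block_mx 1%:M (- R1) 0 1%:M.
pose P' : 'M[K]_(1 + 3) := block_mx 1%:M R1 0 1%:M.
have PP' : P *m P' = 1%:M.
  rewrite /P /P' mulmx_block !mul1mx !mulmx1 !mulmx0 !mul0mx !addr0 !add0r subrr.
  by rewrite -scalar_mx_block.
have [uP eP'] : P \in unitmx /\ invmx P = P'.
  have [uP _] := mulmx1_unit PP'; split=> //.
  by rewrite -[RHS](mulKmx uP) PP' mulmx1.
have cE a r c k : conjP P (block_mx a r c k) =
    block_mx (a - R1 *m c) ((a - R1 *m c) *m R1 + (r - R1 *m k)) c (c *m R1 + k).
  rewrite /conjP eP' /P /P' !mulmx_block !mul1mx !mulmx1 !mulmx0 !mul0mx !addr0 !add0r.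
  by rewrite !mulNmx.
have ur := four_dim_block ch3 (spec1_cj uP sV) F1 irrF trF.
exists R1 => N NV; exists (dlsubmx N *m R1 + drsubmx N).
have eN : ursubmx (conjP P N) = 0.
  apply: ur (mem_cj P NV).
  - move=> c; have [M MV Mc] := su c; exists (conjP P M); first exact: mem_cj.
    by rewrite -[M]submxK cE block_mxKdl.
  - have := mem_cj P hR1; rewrite cE !mulmx0 !mulmx1 mul0mx !subrr mul0mx !addr0 add0r.
    by [].
  - move=> A FA; have [R hR] := hF A FA; exists (R - R1 *m A).
    by have := mem_cj P hR; rewrite cE !mulmx0 !subr0 !mul0mx !add0r.
move: eN; rewrite -{1}[N]submxK cE block_mxKur => /eqP; rewrite addrA subr_eq0 => /eqP e.
rewrite -{1}[N]submxK mul_block_col !mulmx1 mul_col_mx mul1mx; congr col_mx.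
by rewrite mulmxDr -e mulmxBl mulmxA addrA [X in _ = X + _]addrC subrK.
Qed.

Lemma struct_block k (V : {vspace 'M[K]_(1 + (3 + k))}) (F : {vspace 'M[K]_3}) :
  gerstenhaber_at f (1 + k) -> exceptional F -> max_spec1 f V -> adapted V (col_mx 1%:M 0) ->
  (forall c, exists2 N, N \in V & dlsubmx N = c) ->
  (forall B : 'M_(3 + k), W1star 0 F B -> exists R, block_mx 0 R 0 B \in V) -> case2 V.
Proof.
move=> Gk eF mV ad su hW; have [sV dV] := mV.
have irrF := @exc_no_stable_line K L f ch3 F eF; have F1 := exc_one f ch3 eF.
set x := col_mx 1%:M 0 : 'cV[K]_(1 + (3 + k)) in ad.
pose y : 'M[K]_(3 + k, 3) := col_mx 1%:M 0.
pose z : 'M[K]_(1 + (3 + k), 3) := col_mx 0 y.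
have rank_z s : \rank (z + x *m s)%R = 3%N.
  apply/eqP; rewrite eqn_leq rank_leq_col /=.
  have : (\rank (row_mx 0 (row_mx 1%:M 0) *m (z + x *m s) : 'M_3)%R <= \rank (z + x *m s)%R)%N.
    exact: mxrankM_maxr.
  rewrite mulmxDr mulmxA /z /x /y !mul_row_col !mul0mx !mulmx0 mulmx1 !addr0 !add0r mul0mx.
  by rewrite addr0 mxrank1.
have hA A : A \in F -> exists R, block_mx 0 R 0 (block_mx A 0 0 0 : 'M_(3 + k)) \in V.
  move=> FA; apply: hW; apply/W1star_block0; rewrite block_mxKul block_mxKdl block_mxKdr.
  by split=> // i j _; rewrite mxE.
suff [s hs] : exists s : 'rV_3, forall N : 'M_(1 + (3 + k)), N \in V ->
    exists A, N *m (z + x *m s) = (z + x *m s) *m A.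
  apply: (@stable_block_struct (1 + k) V F (z + x *m s) Gk eF mV (rank_z s) hs).
  move=> A FA; have [R hR] := hA A FA; exists (block_mx 0 R 0 (block_mx A 0 0 0) : 'M[K]_(1 + (3 + k))) => //.
  have [A' hA'] := hs _ hR; rewrite hA'; congr (_ *m _).
  move: hA'; have -> : z + x *m s = col_mx s y.
    by rewrite /z /x mul_col_mx mul1mx mul0mx add_col_mx add0r addr0.
  rewrite mul_block_col !mul0mx !add0r [col_mx s y *m A']mul_col_mx => /eq_col_mx[_].
  rewrite /y mul_block_col ?mul0mx ?mulmx0 !addr0 mulmx1 mul_col_mx mul1mx ?mul0mx.
  by case/eq_col_mx.
(* For k = 0 no nonzero row annihilates both x and the block, so [four_dim_stable] replaces the
   lifting argument. *)
case: k V hW Gk mV sV dV @x ad su @y hA @z rank_z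
  => [|k] V hW Gk mV sV dV x ad su y hA z rank_z.
  have bA (A : 'M[K]_3) : block_mx A 0 0 0 = A :> 'M_(3 + 0).
    apply/matrixP => i j; case: (split_ordP i) => [i' ->|[]//]; case: (split_ordP j) => [j' ->|[]//].
    by rewrite block_mxEul; congr (A _ _); apply: val_inj.
  have y1 : y = 1%:M.
    apply/matrixP => i j; case: (split_ordP i) => [i' ->|[]//]; rewrite col_mxEu !mxE.
    by rewrite -!val_eqE.
  have zE s : z + x *m s = col_mx s 1%:M.
    by rewrite /z /x mul_col_mx mul1mx mul0mx add_col_mx add0r addr0 y1.
  have trF A : A \in F -> \tr A = 0 := @exc_tr K L f ch3 F eF A.
  have hF A : A \in F -> exists R, block_mx 0 R 0 A \in V.
    by move=> /hA[R hR]; exists R; rewrite -(bA A).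
  have [s hs] := @four_dim_stable V F sV F1 irrF trF su hF.
  by exists s => N NV; rewrite zE; exact: hs.
have rowP' (l : 'rV[K]_(1 + (3 + k.+1))) : l *m x = 0 -> l *m z = 0 ->
    exists l', l = row_mx 0 (row_mx 0 l').
  move=> lx; rewrite (row_x0 lx) mul_row_col mul0mx add0r => lz.
  exists (rsubmx (rsubmx l)); congr row_mx; rewrite -[LHS]hsubmxK; congr row_mx.
  by move: lz; rewrite -{1}[rsubmx l]hsubmxK mul_row_col mulmx1 mulmx0 addr0.
pose l0 : 'rV[K]_(1 + (3 + k.+1)) := row_mx 0 (row_mx 0 (delta_mx 0 0)).
apply: (@stable_block_of_lifts K L f ch3 _ V x sV ad (surj_x0 su) z F l0 F1 irrF).
- move=> u l lx lz; have [l' el] := rowP' l lx lz.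
  have [R hR] : exists R, block_mx 0 R 0 (col_mx u 0 *m row_mx 0 l' : 'M_(3 + k.+1)) \in V.
    apply: hW; apply/W1star_block0; rewrite mul_col_row ?mulmx0 ?mul0mx.
    rewrite block_mxKul block_mxKdl block_mxKdr mem0v; split=> // i j _; by rewrite mxE.
  exists (row_mx 0 R).
  have -> : z *m u = col_mx 0 (col_mx u 0) by rewrite /z /y !mul_col_mx ?mul0mx mul1mx.
  rewrite el; apply: lifted_x0 => //.
  by rewrite mul_row_col mul0mx ?mulmx0 addr0.
- move=> A FA; have [R hR] := hA A FA.
  exists (block_mx 0 R 0 (block_mx A 0 0 0)), (lsubmx R); split=> //.
  + by rewrite mul_block_col ?mul0mx ?mulmx0 !addr0 col_mx0.
  + rewrite /z /y mul_block_col ?mul0mx !add0r mul_block_col ?mul0mx ?mulmx0 !addr0 mulmx1.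
    rewrite !mul_col_mx ?mul0mx ?mul1mx add_col_mx add0r addr0; congr col_mx.
    by rewrite -{1}[R]hsubmxK mul_row_col mulmx1 ?mulmx0 addr0.
  + move=> l lx lz; have [l' ->] := rowP' l lx lz.
    rewrite mul_row_block ?mul0mx ?mulmx0 !add0r mul_row_block ?mul0mx ?mulmx0 !addr0.
    by rewrite !row_mx0.
- apply/eqP; rewrite /l0 -row_mx0 => /eq_row_mx[_]; rewrite -row_mx0 => /eq_row_mx[_ /matrixP/(_ 0 0)/eqP].
  by rewrite !mxE !eqxx oner_eq0.
- by rewrite mul_row_col mul0mx ?mulmx0 addr0.
- by rewrite /l0 /z /y !mul_row_col ?mul0mx ?mulmx0 !addr0.
Qed.

(** Smaller sizes than m also matter: beside a stable block of size 3 there remains a quotient of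
    dimension k + 1, to which [gerstenhaber_at] is applied. *)
Lemma struct_step k : (forall j, (j <= 3 + k)%N -> struct_at f j) ->
  struct_at f (3 + k).+1.
Proof.
set m := (3 + k)%N; have m3 : (3 <= m)%N by rewrite leq_addr.
move=> IH V sV dV; have mV : @max_spec1 K L f (1 + m) V by split.
have eo : (3 <= m)%N -> no_large_nil_subspace f by move=> _; exact: exceptional_no_large_nil.
have Ge j : (j <= m)%N -> gerstenhaber_at f j.
  (* In size 3 the structure theorem would still allow F + K I to be exceptional; [nil_stable_line]
     excludes it. *)
  move=> jm; have [->|nj] := eqVneq j 3%N; last exact: gerstenhaber_of_struct (IH _ jm).
  move=> F nF dF; apply: (gerstenhaber_of_case1 ch3 nF dF).
  have [e ne he] := @nil_stable_line K L f ch3 F nF dF.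
  have mF : @max_spec1 K L f (1 + 2) (F + <[1%:M]>)%VS := @max_add_one K L f 2 F nF dF.
  have st : @stable_line K (1 + 2) (F + <[1%:M]>)%VS.
    exists e => // N /memv_addP[N' NF [_ /vlineP[c ->] ->]].
    have [d hd] := he _ NF; exists (d + c).
    by rewrite scalemx1 mulmxDl mul_scalar_mx hd scalerDl.
  have eo2 : (3 <= 2)%N -> no_large_nil_subspace f by [].
  by have [//|[]] := stable_line_struct ch3 (struct2 ch3) (gerstenhaber2 ch3) eo2 mF st.
have Sm := IH m (leqnn _); have Gm := Ge m (leqnn _).
have fin (P : 'M[K]_(1 + m)) : P \in unitmx -> stable_line (cj P V) -> case1 V \/ case2 V.
  move=> uP /(stable_line_cj uP) st.
  by have [|[_]] := stable_line_struct ch3 Sm Gm eo mV st; [left|right].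
have [P uP [ad su hc]] := normal_form ch3 Sm Gm eo mV.
have [sV' _] := max_cj uP mV.
pose w0 : 'cV[K]_m := delta_mx (ord0 : 'I_k.+3) 0.
have nw0 : w0 != 0.
  by apply/eqP => /matrixP/(_ 0 0)/eqP; rewrite !mxE !eqxx oner_eq0.
have w0l (l : 'rV[K]_m) i j : (w0 *m l) i j = (i == 0)%:R * l 0 j.
  by rewrite mxE big_ord1 mxE eqxx andbT.
have lw0 (l : 'rV[K]_m) : l *m w0 = 0 -> l 0 0 = 0.
  by move=> /(congr1 (fun M : 'M_1 => M 0 0)); rewrite -colE !mxE.
have m1 : (1 < m)%N by apply: leq_trans m3.
case: hc => [[tV _ _]|[p [F [pm eF hW]]]].
  apply: (fin P uP); pose i1 : 'I_m := Ordinal m1; pose i2 : 'I_m := Ordinal m3.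
  (* This elementary matrix kills w0 and does not kill the row of index i1, which vanishes on w0. It
     takes three basis vectors in the quotient. *)
  have [R hR] : exists R, block_mx 0 R 0 (delta_mx i1 i2 : 'M[K]_m) \in cj P V.
    apply: tV => i j ij; rewrite mxE; case: eqP => // e1; case: eqP => // e2.
    by move: ij; rewrite e1 e2.
  apply: (stable_line_x0 (w := w0) (l0 := delta_mx 0 i1) ch3 sV' ad su nw0 _ hR).
  - move=> l /lw0 l0; apply: tV => i j ij; rewrite w0l; case: eqP => [i_0|_]; last by rewrite mul0r.
    have -> : j = 0 by apply: val_inj; apply/eqP; rewrite -leqn0 (leq_trans ij) // i_0.
    by rewrite l0 mulr0.
  - by rewrite mul_delta_mx_0.
  - by rewrite mul_delta_mx_0.
  - rewrite mul_delta_mx; apply/eqP => /matrixP/(_ 0 i2)/eqP.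
    by rewrite !mxE !eqxx oner_eq0.
(* For p > 0 the vector w0 lies before the block; the identity of the block kills w0 but not the row
   of index p, so it serves as the perturbation. *)
have [p0|p_gt0] := posnP p; last first.
  apply: (fin P uP).
  have [R hR] := hW _ (Wemb_W m p (exc_one f ch3 eF)).
  have pm' : (p < m)%N by apply: leq_trans pm; rewrite addn3; lia.
  pose ip : 'I_m := Ordinal pm'.
  have b0 : bk p 0 = 0%N by rewrite /bk p_gt0.
  have bp : bk p p = 1%N by rewrite /bk ltnn -{1}[p]addn0 ltn_add2l.
  apply: (stable_line_x0 (w := w0) (l0 := delta_mx 0 ip) ch3 sV' ad su nw0 _ hR).
  - move=> l /lw0 l0; apply: hW; split.
    + move=> i j; rewrite w0l; case: eqP => [->|_ _]; first by rewrite b0.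
      by rewrite mul0r.
    + move=> i j _ _ ij; rewrite w0l; case: eqP => [i_0|_]; last by rewrite mul0r.
      have -> : j = 0 by apply: val_inj; apply/eqP; rewrite -leqn0 (leq_trans ij) // i_0.
      by rewrite l0 mulr0.
    + exists 0; first exact: mem0v.
      move=> i j bi bj; rewrite w0l mxE; case: eqP => [i_0|_]; last by rewrite mul0r.
      by move: bi; rewrite i_0 b0.
  - rewrite -colE; apply/colP => i; rewrite !mxE b0 andbF.
    by [].
  - by rewrite mul_delta_mx_0 //; apply/eqP => /(congr1 val) /= e; rewrite e in p_gt0.
  - rewrite -rowE; apply/eqP => /matrixP/(_ 0 ip)/eqP.
    by rewrite !mxE /= bp /= ?mxE eqxx oner_eq0.
right; move: pm hW; rewrite p0 => _ hW {p p0}.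
apply: (case2_cj uP).
by apply: (struct_block (Ge _ _) eF (max_cj uP mV)) => //; rewrite /m; lia.
Qed.

Theorem structP n : struct_at f n.
Proof.
elim/ltn_ind: n => -[|[|[|[|k]]]] IH.
- exact: struct0.
- exact: struct1.
- exact: struct2.
- exact: struct3.
- by apply: struct_step => j jk; apply: IH; rewrite ltnS.
Qed.

End BlockAssembly.

(** * Uniqueness *)

Section Uniqueness.
Variable K : fieldType.

Fixpoint killed n (S : 'M[K]_n -> Prop) k (u : 'cV[K]_n) : Prop :=
  if k is k'.+1 then forall M : 'M[K]_n, S M -> killed S k' (M *m u) else u = 0.

Fixpoint killed_row n (S : 'M[K]_n -> Prop) k (v : 'rV[K]_n) : Prop :=
  if k is k'.+1 then forall M : 'M[K]_n, S M -> killed_row S k' (v *m M) else v = 0.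

Definition intertwines n (T : 'M[K]_n) (S S' : 'M[K]_n -> Prop) :=
  T \in unitmx /\ forall M, S M <-> S' (conjP T M).

Lemma intertwines_sym n (T : 'M[K]_n) S S' : intertwines T S S' -> intertwines (invmx T) S' S.
Proof.
move=> [uT h]; split; first by rewrite unitmx_inv.
by move=> M; rewrite h conjPKV.
Qed.

Lemma intertwinesP n (A B C : 'M[K]_n -> Prop) : mx_similar A B -> mx_similar A C ->
  exists T, intertwines T B C.
Proof.
move=> [P uP hP] [Q uQ hQ]; exists (Q *m invmx P).
have uPi : invmx P \in unitmx by rewrite unitmx_inv.
split=> [|M]; first by rewrite unitmx_mul uQ uPi.
rewrite -conjP_comp // -[conjP Q _]/(Q *m _ *m _) -hQ hP -/(conjP P _) conjPKV //.
Qed.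

Lemma killed_conj n (T : 'M[K]_n) S S' k u : intertwines T S S' ->
  killed S k u -> killed S' k (T *m u).
Proof.
move=> [uT h]; elim: k u => [u /= ->|k IH u /= hu M SM]; first by rewrite mulmx0.
have -> : M *m (T *m u) = T *m (conjP (invmx T) M *m u).
  by rewrite /conjP invmxK !mulmxA mulmxV // mul1mx.
by apply: IH; apply: hu; rewrite h conjPKV.
Qed.

Lemma killed_row_conj n (T : 'M[K]_n) S S' k v : intertwines T S S' ->
  killed_row S k v -> killed_row S' k (v *m invmx T).
Proof.
move=> [uT h]; elim: k v => [v /= ->|k IH v /= hv M SM]; first by rewrite mul0mx.
have -> : v *m invmx T *m M = v *m conjP (invmx T) M *m invmx T.
  by rewrite /conjP invmxK -!mulmxA mulmxV // mulmx1.
by apply: IH; apply: hv; rewrite h conjPKV.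
Qed.

Section OneW.
Variables (n p : nat) (F : {vspace 'M[K]_3}).
Hypotheses (pn : (p + 3 <= n)%N) (F1 : 1%:M \in F).

Lemma W1star_delta (i j : 'I_n) : (bk p i < bk p j)%N -> W1star p F (delta_mx i j).
Proof.
move=> ij; split=> [a b|a b _|].
- rewrite mxE; case: eqP => // ->; case: eqP => // -> /=.
  by move=> /(ltn_trans ij); rewrite ltnn.
- rewrite mxE; case: eqP => // ->; case: eqP => //= -> e.
  by move: ij; rewrite e ltnn.
- exists 0; first exact: mem0v.
  move=> a b; rewrite !mxE; case: eqP => // ->; case: eqP => //= -> e1 e2.
  by move: ij; rewrite e1 e2.
Qed.

Lemma delta_mulcol (i j : 'I_n) (u : 'cV[K]_n) a b :
  (delta_mx i j *m u) a b = (a == i)%:R * u j b.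
Proof.
rewrite mxE (bigD1 j) //= mxE eqxx andbT big1 ?addr0 // => k nk.
by rewrite mxE (negbTE nk) andbF mul0r.
Qed.

Lemma mulrow_delta (i j : 'I_n) (v : 'rV[K]_n) a b :
  (v *m delta_mx i j) a b = v a i * (b == j)%:R.
Proof.
rewrite mxE (bigD1 i) //= mxE eqxx /= big1 ?addr0 // => k nk.
by rewrite mxE (negbTE nk) mulr0.
Qed.

Lemma Wemb_one_mid (i j : 'I_n) : bk p i = 1%N -> bk p j = 1%N -> Wemb n p 1%:M i j = (i == j)%:R :> K.
Proof.
move=> bi bj; rewrite Wemb_mid // mxE; congr (nat_of_bool _)%:R.
have [i' ei] := mid_bk bi; have [j' ej] := mid_bk bj.
by rewrite -[i == j]val_eqE /= ei ej !addKn !inord_val eqn_add2l.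
Qed.

Lemma bk_ge (i : nat) : (p <= i)%N -> bk p i != 1%N -> bk p i = 2%N /\ (p + 3 <= i)%N.
Proof. by rewrite /bk => h; rewrite ltnNge h /=; case: ltnP. Qed.
Lemma bk_lt (i : nat) : (i < p + 3)%N -> bk p i != 1%N -> bk p i = 0%N /\ (i < p)%N.
Proof. by rewrite /bk => ->; case: ltnP. Qed.

(** The identity of F preserves the coordinates in the block, and an elementary matrix brings any
    later coordinate into it, so neither can be killed. On the first p coordinates each factor acts
    strictly triangularly. *)
Lemma killed_W (u : 'cV[K]_n) :
  (exists k, killed (W1star p F) k u) <-> forall i : 'I_n, (p <= i)%N -> u i 0 = 0.
Proof.
split=> [[k]|h].
  elim: k u => [u -> i _|k IH u hu i ip]; first by rewrite mxE.
  have [bi|/(bk_ge ip)[bi _]] := eqVneq (bk p i) 1%N.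
    have := IH _ (hu _ (Wemb_W n p F1)) i ip; rewrite mxE (bigD1 i) //= big1.
      by rewrite addr0 Wemb_one_mid // eqxx mul1r.
    move=> j ji; have [bj|bj] := eqVneq (bk p j) 1%N.
      by rewrite Wemb_one_mid // eq_sym (negbTE ji) mul0r.
    by rewrite mxE (negbTE bj) andbF mul0r.
  have pl : (p < n)%N by apply: leq_trans pn; rewrite addn3; lia.
  have bp : bk p (Ordinal pl) = 1%N by rewrite -[LHS]/(bk p p) -{2}[p]addn0 (bk_mid p 0).
  have Wd : W1star p F (delta_mx (Ordinal pl) i) by apply: W1star_delta; rewrite bp bi.
  by have := IH _ (hu _ Wd) (Ordinal pl) (leqnn _); rewrite delta_mulcol eqxx mul1r.
exists p; suff : forall k, (k <= p)%N -> forall u : 'cV[K]_n, (forall i : 'I_n, (k <= i)%N -> u i 0 = 0) ->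
    killed (W1star p F) k u by apply.
elim=> [_ w hw|k IH kp w hw M [W1 W2 _]] /=.
  by apply/colP => i; rewrite mxE hw.
apply: IH => [|i ki]; first exact: ltnW.
rewrite mxE big1 // => j _; have [jk|kj] := leqP j k; last by rewrite hw // mulr0.
have bj : bk p j = 0%N by rewrite /bk (leq_ltn_trans jk kp).
have [bi|bi] := eqVneq (bk p i) 0%N; last by rewrite W1 ?mul0r // bj lt0n.
by rewrite W2 ?mul0r ?bi ?bj // (leq_trans jk).
Qed.

Lemma killed_row_W (v : 'rV[K]_n) :
  (exists k, killed_row (W1star p F) k v) <-> forall i : 'I_n, (i < p + 3)%N -> v 0 i = 0.
Proof.
split=> [[k]|h].
  elim: k v => [v -> i _|k IH v hv i ip]; first by rewrite mxE.
  have [bi|/(bk_lt ip)[bi _]] := eqVneq (bk p i) 1%N.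
    have := IH _ (hv _ (Wemb_W n p F1)) i ip; rewrite mxE (bigD1 i) //= big1.
      by rewrite addr0 Wemb_one_mid // eqxx mulr1.
    move=> j ji; have [bj|bj] := eqVneq (bk p j) 1%N.
      by rewrite Wemb_one_mid // (negbTE ji) mulr0.
    by rewrite mxE (negbTE bj) mulr0.
  have pl : (p < n)%N by apply: leq_trans pn; rewrite addn3; lia.
  have bp : bk p (Ordinal pl) = 1%N by rewrite -[LHS]/(bk p p) -{2}[p]addn0 (bk_mid p 0).
  have Wd : W1star p F (delta_mx i (Ordinal pl)) by apply: W1star_delta; rewrite bp bi.
  have := IH _ (hv _ Wd) (Ordinal pl); rewrite mulrow_delta eqxx mulr1; apply.
  by rewrite /= -{1}[p]addn0 ltn_add2l.
exists (n - (p + 3))%N.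
suff : forall k, (k <= n - (p + 3))%N -> forall v : 'rV[K]_n,
    (forall i : 'I_n, (i + k < n)%N -> v 0 i = 0) -> killed_row (W1star p F) k v.
  by apply=> // i hi; apply: h; lia.
elim=> [_ w hw|k IH kp w hw M [W1 W2 _]] /=.
  by apply/rowP => i; rewrite mxE hw ?addn0.
apply: IH => [|j kj]; first exact: ltnW.
rewrite mxE big1 // => i _; have [ik|ki] := ltnP (i + k.+1) n; first by rewrite hw // mul0r.
have bi : bk p i = 2%N by rewrite /bk !ifF //; apply/negbTE; lia.
have ji : (j <= i)%N by lia.
have [bj|bj] := eqVneq (bk p j) 2%N; first by rewrite W2 ?mulr0 ?bi ?bj.
by rewrite W1 ?mulr0 // bi; move: bj; rewrite /bk; case: ifP => // _; case: ifP.
Qed.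

End OneW.

Lemma intertwines_low n (T : 'M[K]_n) p p' (F F' : {vspace 'M[K]_3}) : (p + 3 <= n)%N -> (p' + 3 <= n)%N ->
  1%:M \in F -> 1%:M \in F' -> intertwines T (W1star p F) (W1star p' F') ->
  forall i j : 'I_n, (p' <= i)%N -> (j < p)%N -> T i j = 0.
Proof.
move=> pn pn' F1 F1' hT i j ip jp.
have [k hk] : exists k, killed (W1star p F) k (delta_mx j 0).
  apply/(killed_W pn F1) => a pa; rewrite mxE andbT.
  by case: eqP => // e; move: pa; rewrite e leqNgt jp.
have /(killed_W pn' F1')/(_ i ip) : exists k, killed (W1star p' F') k (T *m delta_mx j 0).
  by exists k; exact: killed_conj hT hk.
by rewrite -colE mxE.
Qed.

Lemma intertwines_high n (T : 'M[K]_n) p p' (F F' : {vspace 'M[K]_3}) : (p + 3 <= n)%N -> (p' + 3 <= n)%N ->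
  1%:M \in F -> 1%:M \in F' -> intertwines T (W1star p F) (W1star p' F') ->
  forall i j : 'I_n, (p + 3 <= i)%N -> (j < p' + 3)%N -> invmx T i j = 0.
Proof.
move=> pn pn' F1 F1' hT i j ip jp.
have [k hk] : exists k, killed_row (W1star p F) k (delta_mx 0 i).
  apply/(killed_row_W pn F1) => a pa; rewrite mxE /=.
  by case: eqP => // e; move: pa; rewrite e ltnNge ip.
have /(killed_row_W pn' F1')/(_ j jp) :
    exists k, killed_row (W1star p' F') k (delta_mx 0 i *m invmx T).
  by exists k; exact: killed_row_conj hT hk.
by rewrite -rowE mxE.
Qed.

(** T maps the span of the first p basis vectors injectively into that of the first p'; the
    projections [pid_mx] turn this into a comparison of ranks. *)
Lemma intertwines_leq n (T : 'M[K]_n) p p' (F F' : {vspace 'M[K]_3}) : (p + 3 <= n)%N -> (p' + 3 <= n)%N ->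
  1%:M \in F -> 1%:M \in F' -> intertwines T (W1star p F) (W1star p' F') -> (p <= p')%N.
Proof.
move=> pn pn' F1 F1' hT; have low := intertwines_low pn pn' F1 F1' hT; have [uT _] := hT.
have e : T *m pid_mx p = pid_mx p' *m (T *m pid_mx p) :> 'M_n.
  have eT i j : (T *m pid_mx p : 'M[K]_n) i j = T i j * (j < p)%:R.
    rewrite mxE (bigD1 j) //= mxE eqxx big1 ?addr0 // => k nk.
    by rewrite mxE (negbTE (nk : val k != val j)) mulr0.
  apply/matrixP => i j; rewrite eT [RHS]mxE (bigD1 i) //= eT mxE eqxx big1 ?addr0.
    have [ip|ip] := ltnP i p'; first by rewrite mul1r.
    by case: (ltnP j p) => jp; rewrite ?mulr0 // low // mul0r mul0r.
  move=> k nk; rewrite mxE eq_sym (negbTE (nk : val k != val i)) mul0r.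
  by [].
have := mxrankM_maxl (pid_mx p' : 'M[K]_n) (T *m pid_mx p : 'M[K]_n).
rewrite -e; have -> : \rank (T *m pid_mx p : 'M[K]_n) = p.
  by rewrite (eqmxMfull _ (_ : row_full T)) ?row_full_unit // rank_pid_mx //; lia.
by rewrite rank_pid_mx //; lia.
Qed.

Lemma mid_lt n p (pn : (p + 3 <= n)%N) (i : 'I_3) : (p + i < n)%N.
Proof. by apply: leq_trans pn; rewrite ltn_add2l. Qed.

Definition mid n p (pn : (p + 3 <= n)%N) (i : 'I_3) : 'I_n := Ordinal (mid_lt pn i).

Lemma Wext_entry n p (pn : (p + 3 <= n)%N) (M : 'M[K]_n) i j :
  Wext p M i j = M (mid pn i) (mid pn j).
Proof.
have ins (a : 'I_3) : insub (p + a)%N = Some (mid pn a) :> option 'I_n by exact: insubT.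
by rewrite mxE !ins.
Qed.

Lemma bk_midE n p (pn : (p + 3 <= n)%N) i : bk p (mid pn i) = 1%N.
Proof. exact: bk_mid. Qed.

Lemma Wemb_entry n p (pn : (p + 3 <= n)%N) (A : 'M[K]_3) i j :
  Wemb n p A (mid pn i) (mid pn j) = A i j.
Proof. by rewrite -Wext_entry Wext_emb. Qed.

Lemma sum_mid n p (pn : (p + 3 <= n)%N) (G : 'I_n -> K) :
  (forall k : 'I_n, bk p k != 1%N -> G k = 0) -> \sum_k G k = \sum_a G (mid pn a).
Proof.
move=> G0; rewrite (bigID (fun k : 'I_n => bk p k == 1%N)) /= [X in _ + X]big1; last first.
  by move=> k; exact: G0.
rewrite addr0 (reindex (mid pn)).
  by apply: eq_bigl => a; rewrite bk_midE eqxx.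
exists (fun k : 'I_n => inord (k - p)) => k.
  by move=> _; rewrite /= addKn inord_val.
rewrite inE => /eqP/mid_bk[a e]; apply: val_inj => /=.
by rewrite e addKn inord_val.
Qed.

Lemma Wext_mul n p (A B : 'M[K]_n) : (p + 3 <= n)%N ->
  (forall i j : 'I_n, bk p i = 1%N -> (j < p)%N -> A i j = 0) ->
  (forall i j : 'I_n, (p + 3 <= i)%N -> bk p j = 1%N -> B i j = 0) ->
  Wext p (A *m B) = Wext p A *m Wext p B.
Proof.
move=> pn A0 B0; apply/matrixP => i j; rewrite (Wext_entry pn) !mxE (sum_mid pn).
  by apply: eq_bigr => a _; rewrite !(Wext_entry pn).
move=> k bk1; have [kp|pk] := ltnP k p; first by rewrite A0 ?bk_midE ?mul0r.
by have [_ h] := bk_ge pk bk1; rewrite B0 ?bk_midE ?mulr0.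
Qed.

(** The zeros of T to the left of the block and those of its inverse below it are what [Wext_mul]
    needs, so the middle block of T conjugates F into F'. *)
Lemma intertwines_middle n (T : 'M[K]_n) p (F F' : {vspace 'M[K]_3}) : (p + 3 <= n)%N ->
  1%:M \in F -> 1%:M \in F' -> intertwines T (W1star p F) (W1star p F') ->
  Wext p T *m Wext p (invmx T) = 1%:M /\
  forall A, A \in F -> Wext p T *m A *m Wext p (invmx T) \in F'.
Proof.
move=> pn F1 F1' hT; have low := intertwines_low pn pn F1 F1' hT.
have high := intertwines_high pn pn F1 F1' hT; have [uT h] := hT.
have bk1 (i : 'I_n) : bk p i = 1%N -> (p <= i < p + 3)%N.
  by rewrite /bk; case: ltnP => // _; case: ltnP.
have T0 (i j : 'I_n) : bk p i = 1%N -> (j < p)%N -> T i j = 0.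
  by move=> /bk1/andP[ip _]; exact: low.
have Ti0 (i j : 'I_n) : (p + 3 <= i)%N -> bk p j = 1%N -> invmx T i j = 0.
  by move=> ip /bk1/andP[_ jp]; exact: high.
split.
  rewrite -Wext_mul // mulmxV //; apply/matrixP => i j; rewrite (Wext_entry pn) !mxE.
  by rewrite -val_eqE /= eqn_add2l.
move=> A FA; have := W1star_ext pn ((h _).1 (Wemb_W n p FA)).
rewrite /conjP Wext_mul //; first rewrite Wext_mul ?Wext_emb //.
- move=> i j ip bj; rewrite mxE (gtn_eqF _) //.
  by rewrite /bk !ifF //; lia.
- move=> i j bi jp; rewrite mxE big1 // => k _.
  by rewrite mxE [bk p j]/bk jp andbF mulr0.
Qed.

Lemma W1star_unique n (V : 'M[K]_n -> Prop) p p' (F F' : {vspace 'M[K]_3}) :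
  (p + 3 <= n)%N -> (p' + 3 <= n)%N -> 1%:M \in F -> 1%:M \in F' ->
  mx_similar V (W1star p F) -> mx_similar V (W1star p' F') ->
  p = p' /\ mx_similar (fun M => M \in F) (fun M => M \in F').
Proof.
move=> pn pn' F1 F1' hp hp'; have [T hT] := intertwinesP hp hp'.
have hT' := intertwines_sym hT.
have ep : p = p'.
  apply/eqP; rewrite eqn_leq (intertwines_leq pn pn' F1 F1' hT).
  exact: intertwines_leq pn' pn F1' F1 hT'.
subst p'; split=> //.
have [TT hF] := intertwines_middle pn F1 F1' hT.
have [_ hF'] := intertwines_middle pn F1' F1 hT'.
have [uQ uX] := mulmx1_unit TT.
have eX : Wext p (invmx T) = invmx (Wext p T) by rewrite -(mulKmx uQ (Wext p (invmx T))) TT mulmx1.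
exists (Wext p T) => // M; rewrite -eX; split=> [|/hF']; first exact: hF.
by rewrite invmxK eX !mulmxA mulVmx // mul1mx mulmxKV.
Qed.

(** T carries the standard flag to one stable under [W1star p F]. Its first column outside the span
    of the first p basis vectors is a common eigenvector modulo that span, and its middle
    coordinates give a stable line of F. *)
Lemma V1star_not_W1star n (I : {set 'I_n}) p (F : {vspace 'M[K]_3}) (V : 'M[K]_n -> Prop) :
  (p + 3 <= n)%N -> no_stable_line F ->
  mx_similar V (V1star I) -> mx_similar V (W1star p F) -> False.
Proof.
move=> pn irrF hI hp; have [T [uT h]] := intertwinesP hI hp.
have pl : (p < n)%N by apply: leq_trans pn; rewrite addn3; lia.
have [k1 k1P] : exists k1 : 'I_n, T (Ordinal pl) k1 != 0.
  apply/existsP; apply: contraT; rewrite negb_exists => /forallP h0.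
  have /matrixP/(_ (Ordinal pl) (Ordinal pl))/eqP := mulmxV uT.
  rewrite !mxE eqxx big1 ?(eq_sym 0) ?oner_eq0 // => k _.
  by move/negPn/eqP: (h0 k) => ->; rewrite mul0r.
pose P (k : 'I_n) := [exists i : 'I_n, (p <= i)%N && (T i k != 0)].
have Pk1 : P k1 by apply/existsP; exists (Ordinal pl); rewrite leqnn.
have [k /existsP[i0 /andP[pi0 nz]] kmin] := arg_minnP (fun k : 'I_n => k : nat) Pk1.
have col0 (i j : 'I_n) : (p <= i)%N -> (j < k)%N -> T i j = 0.
  move=> ip jk; apply/eqP; apply: contraTT jk => nT; rewrite -leqNgt; apply: kmin.
  by apply/existsP; exists i; rewrite ip.
have key M : W1star p F M -> exists c, forall i : 'I_n, (p <= i)%N ->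
    (M *m col k T) i 0 = c * T i k.
  move=> WM; have VN : V1star I (conjP (invmx T) M) by apply/h; rewrite conjPKV.
  exists (conjP (invmx T) M k k) => i ip.
  have -> : M *m col k T = T *m col k (conjP (invmx T) M).
    by rewrite !colE /conjP invmxK !mulmxA mulmxV // mul1mx.
  rewrite mxE (bigD1 k) //= big1 ?addr0; first by rewrite mxE mulrC.
  move=> j jk; rewrite [col k _ _ _]mxE; have [lt|ge] := ltnP j k; first by rewrite col0 ?mul0r.
  by rewrite (V1star_upper VN) ?mulr0 // ltn_neqAle ge andbT eq_sym.
(* The elementary matrix that moves coordinate i into the block has zero row i, so a nonzero T i k
   forces the eigenvalue 0; yet the moved coordinate is T i k itself. *)
have hi (i : 'I_n) : (p + 3 <= i)%N -> T i k = 0.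
  move=> ip; apply/eqP/negPn/negP => nTi.
  have bi : bk p i = 2%N by rewrite /bk !ifF //; lia.
  have [c hc] : exists c, forall a : 'I_n, (p <= a)%N ->
      (delta_mx (mid pn 0) i *m col k T) a 0 = c * T a k.
    by apply: key; apply: W1star_delta; rewrite bk_midE bi.
  have pi : (p <= i)%N by lia.
  have dE := delta_mulcol (mid pn 0) i (col k T).
  have := hc i pi; rewrite dE (_ : i == _ = false) ?mul0r.
    move/esym/eqP; rewrite mulf_eq0 (negbTE nTi) orbF => /eqP c0.
    have := hc (mid pn 0) (leq_addr _ _); rewrite dE eqxx mul1r c0 mul0r mxE => e.
    by rewrite e eqxx in nTi.
  by apply/eqP => e; move: ip; rewrite e /= addn0; lia.
pose w : 'cV[K]_3 := \col_a T (mid pn a) k.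
apply: (irrF w).
  have bi0 : bk p i0 = 1%N.
    have [//|/(bk_ge pi0)[_ h3]] := eqVneq (bk p i0) 1%N.
    by rewrite hi ?eqxx in nz.
  have [a ea] := mid_bk bi0.
  apply/eqP => /matrixP/(_ a 0); rewrite !mxE => e.
  by move: nz; rewrite -e (_ : i0 = mid pn a) ?e ?eqxx //; exact: val_inj.
move=> A FA; have [c hc] := key _ (Wemb_W n p FA); exists c.
apply/colP => a; have := hc (mid pn a) (leq_addr _ _).
rewrite mxE (sum_mid pn) => [e|j bj]; last by rewrite mxE (negbTE bj) andbF mul0r.
rewrite !mxE -e; apply: eq_bigr => b _; by rewrite Wemb_entry !mxE.
Qed.

End Uniqueness.

Theorem mainTheorem6 (K : fieldType) (n : nat) (V : {vspace 'M[K]_n}) :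
  3%N \in [pchar K] -> (1 <= n)%N ->
  \dim V = (binomial n 2 + 1)%N ->
  at_most_one_nonzero_eigenvalue (fun M => M \in V) ->
  let case1 := exists2 I : {set 'I_n}, I != set0 &
                 mx_similar (fun M => M \in V) (V1star I) in
  let case2 := exists p : nat, exists2 F : {vspace 'M[K]_3},
                 (p + 3 <= n)%N /\ exceptional F &
                 mx_similar (fun M => M \in V) (W1star p F) in
  [/\ case1 \/ case2, ~ (case1 /\ case2) &
      forall (p p' : nat) (F F' : {vspace 'M[K]_3}),
        (p + 3 <= n)%N -> (p' + 3 <= n)%N -> exceptional F -> exceptional F' ->
        mx_similar (fun M => M \in V) (W1star p F) ->
        mx_similar (fun M => M \in V) (W1star p' F') ->
        p = p' /\ mx_similar (fun M => M \in F) (fun M => M \in F')].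
Proof.
move=> ch3 _ dV sV c1 c2; have [L [f]] := exists_closed_extension K; split.
- by apply: (structP (f := f) ch3 _ dV) => M MV a b; exact: sV.
- move=> [[I _ hI] [p [F [pn eF] hp]]].
  exact: V1star_not_W1star pn (@exc_no_stable_line K L f ch3 F eF) hI hp.
- move=> p p' F F' pn pn' eF eF'; by apply: W1star_unique => //; apply: (exc_one f ch3).
Qed.
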